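(* Let $\mathcal G$ be a locally finite metric tree of finite inradius with a centre vertex $v_c$, and let $\mathfrak V=\mathfrak C(\mathcal G)\cup\{v\in V:\deg(v)=1,\ v\ne v_c\}$. Then the lowest eigenvalue $\lambda_1(\mathcal G,\mathfrak V)$ of $\mathcal H_{\mathfrak V}$ satisfies $$\lambda_1(\mathcal G,\mathfrak V)\ge\frac{\pi^2}{4\,\mathrm{Inr}(\mathcal G,\mathfrak V)^2}.$$ Equality holds if and only if $\mathcal G$ is an equilateral star graph with Dirichlet conditions at all degree one vertices.
   Context: A metric graph $\mathcal G$ is given by finite or countably infinite sets $V$ of vertices and $E$ of edges, each edge $e$ having a length $\ell_e\in(0,\infty)$; it is obtained from the disjoint union of intervals $[0,\ell_e]$ by gluing endpoints at the vertices. It carries the shortest-path metric and the sum of the Lebesgue measures on the edges. It is locally finite if every vertex has finite degree. It is a tree if it is connected and contains no cycles. Inserting or deleting finitely many vertices of degree two does not affect the metric structure or the operators considered. Ends: consider sequences $(U_n)$ of non-empty open connected subsets of $\mathcal G$ with compact boundary, $U_{n+1}\subset U_n$, $\bigcap_n\overline{U_n}=\emptyset$; $(U_n),(U_n')$ are equivalent if for each $n$ there are $j,k$ with $U_j'\subset U_n$, $U_k\subset U_n'$. An end is an equivalence class; $\mathfrak C(\mathcal G)$ is the set of ends. On a tree, the distance $\mathrm{dist}(x,\gamma)$ from a point $x$ to an end $\gamma$ is the length of the unique ray from $x$ to $\gamma$. Inradius: $\mathrm{Inr}(\mathcal G,\mathfrak V)=\sup\{\mathrm{dist}_{\mathcal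 G}(x,\mathfrak V):x\in\mathcal G\}$. Centre vertex: a vertex $v_c$ such that, with $\mathfrak V=\mathfrak C(\mathcal G)\cup\{v\in V:\deg(v)=1,\ v\ne v_c\}$, one has $\mathrm{dist}(v_c,\gamma_1)=\mathrm{dist}(v_c,\gamma_2)$ for all $\gamma_1,\gamma_2\in\mathfrak V$. $H^1(\mathcal G)$ is the space of continuous $f$ on $\mathcal G$ with $f_e\in H^1(0,\ell_e)$ for every edge and $\sum_e\|f_e\|^2_{H^1(0,\ell_e)}<\infty$; each such $f$ has a value at each end $\gamma$, $f(\gamma)=\lim f(x_n)$ for any $x_n\in U_n$, $(U_n)$ representing $\gamma$. $H^1_0(\mathcal G;\mathfrak V)=\{f\in H^1(\mathcal G):f(v)=0\ \forall v\in\mathfrak V\}$. $\mathcal H_{\mathfrak V}$ is the self-adjoint operator on $L^2(\mathcal G)$ associated with $f\mapsto\int_{\mathcal G}|f'|^2dx$ on $H^1_0(\mathcal G;\mathfrak V)$, and $\lambda_1(\mathcal G,\mathfrak V)=\inf\{\int|f'|^2/\int|f|^2:0\ne f\in H^1_0(\mathcal G;\mathfrak V)\}$ is its lowest eigenvalue; one says that Dirichlet conditions are imposed at the points of $\mathfrak V$. An equilateral star graph consists of finitely many edges of equal length glued together at one common vertex.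
   Formalization: Equality case: the star is taken up to isometry; an edge may be cut by infinitely many degree-two vertices, its tip then being a Dirichlet end (e.g. path with edge lengths 2^-n), and for a one-edge star the centre vertex carries no Dirichlet condition; else the equivalence fails. *)

(* Defs.v *)
From HB Require Import structures.
From mathcomp Require Import finmap.
From mathcomp Require Import all_boot all_order all_algebra.
From mathcomp Require Import all_classical all_reals all_analysis.
Import Order.TTheory GRing.Theory Num.Theory numFieldNormedType.Exports.

Set Implicit Arguments.
Unset Strict Implicit.
Unset Printing Implicit Defensive.

Local Open Scope classical_set_scope.
Local Open Scope ring_scope.

(* Loops and multiple edges are allowed; [src]/[tgt] fix the parametrisation
   of an edge by [0, len e] and carry no orientation of the graph.  Being of
   type countType makes the sets of vertices and edges finite or countable. *)
Record metric_graph (R : realType) := MetricGraph {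
  vertex : countType;
  edge : countType;
  src : edge -> vertex;
  tgt : edge -> vertex;
  len : edge -> R;
  len_gt0 : forall e, 0 < len e
}.

Section Graph.
Variables (R : realType) (G : metric_graph R).

Definition half_edge : Type := (edge G * bool)%type.

Definition hsrc (h : half_edge) : vertex G := if h.2 then src h.1 else tgt h.1.
Definition htgt (h : half_edge) : vertex G := if h.2 then tgt h.1 else src h.1.

Definition star_at (v : vertex G) : set (edge G * bool)%type :=
  [set h | hsrc h = v].

Definition locally_finite : Prop := forall v, finite_set (star_at v).

(* A loop counts twice; the value is 0 at vertices of infinite degree. *)
Definition deg (v : vertex G) : nat := #|` fset_set (star_at v)|.

Fixpoint walk (v : vertex G) (p : seq half_edge) (w : vertex G) : Prop :=
  if p is h :: q then hsrc h = v /\ walk (htgt h) q w else v = w.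

Definition cycle_at (v : vertex G) (p : seq half_edge) : Prop :=
  [/\ p <> [::], walk v p v, uniq (map hsrc p) & uniq (map fst p)].

Definition is_tree : Prop :=
  (forall v w, exists p, walk v p w) /\ (forall v p, ~ cycle_at v p).

(* Each point of the glued space has exactly one representative here: a vertex,
   or a position strictly inside an edge. *)
Definition gpoint : Type :=
  (vertex G + {p : edge G * R | 0 < p.2 < len p.1})%type.

HB.instance Definition _ := Choice.on gpoint.

Definition vpoint (v : vertex G) : gpoint := inl v.

(* The quotient map on the interval [0, len e], extended constantly to R. *)
Definition edge_point (e : edge G) (t : R) : gpoint :=
  if insub (e, t) is Some p then inr p
  else vpoint (if t <= 0 then src e else tgt e).

(* A path is a finite list of segments (e, s, t), each running inside the edge
   e from position s to position t. *)
Fixpoint is_path (x : gpoint) (p : seq (edge G * R * R)) (y : gpoint) : Prop :=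
  if p is (e, s, t) :: q then
    [/\ 0 <= s <= len e, 0 <= t <= len e, x = edge_point e s
      & is_path (edge_point e t) q y]
  else x = y.

Definition path_length (p : seq (edge G * R * R)) : R :=
  \sum_(a <- p) `|a.2 - a.1.2|.

Definition dist (x y : gpoint) : \bar R :=
  ereal_inf [set (path_length p)%:E | p in [set p | is_path x p y]].

Definition metric_open (U : set gpoint) : Prop :=
  forall x, U x -> exists2 r : R, 0 < r &
    forall y, (dist x y < r%:E)%E -> U y.

Lemma metric_openT : metric_open setT.
Proof. by move=> x _; exists 1. Qed.

Lemma metric_openI : setI_closed metric_open.
Proof.
move=> A B oA oB x [/oA[r r0 rA] /oB[s s0 sB]].
exists (Num.min r s); first by rewrite lt_min r0.
move=> y xy; split; [apply: rA|apply: sB]; apply: (lt_le_trans xy);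
  by rewrite lee_fin ge_min lexx ?orbT.
Qed.

Lemma metric_open_bigU (I : Type) (F : I -> set gpoint) :
  (forall i, metric_open (F i)) -> metric_open (\bigcup_i F i).
Proof.
move=> oF x [i _ /oF[r r0 rF]]; exists r => // y /rF Fy.
by exists i.
Qed.

HB.instance Definition _ := isOpenTopological.Build gpoint
  metric_openT metric_openI metric_open_bigU.

Definition end_seq (U : nat -> set gpoint) : Prop :=
  [/\ forall n, [/\ U n !=set0, open (U n), connected (U n)
                  & compact (closure (U n) `\` interior (U n))],
      forall n, U n.+1 `<=` U n
    & \bigcap_n closure (U n) = set0].

Definition end_equiv (U U' : nat -> set gpoint) : Prop :=
  forall n, exists j k, U' j `<=` U n /\ U k `<=` U' n.

Definition ends : set (set (nat -> set gpoint)) :=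
  [set c | exists2 U, end_seq U & c = [set U' | end_seq U' /\ end_equiv U U']].

Definition end_value (T : topologicalType) (f : gpoint -> T)
    (c : set (nat -> set gpoint)) (a : T) : Prop :=
  forall (U : nat -> set gpoint) (x : nat -> gpoint),
    c U -> (forall n, U n (x n)) -> f (x n) @[n --> \oo] --> a.

(* [r], restricted to [0, l), is the arc length parametrisation of a ray of
   length [l], possibly infinite, from [x] to the end [c].  On a tree the paths
   without backtracking are the geodesic ones. *)
Definition is_ray (x : gpoint) (c : set (nat -> set gpoint))
    (l : \bar R) (r : R -> gpoint) : Prop :=
  [/\ r 0 = x,
      forall s t, 0 <= s -> 0 <= t -> (s%:E < l)%E -> (t%:E < l)%E ->
        dist (r s) (r t) = `|s - t|%:E
    & forall U n, c U -> exists t0, [/\ 0 <= t0, (t0%:E < l)%E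
        & forall t, t0 <= t -> (t%:E < l)%E -> U n (r t)]].

(* On a tree the ray is unique, so the infimum is over a single length. *)
Definition dist_end (x : gpoint) (c : set (nat -> set gpoint)) : \bar R :=
  ereal_inf [set l | exists r, is_ray x c l r].

(* The points that can carry a Dirichlet condition: vertices and ends. *)
Definition bpoint : Type := (vertex G + set (nat -> set gpoint))%type.

Definition bdist (x : gpoint) (b : bpoint) : \bar R :=
  match b with inl v => dist x (vpoint v) | inr c => dist_end x c end.

Definition bvalue (f : gpoint -> R) (b : bpoint) (a : R) : Prop :=
  match b with inl v => f (vpoint v) = a | inr c => end_value f c a end.

Definition inradius (D : set bpoint) : \bar R :=
  ereal_sup [set ereal_inf [set bdist x b | b in D] | x in [set: gpoint]].

Definition dirichlet_set (vc : vertex G) : set bpoint :=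
  [set b | match b with
           | inl v => deg v = 1%N /\ v <> vc
           | inr c => ends c
           end].

Definition centre_vertex (vc : vertex G) : Prop :=
  forall b1 b2, dirichlet_set vc b1 -> dirichlet_set vc b2 ->
    bdist (vpoint vc) b1 = bdist (vpoint vc) b2.

Local Notation mu := (@lebesgue_measure R).

(* [u] lies in H^1(0, l) with derivative [g]: it is absolutely continuous on
   [0, l], i.e. an indefinite integral of [g], and [g] is square integrable. *)
Definition H1_derivative (l : R) (u g : R -> R) : Prop :=
  [/\ measurable_fun `[0, l] g,
      (\int[mu]_(t in `[0%R, l]) ((g t) ^+ 2)%:E < +oo)%E
    & forall t, 0 <= t <= l -> u t = u 0 + \int[mu]_(s in `[0, t]) g s].

Definition sqint (h : edge G -> R -> R) : \bar R :=
  (\esum_(e in [set: edge G])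
     \int[mu]_(t in `[0%R, len e]) (((h e t) ^+ 2)%R)%:E)%E.

Definition on_edges (f : gpoint -> R) (e : edge G) (t : R) : R :=
  f (edge_point e t).

(* f belongs to H^1 of the graph and has derivative g. *)
Definition H1_with (f : gpoint -> R) (g : edge G -> R -> R) : Prop :=
  [/\ continuous f,
      forall e, H1_derivative (len e) (on_edges f e) (g e)
    & (sqint (on_edges f) + sqint g < +oo)%E].

Definition H10_with (D : set bpoint) (f : gpoint -> R) (g : edge G -> R -> R) :
  Prop := H1_with f g /\ forall b, D b -> bvalue f b 0.

(* The derivative g is unique almost everywhere, so each f contributes a single
   Rayleigh quotient. *)
Definition lambda1 (D : set bpoint) : \bar R :=
  ereal_inf [set q | exists f g,
    [/\ H10_with D f g, (exists x, f x <> 0)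
      & q = (fine (sqint g) / fine (sqint (on_edges f)))%:E]].

End Graph.

Arguments vpoint {R G} v.

(* k edges of length L: the common vertex is None, the outer ones are Some i. *)
Definition star_graph (R : realType) (k : nat) (L : R) (L0 : 0 < L) :
    metric_graph R :=
  @MetricGraph R (option 'I_k) 'I_k (fun=> None) Some (fun=> L) (fun=> L0).

(* The pair (G, D) is an equilateral star graph with Dirichlet conditions at the
   outer vertices of its edges.  Vertices of degree two are immaterial, so this
   is up to isometry.  Infinitely many of them may subdivide an edge of the star;
   the outer vertex of that edge is then not a point of G but an end of G, at
   finite distance.  When k = 1 the common vertex also has degree one, and it is
   the other vertex that is meant. *)
Definition is_equilateral_star (R : realType) (G : metric_graph R)
    (D : set (bpoint G)) : Prop :=
  exists (k : nat) (L : R) (L0 : 0 < L)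
         (phi : gpoint G -> gpoint (star_graph k L0)),
    let tip (i : 'I_k) := @vpoint R (star_graph k L0) (Some i) in
    [/\ (0 < k)%N,
        forall x y, dist (phi x) (phi y) = dist x y,
        (forall z, (forall i, z <> tip i) -> exists x, phi x = z)
      & forall i, exists2 b, D b &
          match b with
          | inl v => phi (vpoint v) = tip i
          | inr c => end_value phi c (tip i)
          end].

(* Main.v *)
Require Import Defs.
From HB Require Import structures.
From mathcomp Require Import finmap.
From mathcomp Require Import all_boot all_order all_algebra.
From mathcomp Require Import all_classical all_reals all_analysis.
From mathcomp Require Import measurable_realfun.
From mathcomp Require Import ring lra zify.
Import Order.TTheory GRing.Theory Num.Theory numFieldNormedType.Exports.

Set Implicit Arguments.
Unset Strict Implicit.
Unset Printing Implicit Defensive.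

Local Open Scope classical_set_scope.
Local Open Scope ring_scope.

(** Root the tree at the centre and let d be the distance to the root: every
    leaf and every end is at distance L from the root, and L is the inradius.
    For k < pi / (2 L) the function cos (k d) is a positive supersolution, since
    at a vertex with several children its outgoing fluxes add up with the right
    sign.  Picone's inequality on each edge, with the Riccati solution
    - k tan (k d), is summed over the first n levels of the tree; the boundary
    term at level n tends to 0, because the sum of f^2 over level n is bounded by
    the energy of f beyond that level.
    If a vertex v0 other than the root branches, the phase k d can be shifted up
    on the path from the root to v0 and down elsewhere, which leaves room for
    some k > pi / (2 L), so that the bound is strict.  If no vertex other than
    the root branches, the tree is a star, and cos (pi d / (2 L)) is a trial
    function with equality. *)

(** * Picone's inequality on an interval *)

(** No minimiser is used: [lambda1] is only an infimum. Strictness therefore cannot be read off from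
    the equality case of Picone's inequality; it has to come from a supersolution with a larger k.
    Only its logarithmic derivative enters, so the phase may jump from edge to edge, and at a vertex
    only tangents are compared. The boundary term is the main obstacle. f tends to 0 along each ray,
    but with no common rate, and the number of vertices in level n may grow without bound. Following
    one descending path from each vertex of the level, with a fixed positive phase, controls the
    whole sum by the energy in disjoint subtrees. For the phase k d the outgoing flux at the root is
    exactly 0, so the root has no reserve of its own. Raising one edge there pays for lowering the
    others. The raised phase is passed down to v0, where two tangents stand against one, and the
    lowering elsewhere makes room for k L > pi / 2. *)

Section Analysis.
Variable R : realType.
Implicit Types (F T u g : R -> R) (l : R).
Local Notation mu := (@lebesgue_measure R).

(** Continuous induction. For a slack e > 0, let s be the supremum of the t such that
    [F 0 - e * r <= F r] on [[0, t]]. Left continuity gives the bound at s, and the hypothesis at s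
    extends it beyond s unless s = l. *)
Lemma le_of_lower_right_derivative F l : 0 < l ->
  {within `[0, l], continuous F} ->
  (forall s e : R, 0 <= s < l -> 0 < e ->
     \forall t \near s^'+, F s - e * (t - s) <= F t) ->
  F 0 <= F l.
Proof.
move=> l0 Fc Fr; apply/ler_addgt0Pr => e e0.
suff H : F 0 - (e / l) * l <= F l by rewrite -lerBlDr (le_trans _ H)// mulfVK// gt_eqF.
have {e0} : 0 < e / l by rewrite divr_gt0.
move: (e / l) => {}e e0.
pose A := [set t | 0 <= t <= l /\ forall r, 0 <= r <= t -> F 0 - e * r <= F r].
have A0 : A 0.
  split; first by rewrite lexx ltW.
  by move=> r /le_anti<-; rewrite mulr0 subr0.
have supA : has_sup A by split; [exists 0|exists l => t [/andP[]]].
set s := sup A.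
have s0 : 0 <= s by apply: ub_le_sup => //; case: supA.
have sl : s <= l by apply: ge_sup; [exists 0|move=> t [/andP[]]].
have Alt r : 0 <= r < s -> F 0 - e * r <= F r.
  move=> /andP[r0 rs]; have [t At rt] := sup_gt supA.1 rs.
  by case: At => _; apply; rewrite r0 ltW.
have [Fi _ Fll] := (continuous_within_itvP F l0).1 Fc.
have As : F 0 - e * s <= F s.
  move: s0; rewrite le_eqVlt => /predU1P[<-|s0]; first by rewrite mulr0 subr0.
  have Fs : F x @[x --> s^'-] --> F s.
    move: sl; rewrite le_eqVlt => /predU1P[->//|sl].
    by apply: cvg_at_left_filter; apply: Fi; rewrite in_itv/= s0.
  have Gs : F x + e * x @[x --> s^'-] --> F s + e * s.
    apply: cvgD => //; apply: cvg_at_left_filter.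
    by apply: cvgM; [exact: cvg_cst|exact: cvg_id].
  rewrite lerBlDr -(cvg_lim _ Gs)//; apply: limr_ge; first exact: cvgP Gs.
  near=> x; rewrite -lerBlDr; apply: Alt; apply/andP; split; near: x.
    exact: nbhs_left_ge.
  exact: nbhs_left_lt.
move: sl; rewrite le_eqVlt => /predU1P[<-//|sl].
have : \forall t \near s^'+, s < t < l.
  near=> t; apply/andP; split; near: t; [exact: nbhs_right_gt|exact: nbhs_right_lt].
have /(Fr s e) /(_ e0) : 0 <= s < l by rewrite s0.
move=> [d1 /= d10 H1] [d2 /= d20 H2].
pose d := Num.min d1 d2 / 2.
have dpos : 0 < d by rewrite divr_gt0// lt_min d10.
have dd : d < Num.min d1 d2 by rewrite /d ltr_pdivrMr// ltr_pMr ?lt_min ?d10 ?ltr1n.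
suff : s + d <= s by rewrite gerDl leNgt dpos.
have bnd t : s < t -> t <= s + d -> F s - e * (t - s) <= F t /\ s < t < l.
  move=> st td; have : `|s - t| < Num.min d1 d2.
    by rewrite distrC gtr0_norm ?subr_gt0//; lra.
  rewrite lt_min => /andP[t1 t2]; split; first exact: (H1 t).
  exact: (H2 t).
apply: ub_le_sup; first by case: supA.
split.
  have [||_ /andP[_ /ltW ->]] := bnd (s + d); rewrite ?lexx ?ltrDl// andbT.
  by rewrite addr_ge0// ltW.
move=> r /andP[r0 rsd]; have [rs|sr|->//] := ltgtP r s.
  by apply: Alt; rewrite r0.
have [+ _] := bnd r sr rsd; apply: le_trans.
by rewrite mulrBr; lra.
Unshelve. all: by end_near. Qed.

Lemma is_derive_continuous F (s d : R) : is_derive s (1 : R) F d -> {for s, continuous F}.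
Proof.
move=> Fd; apply: differentiable_continuous; apply/derivable1_diffP.
exact: (@ex_derive _ _ _ _ _ _ _ Fd).
Qed.

Lemma segment_integrable_cst a b (c : R) : mu.-integrable `[a, b] (EFin \o (fun=> c)).
Proof.
apply: continuous_compact_integrable; first exact: segment_compact.
by move=> x; exact: cvg_cst.
Qed.

Section H1Interval.
Variables (l : R) (u g : R -> R).
Hypotheses (l0 : 0 < l) (ug : H1_derivative l u g).

Lemma sq_integrable : mu.-integrable `[0, l] (EFin \o (fun t => g t ^+ 2)).
Proof.
have [mg fg _] := ug; apply/integrableP; split.
  by apply/measurable_EFinP; exact: measurable_funX.
apply: le_lt_trans fg; rewrite le_eqVlt; apply/orP; left; apply/eqP.
by apply: eq_integral => t _ /=; rewrite ger0_norm// sqr_ge0.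
Qed.

Lemma derivative_integrable : mu.-integrable `[0, l] (EFin \o g).
Proof.
have [mg _ _] := ug.
have i1 : mu.-integrable `[0, l] (EFin \o (fun t => g t ^+ 2 + 1)).
  apply: (@eq_integrable _ _ _ mu _ _ ((EFin \o (fun t => (g t ^+ 2)%R)) \+ (fun=> 1%E))%E) => //.
  apply: integrableD => //; first exact: sq_integrable.
  exact: segment_integrable_cst.
apply: le_integrable i1 => //; first exact/measurable_EFinP.
move=> t _ /=; rewrite lee_fin [leRHS]ger0_norm ?addr_ge0 ?sqr_ge0//.
rewrite ler_norml; have := sqr_ge0 (g t + 1/2); have := sqr_ge0 (g t - 1/2).
by move=> h1 h2; apply/andP; split; nra.
Qed.

Lemma H1_continuous : {within `[0, l], continuous u}.
Proof.
have [_ _ uE] := ug.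
have c := @parameterized_integral_continuous R 0 l g (ltW l0) derivative_integrable.
have : {within `[0, l], continuous
    (fun x => u 0 + parameterized_integral mu 0 x g)}.
  by move=> x; apply: (@continuousD _ _ _ (fun=> u 0) _ x (@cst_continuous _ _ _ x) (c x)).
apply: subspace_eq_continuous => x; rewrite inE/= in_itv/= => xl.
by rewrite /from_subspace /parameterized_integral [RHS]uE.
Qed.

Lemma H1_sq_continuous : {within `[0, l], continuous (fun t => u t ^+ 2)}.
Proof.
move=> x; apply: (@continuousM _ _ _ _ x);
  exact: H1_continuous.
Qed.

Lemma H1_sq_integrable : mu.-integrable `[0, l] (EFin \o (fun t => u t ^+ 2)).
Proof.
by apply: continuous_compact_integrable; [exact: segment_compact|exact: H1_sq_continuous].
Qed.

Lemma Rintegral_increment (f : R -> R) s t :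
  mu.-integrable `[0, l] (EFin \o f) -> 0 <= s -> s <= t -> t <= l ->
  \int[mu]_(x in `[0, t]) f x - \int[mu]_(x in `[0, s]) f x =
  \int[mu]_(x in `]s, t]) f x.
Proof.
move=> fi s0 st tl; apply: Rintegral_itvB; rewrite ?bnd_simp//.
by apply: integrableS fi => //; apply: subset_itvl; rewrite bnd_simp.
Qed.

(** Cauchy-Schwarz, obtained by integrating [(g - c) ^+ 2 >= 0] with c the mean slope of u on
    [[s, t]]. *)
Lemma increment_sq_le s t : 0 <= s -> s < t -> t <= l ->
  (u t - u s) ^+ 2 / (t - s) <=
  \int[mu]_(x in `[0, t]) (g x ^+ 2) - \int[mu]_(x in `[0, s]) (g x ^+ 2).
Proof.
move=> s0 st tl; have [_ _ uE] := ug.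
rewrite (Rintegral_increment sq_integrable s0 (ltW st) tl).
have -> : u t - u s = \int[mu]_(x in `]s, t]) g x.
  rewrite -(Rintegral_increment derivative_integrable s0 (ltW st) tl).
  rewrite (uE t) ?(uE s); first lra.
    by rewrite s0 (le_trans (ltW st)).
  by rewrite (le_trans s0 (ltW st)).
have sub : `]s, t] `<=` `[0, l].
  by move=> x /=; rewrite !in_itv/= => /andP[sx xt]; lra.
have ig : mu.-integrable `]s, t] (EFin \o g).
  exact: integrableS derivative_integrable.
have ig2 : mu.-integrable `]s, t] (EFin \o (fun x => g x ^+ 2)).
  exact: integrableS sq_integrable.
set D := \int[mu]_(x in `]s, t]) g x.
pose c := D / (t - s).
have ts0 : t - s != 0 by rewrite gt_eqF// subr_gt0.
have mst : mu `]s, t] = (t - s)%:E by rewrite lebesgue_measure_itv/= lte_fin st.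
have ic : mu.-integrable `]s, t] (EFin \o (fun=> c ^+ 2)).
  exact: integrableS (segment_integrable_cst 0 l _).
have igc : mu.-integrable `]s, t] (EFin \o (fun x => (2 * c) * g x)).
  by apply: eq_integrable (integrableZl _ (2 * c) ig) => // x _ /=; rewrite EFinM.
have isub : mu.-integrable `]s, t] (EFin \o (fun x => g x ^+ 2 - 2 * c * g x)).
  by apply: eq_integrable (integrableB _ ig2 igc) => // x _ /=; rewrite EFinB.
have : 0 <= \int[mu]_(x in `]s, t]) (g x ^+ 2 - 2 * c * g x + c ^+ 2).
  by apply: Rintegral_ge0 => x _; have := sqr_ge0 (g x - c); lra.
rewrite RintegralD//.
rewrite RintegralB// RintegralZl// Rintegral_cst//= lebesgue_measure_itv/= lte_fin st /= -/D.
suff -> : D ^+ 2 / (t - s) = 2 * c * D - c ^+ 2 * (t - s) by lra.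
by rewrite /c; field.
Qed.

Lemma within_continuousM (A : set R) (f h : R -> R) :
  {within A, continuous f} -> {within A, continuous h} ->
  {within A, continuous (fun x => f x * h x)}.
Proof. by move=> cf ch x; apply: (@continuousM R (subspace A) f h x (cf x) (ch x)). Qed.

Lemma within_continuousB (A : set R) (f h : R -> R) :
  {within A, continuous f} -> {within A, continuous h} ->
  {within A, continuous (fun x => f x - h x)}.
Proof. by move=> cf ch x; apply: (@continuousB R R (subspace A) f h x (cf x) (ch x)). Qed.

(** The left side is the minimum over D of the quadratic polynomial on the right. In [picone], D is
    the increment of u over a step h and c is [u s]; minimising over D avoids any bound on D / h. *)
Lemma sq_completion_bound (D h T c : R) : 0 < h -> 0 < 1 - h * T ->
  - (h * (T ^+ 2 * c ^+ 2 / (1 - h * T))) <= D ^+ 2 / h - T * D ^+ 2 - 2 * T * c * D.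
Proof.
move=> h0 hT; rewrite -subr_ge0.
have -> : D ^+ 2 / h - T * D ^+ 2 - 2 * T * c * D -
    - (h * (T ^+ 2 * c ^+ 2 / (1 - h * T))) =
    (D * (1 - h * T) - h * T * c) ^+ 2 / (h * (1 - h * T)).
  by field; rewrite !gt_eqF.
by rewrite divr_ge0 ?sqr_ge0// mulr_ge0 ?ltW.
Qed.

(* By the Riccati equation, int_0^t g^2 - k^2 int_0^t u^2 - T(t) u(t)^2 has the
   derivative (g - T u)^2 almost everywhere; a lower bound on its right difference
   quotients avoids differentiating the integrals. *)
Lemma picone (k : R) T :
  (forall t : R, 0 <= t <= l -> is_derive t (1 : R) T (- k ^+ 2 - T t ^+ 2)) ->
  k ^+ 2 * \int[mu]_(t in `[0, l]) (u t ^+ 2) + (T l * u l ^+ 2 - T 0 * u 0 ^+ 2)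
  <= \int[mu]_(t in `[0, l]) (g t ^+ 2).
Proof.
move=> dT.
pose E t := parameterized_integral mu 0 t (fun x => g x ^+ 2).
pose B t := parameterized_integral mu 0 t (fun x => u x ^+ 2).
have Ec : {within `[0, l], continuous E}.
  by apply: parameterized_integral_continuous (ltW l0) sq_integrable.
have Bc : {within `[0, l], continuous B}.
  by apply: parameterized_integral_continuous (ltW l0) H1_sq_integrable.
have Tc : {within `[0, l], continuous T}.
  apply: derivable_within_continuous => t; rewrite in_itv/= => /dT dt.
  exact: ex_derive.
pose F t := E t - k ^+ 2 * B t - T t * u t ^+ 2.
have Fc : {within `[0, l], continuous F}.
  apply: within_continuousB; last exact: within_continuousM Tc H1_sq_continuous.
  by apply: within_continuousB => //; apply: within_continuousM => // x; exact: cvg_cst.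
have par0 f : parameterized_integral mu 0 0 f = 0.
  by rewrite /parameterized_integral set_itv1 Rintegral_set1.
suff : F 0 <= F l.
  by rewrite /F/= {1}/E {1}/B !par0 /E /B /parameterized_integral; lra.
apply: le_of_lower_right_derivative => // s e /andP[s0 sl] e0.
have usc : u x @[x --> s^'+] --> u s.
  have [ui u0 _] := (continuous_within_itvP u l0).1 H1_continuous.
  move: s0; rewrite le_eqVlt => /predU1P[<-//|s0].
  by apply: cvg_at_right_filter; apply: ui; rewrite in_itv/= s0.
have Dts : is_derive s (1 : R) T (- k ^+ 2 - T s ^+ 2) by apply: dT; rewrite s0 ltW.
have Tsc : T x @[x --> s^'+] --> T s.
  exact/cvg_at_right_filter/(is_derive_continuous Dts).
have hc : x - s @[x --> s^'+] --> (0 : R).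
  rewrite -(subrr s); apply: cvgB; last exact: cvg_cst.
  exact: cvg_at_right_filter.
have Tq : (T x - T s) / (x - s) @[x --> s^'+] --> - k ^+ 2 - T s ^+ 2.
  have /cvg_ex[/= dl Tdl] := @ex_derive _ _ _ _ _ _ _ Dts.
  have dlE : dl = - k ^+ 2 - T s ^+ 2.
    by rewrite -(@derive_val _ _ _ _ _ _ _ Dts); apply/esym/cvg_lim.
  rewrite dlE in Tdl.
  have sh : x - s @[x --> s^'+] --> (0 : R)^'.
    move=> A [d /= d0 dA]; exists d => // x /= xd sx; apply: dA.
      by rewrite /= sub0r normrN distrC.
    by rewrite subr_eq0 gt_eqF.
  have := cvg_comp _ _ sh Tdl; apply: cvg_trans; apply: near_eq_cvg.
  by near=> x; rewrite /= /shift/= scaler1 subrK [RHS]mulrC.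
have q1 : 1 - (x - s) * T x @[x --> s^'+] --> (1 : R).
  rewrite -[X in _ --> X]subr0 -[X in 1 - X](mul0r (T s)).
  by apply: cvgB; [exact: cvg_cst|apply: cvgM].
(* Up to an error e / 2, [- Q t] is a lower bound for the difference quotient of F between s and t;
   the Riccati equation makes Q tend to 0. *)
pose Q x := T x * T x * u s ^+ 2 / (1 - (x - s) * T x) +
  (T x - T s) / (x - s) * u s ^+ 2 + k ^+ 2 * u s ^+ 2.
have Qc : Q x @[x --> s^'+] --> (0 : R).
  have -> : 0 = T s * T s * u s ^+ 2 / 1 + (- k ^+ 2 - T s ^+ 2) * u s ^+ 2 +
    k ^+ 2 * u s ^+ 2 by field.
  apply: cvgD; last exact: cvg_cst.
  apply: cvgD; last by apply: cvgM => //; exact: cvg_cst.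
  apply: cvgM; last by apply: cvgV => //; rewrite oner_neq0.
  by apply: cvgM; [exact: cvgM|exact: cvg_cst].
(* Replacing u^2 by [u s ^+ 2 + e1] on []s, t]] costs at most e / 2 per unit length after
   multiplication by k^2; the added 1 covers k = 0. *)
pose e1 := e / (2 * (k ^+ 2 + 1)).
have k20 := sqr_ge0 k.
have e10 : 0 < e1 by rewrite divr_gt0// mulr_gt0// ltr_wpDl.
have ke1 : k ^+ 2 * e1 <= e / 2.
  rewrite /e1 invfM mulrA mulrA ler_pdivrMr ?ltr_wpDl//.
  by nra.
have us2 : \forall t \near s^'+, forall r, s < r -> r <= t -> u r ^+ 2 <= u s ^+ 2 + e1.
  have u2c : u x * u x @[x --> s^'+] --> u s * u s by exact: cvgM.
  have us1 : u s * u s < u s ^+ 2 + e1 by rewrite -expr2 ltrDl.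
  have [d /= d0 dA] := cvgr_lt _ u2c _ us1.
  exists d => // t /= td st r sr rt; rewrite ltW// [ltLHS]expr2; apply: dA => //=.
  apply: le_lt_trans td; rewrite !(distrC s) !gtr0_norm ?subr_gt0//.
  by rewrite lerB.
near=> t.
have st : s < t by near: t; exact: nbhs_right_gt.
have tl : t < l by near: t; exact: nbhs_right_lt.
have h0 : 0 < t - s by rewrite subr_gt0.
have hT : 0 < 1 - (t - s) * T t by near: t; apply: cvgr_gt q1 _ ltr01.
have Qe : Q t < e / 2 by near: t; apply: cvgr_lt Qc _ _; rewrite divr_gt0.
have uu : forall r, s < r -> r <= t -> u r ^+ 2 <= u s ^+ 2 + e1 by near: t.
have Est : (u t - u s) ^+ 2 / (t - s) <= E t - E s.
  exact: increment_sq_le s0 st (ltW tl).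
have Bst : B t - B s <= (t - s) * (u s ^+ 2 + e1).
  rewrite /B /parameterized_integral Rintegral_increment ?H1_sq_integrable ?(ltW st) ?(ltW tl)//.
  have -> : (t - s) * (u s ^+ 2 + e1) = \int[mu]_(x in `]s, t]) (u s ^+ 2 + e1).
    by rewrite Rintegral_cst//= lebesgue_measure_itv/= lte_fin st/= mulrC.
  have sub : `]s, t] `<=` `[0, l].
    by move=> x /=; rewrite !in_itv/= => /andP[sx xt]; lra.
  apply: le_Rintegral => //.
  - exact: integrableS H1_sq_integrable.
  - exact: integrableS (segment_integrable_cst 0 l _).
  - by move=> x /=; rewrite in_itv/= => /andP[]; exact: uu.
have := sq_completion_bound (u t - u s) (u s) h0 hT.
have k2B : k ^+ 2 * (B t - B s) <= (t - s) * (k ^+ 2 * u s ^+ 2 + e / 2).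
  apply: le_trans (ler_wpM2l k20 Bst) _.
  rewrite mulrCA ler_wpM2l ?(ltW h0)//; nra.
have : (t - s) * Q t <= (t - s) * (e / 2) by rewrite ler_wpM2l ?ltW.
rewrite /Q -expr2 !mulrDr [(t - s) * ((T t - T s) / _ * _)]mulrCA.
have -> : (T t - T s) / (t - s) * ((t - s) * u s ^+ 2) = (T t - T s) * u s ^+ 2.
  by field; rewrite gt_eqF.
rewrite /F; move: (T t ^+ 2 * _ / _) => q.
lra.
Unshelve. all: by end_near. Qed.

Lemma H1_sq_integral_gt0 t0 : 0 <= t0 <= l -> u t0 != 0 ->
  0 < \int[mu]_(t in `[0, l]) (u t ^+ 2).
Proof.
move=> /andP[t00 t0l] ut0.
have m0 : 0 < u t0 ^+ 2 by rewrite lt_def sqrf_eq0 ut0 sqr_ge0.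
have /(_ t0) := (@subspace_continuousP _ _ _ _).1 H1_sq_continuous.
rewrite /= in_itv/= t00 t0l => /(_ isT) c.
have m2 : u t0 ^+ 2 / 2 < u t0 ^+ 2 by rewrite ltr_pdivrMr// ltr_pMr ?ltr1n.
have [d /= d0 dA] := cvgr_gt _ c _ m2.
(* For t0 = l the interval has to lie to the left of t0. *)
have [a [b [a0 ab bl abd]]] : exists a b, [/\ 0 <= a, a < b, b <= l &
    forall t, a <= t <= b -> `|t0 - t| < d].
  have [tl|lt] := ltP t0 l.
    exists t0, (Num.min l (t0 + d / 2)); split => //.
    - by rewrite lt_min tl ltrDl divr_gt0.
    - by rewrite ge_min lexx.
    - move=> t; rewrite le_min => /and3P[h1 _ h2].
      by rewrite ler0_norm ?subr_le0//; lra.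
  have t0E : t0 = l by apply/le_anti; rewrite t0l.
  exists (Num.max 0 (l - d / 2)), l; split => //.
  - by rewrite le_max lexx.
  - by rewrite gt_max l0 ltrBlDr ltrDl divr_gt0.
  - move=> t; rewrite ge_max => /andP[/andP[_ h1] h2].
    by rewrite t0E ger0_norm ?subr_ge0//; lra.
have sub : `[a, b] `<=` `[0, l].
  by move=> x /=; rewrite !in_itv/= => /andP[sx xt]; lra.
have iab : mu.-integrable `[a, b] (EFin \o (fun t => u t ^+ 2)).
  exact: integrableS H1_sq_integrable.
apply: (@lt_le_trans _ _ (\int[mu]_(t in `[a, b]) (u t ^+ 2))).
  apply: (@lt_le_trans _ _ (\int[mu]_(t in `[a, b]) (u t0 ^+ 2 / 2))).
    rewrite Rintegral_cst//= lebesgue_measure_itv/= lte_fin ab/=.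
    by rewrite mulr_gt0// ?subr_gt0// divr_gt0.
  apply: le_Rintegral => //; first exact: segment_integrable_cst.
  move=> t /=; rewrite in_itv/= => /andP[at_ tb].
  rewrite ltW//; apply: dA => /=; first by apply: abd; rewrite at_.
  by rewrite in_itv/=; lra.
rewrite -lee_fin /Rintegral !fineK ?integrable_fin_num ?H1_sq_integrable//.
apply: ge0_subset_integral => //; last by move=> x _; rewrite lee_fin sqr_ge0.
by case/integrableP : H1_sq_integrable.
Qed.

Lemma sq_integralE (f : R -> R) : mu.-integrable `[0, l] (EFin \o (fun t => f t ^+ 2)) ->
  (\int[mu]_(t in `[0%R, l]) (f t ^+ 2)%:E)%E = (\int[mu]_(t in `[0, l]) (f t ^+ 2))%:E.
Proof. by move=> fi; rewrite fineK ?integrable_fin_num. Qed.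

Lemma is_derive_tan_phase (c b t : R) : cos (c * t + b) != 0 ->
  is_derive t (1 : R) (fun t => - c * tan (c * t + b))
    (- c ^+ 2 - (- c * tan (c * t + b)) ^+ 2).
Proof.
move=> ct; have dt := is_derive_tan ct.
have dl : is_derive t (1 : R) (fun t => c * t + b) c.
  apply: (is_derive_eq (is_deriveD (is_deriveZ c (is_derive_id t (1 : R)))
    (is_derive_cst b t (1 : R)))).
  by rewrite addr0 /GRing.scale/= mulr1.
have dcomp := is_deriveZ (- c) (@is_derive1_comp _ tan (fun t => c * t + b) _ _ _ dt dl).
apply: (is_derive_eq dcomp).
by rewrite cos2_tan2// /GRing.scale/=; ring.
Qed.

(** The Riccati solution is the logarithmic derivative of [cos (c * t + b)]. Here c may have either
    sign: an edge parametrised towards the root takes a negative c. *)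
Lemma picone_tan (c b : R) :
  (forall t, 0 <= t <= l -> - (pi / 2) < c * t + b < pi / 2) ->
  c ^+ 2 * \int[mu]_(t in `[0, l]) (u t ^+ 2) +
    (c * tan b * u 0 ^+ 2 - c * tan (c * l + b) * u l ^+ 2)
  <= \int[mu]_(t in `[0, l]) (g t ^+ 2).
Proof.
move=> cb; have := @picone c (fun t => - c * tan (c * t + b)).
rewrite mulr0 add0r !mulNr opprK [in X in _ -> X](addrC (c * tan b * _)); apply => t tl.
by apply: is_derive_tan_phase; rewrite gt_eqF// cos_gt0_pihalf// cb.
Qed.

End H1Interval.

Lemma le_tan (x y : R) : - (pi / 2) < x -> x <= y -> y < pi / 2 -> tan x <= tan y.
Proof.
move=> x1; rewrite le_eqVlt => /predU1P[->//|xy] y1; rewrite ltW// ltr_tan//.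
  by rewrite in_itv/= x1 (lt_trans xy).
by rewrite in_itv/= y1 (lt_trans x1).
Qed.

Lemma tan_ge0 (x : R) : 0 <= x -> x < pi / 2 -> 0 <= tan x.
Proof. by move=> x0 x1; rewrite -tan0 le_tan// oppr_lt0 divr_gt0// pi_gt0. Qed.

Lemma tan_gt0 (x : R) : 0 < x -> x < pi / 2 -> 0 < tan x.
Proof.
move=> x0 x1; have pi0 : 0 < pi / 2 :> R by rewrite divr_gt0// pi_gt0.
by rewrite -tan0 ltr_tan// in_itv/= ?x1 ?pi0 ?oppr_lt0 ?pi0// ?andbT (lt_trans _ x0)// oppr_lt0.
Qed.

Lemma tan_continuous (x : R) : - (pi / 2) < x < pi / 2 -> {for x, continuous (@tan R)}.
Proof.
by move=> xb; apply: is_derive_continuous; apply: is_derive_tan; rewrite gt_eqF// cos_gt0_pihalf.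
Qed.

Lemma le_of_vanishing_error (a b : R) (h : nat -> R) :
  (forall m, a <= b + h m) -> h m @[m --> \oo] --> 0 -> a <= b.
Proof.
move=> ah h0; apply/ler_addgt0Pr => e e0.
have /cvgrPdist_lt /(_ e e0) [N _ hN] := h0.
have := hN N (leqnn N); rewrite /= sub0r normrN => hNe.
by apply: le_trans (ah N) _; rewrite lerD2l; apply: le_trans (ler_norm _) (ltW hNe).
Qed.

Lemma cos_lipschitz (x y : R) : x <= y -> `|cos x - cos y| <= y - x.
Proof.
rewrite le_eqVlt => /predU1P[->|xy]; first by rewrite !subrr normr0.
have cc : {within `[x, y], continuous (@cos R)}.
  exact: (continuous_subspaceT (@continuous_cos R)).
rewrite distrC; have [c _ ->] := MVT xy (fun (z : R) _ => is_derive_cos z) cc.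
rewrite normrM normrN [X in _ * X]gtr0_norm ?subr_gt0//.
by rewrite ler_piMl ?sin_max// subr_ge0 ltW.
Qed.

Lemma Rintegral_FTC (F h : R -> R) (t : R) : 0 <= t ->
  (forall s : R, is_derive s (1 : R) F (h s)) -> continuous h ->
  \int[lebesgue_measure]_(s in `[0, t]) h s = F t - F 0.
Proof.
rewrite le_eqVlt => /predU1P[<- _ _|t0 Fh hc].
  by rewrite set_itv1 Rintegral_set1 subrr.
have Fc s := is_derive_continuous (Fh s).
rewrite /Rintegral (@continuous_FTC2 _ _ F) ?EFinB//.
- exact: continuous_subspaceT.
- split.
  + by move=> s _; exact: (@ex_derive _ _ _ _ _ _ _ (Fh s)).
  + by apply: cvg_at_right_filter; exact: Fc.
  + by apply: cvg_at_left_filter; exact: Fc.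
- by move=> s _; rewrite derive1E (@derive_val _ _ _ _ _ _ _ (Fh s)).
Qed.

Lemma continuous_mul (f h : R -> R) : continuous f -> continuous h ->
  continuous (fun t => f t * h t).
Proof. by move=> cf ch t; apply: (@continuousM R R f h t (cf t) (ch t)). Qed.

(** * The energy of a cosine on an interval *)

Section Cosine.
Variables (l c b : R).
Hypothesis l0 : 0 < l.

Let phase_derive (t : R) : is_derive t (1 : R) (fun t => c * t + b) c.
Proof.
apply: (is_derive_eq (is_deriveD (is_deriveZ c (is_derive_id t (1 : R)))
  (is_derive_cst b t (1 : R)))).
by rewrite addr0 /GRing.scale/= mulr1.
Qed.

Lemma is_derive_cos_phase (t : R) :
  is_derive t (1 : R) (fun t => cos (c * t + b)) (- c * sin (c * t + b)).
Proof.
apply: (is_derive_eq (@is_derive1_comp _ cos (fun t => c * t + b) _ _ _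
  (is_derive_cos _) (phase_derive t))).
by rewrite mulrC mulrN mulNr.
Qed.

Lemma is_derive_sin_phase (t : R) :
  is_derive t (1 : R) (fun t => sin (c * t + b)) (c * cos (c * t + b)).
Proof.
apply: (is_derive_eq (@is_derive1_comp _ sin (fun t => c * t + b) _ _ _
  (is_derive_sin _) (phase_derive t))).
by rewrite mulrC.
Qed.

Let cos_continuous : continuous (fun t => cos (c * t + b)).
Proof. by move=> t; exact: is_derive_continuous (is_derive_cos_phase t). Qed.

Let sin_continuous : continuous (fun t => sin (c * t + b)).
Proof. by move=> t; exact: is_derive_continuous (is_derive_sin_phase t). Qed.

Let dcos_continuous : continuous (fun t => - c * sin (c * t + b)).
Proof. by apply: continuous_mul => //; exact: cst_continuous. Qed.

Let sq_continuous_integrable (h : R -> R) : continuous h ->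
  lebesgue_measure.-integrable `[0, l] (EFin \o (fun t => h t ^+ 2)).
Proof.
move=> hc; apply: continuous_compact_integrable; first exact: segment_compact.
by apply: continuous_subspaceT; exact: continuous_mul.
Qed.

Lemma H1_derivative_cos (u : R -> R) :
  (forall t, 0 <= t <= l -> u t = cos (c * t + b)) ->
  H1_derivative l u (fun t => - c * sin (c * t + b)).
Proof.
move=> uE; split.
- by apply: measurable_funTS; exact: continuous_measurable_fun.
- have := sq_continuous_integrable dcos_continuous.
  by move=> /sq_integralE->; exact: ltry.
- move=> t tl; have /andP[t0 _] := tl.
  rewrite (Rintegral_FTC t0 is_derive_cos_phase dcos_continuous).
  by rewrite !uE ?lexx ?(ltW l0)// subrKC.
Qed.

(** Both sides are the increment of u' u over the interval, since u'' = - c^2 u. *)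
Lemma cos_energy (u : R -> R) : (forall t, 0 <= t <= l -> u t = cos (c * t + b)) ->
  \int[lebesgue_measure]_(t in `[0, l]) ((- c * sin (c * t + b)) ^+ 2) -
  c ^+ 2 * \int[lebesgue_measure]_(t in `[0, l]) (u t ^+ 2) =
  c * sin b * cos b - c * sin (c * l + b) * cos (c * l + b).
Proof.
move=> uE; pose C t := cos (c * t + b); pose S t := - c * sin (c * t + b).
have -> : \int[lebesgue_measure]_(t in `[0, l]) (u t ^+ 2) =
    \int[lebesgue_measure]_(t in `[0, l]) (C t ^+ 2).
  by apply: eq_Rintegral => t; rewrite inE/= in_itv/= => /uE->.
have iC : lebesgue_measure.-integrable `[0, l] (EFin \o (fun t => c ^+ 2 * C t ^+ 2)).
  exact: eq_integrable (integrableZl _ (c ^+ 2) (sq_continuous_integrable cos_continuous)).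
rewrite -RintegralZl ?sq_continuous_integrable// -RintegralB ?sq_continuous_integrable//.
have dSC t : is_derive t (1 : R) (fun t => S t * C t) (S t ^+ 2 - c ^+ 2 * C t ^+ 2).
  have h1 := is_deriveZ (- c) (is_derive_sin_phase t).
  apply: (is_derive_eq (is_deriveM h1 (is_derive_cos_phase t))).
  rewrite /S /C; change ((- c * sin (c * t + b)) * (- c * sin (c * t + b)) +
    cos (c * t + b) * (- c * (c * cos (c * t + b))) =
    (- c * sin (c * t + b)) ^+ 2 - c ^+ 2 * cos (c * t + b) ^+ 2).
  ring.
have cSC : continuous (fun t => S t ^+ 2 - c ^+ 2 * C t ^+ 2).
  have cC2 := continuous_mul cos_continuous cos_continuous.
  have cS2 := continuous_mul dcos_continuous dcos_continuous.
  have cC3 := continuous_mul (@cst_continuous _ _ (c ^+ 2)) cC2.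
  by move=> t; apply: (@continuousB R R R _ _ t (cS2 t) (cC3 t)).
rewrite (Rintegral_FTC (ltW l0) dSC cSC).
by rewrite /S /C mulr0 add0r; ring.
Qed.

Lemma cos_sq_le (u : R -> R) : (forall t, 0 <= t <= l -> u t = cos (c * t + b)) ->
  \int[lebesgue_measure]_(t in `[0, l]) (u t ^+ 2) <= l.
Proof.
move=> uE.
have -> : \int[lebesgue_measure]_(t in `[0, l]) (u t ^+ 2) =
    \int[lebesgue_measure]_(t in `[0, l]) (cos (c * t + b) ^+ 2).
  by apply: eq_Rintegral => t; rewrite inE/= in_itv/= => /uE->.
have {2}-> : l = \int[lebesgue_measure]_(t in `[0, l]) (1 : R).
  by rewrite Rintegral_cst//= lebesgue_measure_itv/= lte_fin l0/= mul1r subr0.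
by apply: le_Rintegral; rewrite ?sq_continuous_integrable ?segment_integrable_cst.
Qed.

Lemma sin_sq_le :
  \int[lebesgue_measure]_(t in `[0, l]) ((- c * sin (c * t + b)) ^+ 2) <= c ^+ 2 * l.
Proof.
have -> : c ^+ 2 * l = \int[lebesgue_measure]_(t in `[0, l]) (c ^+ 2).
  by rewrite Rintegral_cst//= lebesgue_measure_itv/= lte_fin l0/= subr0.
apply: le_Rintegral => //; first exact: sq_continuous_integrable.
  exact: segment_integrable_cst.
by move=> t _; rewrite exprMn sqrrN ler_piMr ?sqr_ge0.
Qed.

End Cosine.

End Analysis.

(** * Rooting a tree *)

(* [orient e] tells whether the source of [e] is its end nearer to the root.
   The value [par_root] is a convention. *)
Record rooting (R : realType) (G : metric_graph R) (r : vertex G) := Rooting {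
  orient : edge G -> bool;
  level : vertex G -> nat;
  par : vertex G -> vertex G;
  depth : vertex G -> R;
  up := fun e => hsrc (e, orient e);
  lo := fun e => htgt (e, orient e);
  level_root : level r = 0%N;
  level_lo : forall e, level (lo e) = (level (up e)).+1;
  par_root : par r = r;
  par_lo : forall e, par (lo e) = up e;
  depth_root : depth r = 0;
  depth_lo : forall e, depth (lo e) = depth (up e) + len e;
  lo_inj : injective lo;
  lo_surj : forall v, v <> r -> exists e, lo e = v
}.

Section Walks.
Variables (R : realType) (G : metric_graph R).
Local Notation hedge := (edge G * bool)%type.
Implicit Types (h : hedge) (p q : seq hedge) (v w : vertex G).

Definition rev_half h : hedge := (h.1, ~~ h.2).
Definition rev_walk p : seq hedge := rev (map rev_half p).
Definition no_turn h1 h2 := h2 != rev_half h1.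

Lemma hsrc_rev h : hsrc (rev_half h) = htgt h.
Proof. by case: h => e []. Qed.

Lemma htgt_rev h : htgt (rev_half h) = hsrc h.
Proof. by case: h => e []. Qed.

Lemma rev_halfK : involutive rev_half.
Proof. by case=> e b; rewrite /rev_half negbK. Qed.

Lemma walk_cat v p q w : walk v (p ++ q) w <-> exists2 x, walk v p x & walk x q w.
Proof.
elim: p v => [|h p IH] v /=; first by split=> [|[x ->]]; [exists v|].
split=> [[hv /IH[x px qx]]|[x [hv px] qx]]; first by exists x.
by split=> //; apply/IH; exists x.
Qed.

Lemma walk_rev v p w : walk v p w -> walk w (rev_walk p) v.
Proof.
rewrite /rev_walk; elim: p v => [|h p IH] v /= => [->//|[hv /IH ph]].
rewrite rev_cons -cats1; apply/walk_cat; exists (htgt h) => //=.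
by rewrite hsrc_rev htgt_rev.
Qed.

Lemma not_uniq_map_split (T : eqType) (f : hedge -> T) p : ~~ uniq (map f p) ->
  exists p1 h1 p2 h2 p3, p = p1 ++ (h1 :: p2) ++ (h2 :: p3) /\ f h1 = f h2.
Proof.
elim: p => [//|h p IH] /=; rewrite negb_and negbK => /orP[/mapP[h2 h2p fh]|/IH].
  have [p2 p3] := splitPr h2p.
  by exists [::], h, p2, h2, p3.
move=> [p1 [h1 [p2 [h2 [p3 [-> e]]]]]].
by exists (h :: p1), h1, p2, h2, p3.
Qed.

(** A repeated source vertex would cut out a shorter nonempty closed reduced walk, so by induction
    on the length the sources are distinct. Once repeated edges are excluded as well, a nonempty
    walk is a cycle. *)
Lemma reduced_closed_walk_nil : (forall v p, ~ cycle_at v p) ->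
  forall v p, walk v p v -> sorted no_turn p -> p = [::].
Proof.
move=> acyc v p; have [n] := ubnP (size p); elim: n p v => // n IH p v pn pv sp.
apply: contrapT => p0.
have us : uniq (map (@hsrc _ _) p).
  apply: contrapT => /negP /not_uniq_map_split[p1 [h1 [p2 [h2 [p3 [pE hh]]]]]].
  move: pv; rewrite pE => /walk_cat[x p1x] /walk_cat[y p2y] /= [h2y _].
  have xE : hsrc h1 = x by case: p2y.
  have : h1 :: p2 = [::]; last by [].
  apply: (IH _ x).
  - by move: pn; rewrite pE !size_cat /=; lia.
  - by rewrite -[X in walk x _ X]xE hh h2y.
  - move: sp; rewrite pE => /cat_sorted2[_ /cat_sorted2[]//].
apply: (acyc v p); split=> //.
apply: contrapT => /negP /not_uniq_map_split[p1 [h1 [p2 [h2 [p3 [pE hh]]]]]].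
have h12 : h1 != h2.
  apply/eqP => h12; move: us; rewrite pE h12 !map_cat /= !cat_uniq /=.
  by rewrite mem_cat in_cons eqxx orbT !andbF.
have h2E : h2 = rev_half h1.
  case: h1 h2 hh h12 {pE} => e1 b1 [e2 b2] /= ->.
  by rewrite xpair_eqE eqxx /rev_half /=; case: b1 b2 => [] [].
(* An edge met again is crossed in the opposite direction. If this happens at once it is a turn;
   otherwise the step after h1 has the same source as h2. *)
case: p2 pE => [|h3 p2] pE.
  by move: sp; rewrite pE => /cat_sorted2[_] /=; rewrite /no_turn h2E eqxx.
have h3E : hsrc h3 = hsrc h2.
  move: pv; rewrite pE => /walk_cat[x p1x] /=[_ [-> _]].
  by rewrite h2E hsrc_rev.
move: us; rewrite pE !map_cat /= !cat_uniq /= h3E.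
by rewrite (mem_cat (hsrc h2) [seq hsrc i | i <- p2]) mem_head orbT /= !andbF.
Qed.

End Walks.

Section TreeRooting.
Variables (R : realType) (G : metric_graph R) (r : vertex G).
Hypothesis Gtree : is_tree G.
Local Notation hedge := (edge G * bool)%type.
Implicit Types (h : hedge) (p q : seq hedge) (v w : vertex G).

Lemma walk_length_exists v : exists n, `[< exists2 p, walk r p v & size p = n >].
Proof. by have [p pw] := Gtree.1 r v; exists (size p); apply/asboolP; exists p. Qed.

Definition wlevel v : nat := ex_minn (walk_length_exists v).

Lemma wlevel_le v p : walk r p v -> (wlevel v <= size p)%N.
Proof.
by move=> pv; rewrite /wlevel; case: ex_minnP => m _; apply; apply/asboolP; exists p.
Qed.

Lemma wlevel_walk v : exists2 p, walk r p v & size p = wlevel v.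
Proof. by rewrite /wlevel; case: ex_minnP => m /asboolP. Qed.

Lemma wlevel_root : wlevel r = 0%N.
Proof. by apply/eqP; rewrite -leqn0; exact: (@wlevel_le r [::]). Qed.

Lemma wlevel_step h : (wlevel (htgt h) <= (wlevel (hsrc h)).+1)%N.
Proof.
have [p pw <-] := wlevel_walk (hsrc h).
rewrite -(size_rcons p h); apply: wlevel_le; rewrite -cats1.
by apply/walk_cat; exists (hsrc h).
Qed.

Definition ascending h := wlevel (htgt h) == (wlevel (hsrc h)).+1.
Definition descending h := ascending (rev_half h).

(** On a shortest walk the last step must raise the level by exactly one; induction replaces the
    rest by an ascending walk. *)
Lemma ascending_walk v : exists2 p, walk r p v & all ascending p.
Proof.
have [n] := ubnP (wlevel v); elim: n v => // n IH v vn.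
have [p] := wlevel_walk v; case/lastP: p => [|p h] pw ps; first by exists [::].
move: (pw); rewrite -cats1 => /walk_cat[x px /= [hx hv]].
have xp : (wlevel x <= size p)%N by exact: wlevel_le.
have := wlevel_step h; rewrite hx hv => xv.
rewrite size_rcons in ps.
have [q qx qa] : exists2 p, walk r p x & all ascending p by apply: IH; lia.
exists (rcons q h); first by rewrite -cats1; apply/walk_cat; exists x.
by rewrite all_rcons qa andbT /ascending hx hv; apply/eqP; lia.
Qed.

Lemma ascendingN h : ascending h -> ~~ descending h.
Proof. by rewrite /descending /ascending hsrc_rev htgt_rev; lia. Qed.

Lemma no_turn_ascending h1 h2 : ascending h1 -> ~~ descending h2 -> no_turn h1 h2.
Proof. by move=> a1; apply: contraNN => /eqP->; rewrite /descending rev_halfK. Qed.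

Lemma no_turn_descending h1 h2 : ~~ ascending h1 -> descending h2 -> no_turn h1 h2.
Proof.
move=> a1 d2; apply: contraNN a1 => /eqP h2E.
by move: d2; rewrite h2E /descending rev_halfK.
Qed.

Lemma sorted_ascending_cat p h q : all ascending p -> ~~ descending h ->
  sorted (@no_turn _ G) (h :: q) -> sorted (@no_turn _ G) (p ++ h :: q).
Proof.
move=> pa hd hq; elim: p pa => //= h1 p IH /andP[a1 pa].
case: p pa IH => [|h2 p] /=; first by rewrite no_turn_ascending.
move=> /andP[a2 pa] IH; rewrite IH ?a2// andbT.
by apply: no_turn_ascending => //; exact: ascendingN.
Qed.

Lemma path_descending h p : ~~ ascending h -> all descending p ->
  path (@no_turn _ G) h p.
Proof.
elim: p h => //= h2 p IH h ha /andP[d2 pd]; rewrite no_turn_descending//= IH//.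
by apply/negP => /ascendingN; rewrite d2.
Qed.

Lemma descending_rev_walk p : all ascending p -> all descending (rev_walk p).
Proof.
rewrite /rev_walk all_rev all_map => pa; apply: sub_all pa => h /=.
by rewrite /descending rev_halfK.
Qed.

(** An edge within one level, placed between ascending walks from the root to its two ends, would
    give a nonempty reduced closed walk. *)
Lemma level_neq h : wlevel (htgt h) != wlevel (hsrc h).
Proof.
apply/eqP => hl.
have [p pw pa] := ascending_walk (hsrc h).
have [q qw qa] := ascending_walk (htgt h).
have ha : ~~ ascending h by rewrite /ascending; lia.
have hd : ~~ descending h by rewrite /descending /ascending hsrc_rev htgt_rev; lia.
suff : p ++ h :: rev_walk q = [::] by case: (p).
apply: (reduced_closed_walk_nil Gtree.2 (v := r)).
  by apply/walk_cat; exists (hsrc h) => //=; split=> //; exact: walk_rev.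
apply: sorted_ascending_cat => //=; apply: path_descending => //.
exact: descending_rev_walk.
Qed.

(** Two distinct edges rising to the same vertex would give a nonempty reduced closed walk, up
    through the one and down through the other. *)
Lemma ascending_inj h1 h2 : ascending h1 -> ascending h2 -> htgt h1 = htgt h2 ->
  h1 = h2.
Proof.
move=> a1 a2 h12; apply: contrapT => /eqP n12.
have [p pw pa] := ascending_walk (hsrc h1).
have [q qw qa] := ascending_walk (hsrc h2).
suff : p ++ h1 :: rev_half h2 :: rev_walk q = [::] by case: (p).
apply: (reduced_closed_walk_nil Gtree.2 (v := r)).
  apply/walk_cat; exists (hsrc h1) => //=; split=> //.
  by rewrite hsrc_rev htgt_rev h12; split=> //; exact: walk_rev.
apply: sorted_ascending_cat => //=; first exact: ascendingN.
apply/andP; split.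
  by apply: contraNN n12 => /eqP /(can_inj (@rev_halfK _ G)) ->.
apply: path_descending; last exact: descending_rev_walk.
by have := ascendingN a2; rewrite /descending.
Qed.

Definition worient (e : edge G) : bool := ascending (e, true).
Let wup e := hsrc (e, worient e).
Let wlo e := htgt (e, worient e).

Lemma ascending_worient e : ascending (e, worient e).
Proof.
rewrite /worient; case: (boolP (ascending (e, true))) => // a.
have := level_neq (e, true); move: a; have := wlevel_step (e, false); have := wlevel_step (e, true).
by rewrite /ascending /hsrc /htgt /=; lia.
Qed.

Lemma ascendingE h : ascending h -> h.2 = worient h.1.
Proof.
case: h => e b /= a; have := ascending_worient e.
move: (worient e) a => c; case: b c => [] [] // a b.
  by have := ascendingN b; rewrite /descending a.
by have := ascendingN b; rewrite /descending a.
Qed.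

Lemma wlo_inj : injective wlo.
Proof.
by move=> e1 e2 /(ascending_inj (ascending_worient e1) (ascending_worient e2)) [].
Qed.

Lemma wlo_surj v : v <> r -> exists e, wlo e = v.
Proof.
move=> vr; have [p] := ascending_walk v; case/lastP: p => [|p h] pw; first by case: vr.
rewrite all_rcons => /andP[ha _]; exists h.1.
move: pw; rewrite -cats1 => /walk_cat[x _ /= [_ <-]].
by rewrite /wlo -(ascendingE ha); case: (h).
Qed.

Definition parent_edge v : option (edge G) :=
  if pselect (exists e, wlo e = v) is left ex then Some (projT1 (cid ex)) else None.

Lemma parent_edge_lo e : parent_edge (wlo e) = Some e.
Proof.
rewrite /parent_edge; case: pselect => [ex|]; last by case; exists e.
by congr Some; apply: wlo_inj; case: cid.
Qed.

Lemma parent_edge_root : parent_edge r = None.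
Proof.
rewrite /parent_edge; case: pselect => // -[e er]; exfalso.
by have := ascending_worient e; rewrite /ascending -/(wlo e) er wlevel_root.
Qed.

Definition wpar v := if parent_edge v is Some e then wup e else v.

(** The recursion is driven by the level, which drops by one at each parent; started from [wlevel v]
    it reaches 0 exactly at the root. *)
Fixpoint wdepth_rec n v : R :=
  if n is n'.+1 then
    if parent_edge v is Some e then wdepth_rec n' (wup e) + len e else 0
  else 0.
Definition wdepth v := wdepth_rec (wlevel v) v.

Lemma tree_rooting : rooting r.
Proof.
have lvl e : wlevel (wlo e) = (wlevel (wup e)).+1 by exact/eqP/ascending_worient.
apply: (@Rooting _ _ _ worient wlevel wpar wdepth).
- exact: wlevel_root.
- exact: lvl.
- by rewrite /wpar parent_edge_root.
- by move=> e; rewrite /wpar parent_edge_lo.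
- by rewrite /wdepth wlevel_root.
- by move=> e; rewrite /wdepth -/(wlo e) -/(wup e) lvl /= parent_edge_lo.
- exact: wlo_inj.
- exact: wlo_surj.
Qed.

End TreeRooting.

(** * Paths, distances and branches *)

Section Paths.
Variables (R : realType) (G : metric_graph R).
Implicit Types (x y z : gpoint G) (e : edge G).

Lemma edge_point_src e t : t <= 0 -> edge_point e t = vpoint (src e).
Proof.
by move=> t0; rewrite /edge_point t0 insubF//= [0 < t]ltNge t0.
Qed.

Lemma edge_point_tgt e t : len e <= t -> edge_point e t = vpoint (tgt e).
Proof.
move=> lt; rewrite /edge_point insubF//= ?[t < _]ltNge ?lt ?andbF//.
by rewrite leNgt (lt_le_trans (len_gt0 e) lt).
Qed.

Lemma edge_point_in e t (te : 0 < (e, t).2 < len (e, t).1) :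
  edge_point e t = inr (exist _ (e, t) te).
Proof. by rewrite /edge_point (insubT (fun p => 0 < p.2 < len p.1) te). Qed.

Definition reach x y (l : R) := exists2 p, is_path x p y & path_length p = l.

Lemma is_path_cat x p q y : is_path x (p ++ q) y <->
  exists2 z, is_path x p z & is_path z q y.
Proof.
elim: p x => [|[[e s] t] p IH] x /=; first by split=> [|[z ->]]; [exists x|].
split=> [[se te xE /IH[z pz qz]]|[z [se te xE] pz qz]]; first by exists z.
by split=> //; apply/IH; exists z.
Qed.

Lemma reach_refl x : reach x x 0.
Proof. by exists [::] => //; rewrite /path_length big_nil. Qed.

Lemma reach_trans x y z l m : reach x y l -> reach y z m -> reach x z (l + m).
Proof.
move=> [p px <-] [q qy <-]; exists (p ++ q); first by apply/is_path_cat; exists y.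
by rewrite /path_length big_cat.
Qed.

Lemma reach_edge e s t : 0 <= s <= len e -> 0 <= t <= len e ->
  reach (edge_point e s) (edge_point e t) `|s - t|.
Proof.
move=> se te; exists [:: (e, s, t)] => //=.
by rewrite /path_length big_seq1 distrC.
Qed.

Lemma reach_sym x y l : reach x y l -> reach y x l.
Proof.
move=> [p]; elim: p x l => [|[[e s] t] p IH] x l /=.
  by move=> -> <-; rewrite /path_length big_nil; exact: reach_refl.
move=> [se te -> /IH] yE; rewrite /path_length big_cons /= addrC => <-.
by apply: reach_trans (yE _ erefl) _; exact: reach_edge.
Qed.

Lemma reach_dist x y l : reach x y l -> (dist x y <= l%:E)%E.
Proof. by move=> [p xp <-]; apply: ereal_inf_lbound; exists p. Qed.

Definition lipschitz (H : gpoint G -> R) := forall e (s t : R),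
  0 <= s <= len e -> 0 <= t <= len e ->
  `|H (edge_point e s) - H (edge_point e t)| <= `|s - t|.

(** The triangle inequality along a path. Lower bounds on distances come from such functions: the
    depth, the height in a branch, and a combination of both. *)
Lemma lipschitz_dist H : lipschitz H -> forall x y, (`|H x - H y|%:E <= dist x y)%E.
Proof.
move=> lH x y; apply: le_ereal_inf_tmp => _ [p /= xp <-]; rewrite lee_fin.
elim: p x xp => [|[[e s] t] p IH] x /=.
  by move=> ->; rewrite subrr normr0 /path_length big_nil.
move=> [se te -> /IH]; rewrite /path_length big_cons/= => Hp.
by rewrite (le_trans (ler_distD (H (edge_point e t)) _ _))// lerD// (distrC t) lH.
Qed.

Lemma lipschitz_open H c : lipschitz H -> open [set x | c < H x].
Proof.
move=> lH; suff : metric_open [set x | c < H x] by [].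
move=> x /= cx; exists (H x - c); first by rewrite subr_gt0.
move=> y /(le_lt_trans (lipschitz_dist lH x y)); rewrite lte_fin => xy.
by rewrite -subr_gt0; have := ler_norm (H x - H y); lra.
Qed.

Lemma lipschitz_continuous H : lipschitz H -> continuous H.
Proof.
move=> lH x; have FF := nbhs_filter x.
apply/(@cvgrPdist_lt _ _ _ (nbhs x) FF) => e e0.
have oy : open [set y | - (H x + e) < - H y].
  apply: (@lipschitz_open (fun y => - H y)) => f s t se te.
  by rewrite opprK addrC distrC; exact: lH.
have oz := lipschitz_open (c := H x - e) lH.
apply: filterS (open_nbhs_nbhs (conj (openI oy oz) _)) => [y /= [h1 h2]|].
  by rewrite ltr_norml; lra.
by split => /=; lra.
Qed.

Lemma dist_sym x y : dist x y = dist y x.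
Proof.
congr ereal_inf; apply/seteqP; split=> _ [p /= xp <-];
  have [q yq qE] := reach_sym (ex_intro2 _ _ p xp erefl);
  by exists q; rewrite // qE.
Qed.

Lemma reach_continuous (f : R -> gpoint G) (a b : R) :
  (forall s t, a <= s <= b -> a <= t <= b -> reach (f s) (f t) `|s - t|) ->
  {within `[a, b], continuous f}.
Proof.
move=> fr; apply/subspace_continuousP => s /=; rewrite in_itv/= => se.
move=> A; rewrite nbhsE => -[B [oB Bs] BA].
have [d d0 dB] : exists2 d : R, 0 < d & forall y, (dist (f s) y < d%:E)%E -> B y.
  exact: oB.
exists d => // t /= tr; rewrite in_itv/= => te; apply: BA; apply: dB.
by apply: le_lt_trans (reach_dist (fr _ _ se te)) _; rewrite lte_fin.
Qed.

End Paths.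

Section Rooted.
Variables (R : realType) (G : metric_graph R) (r : vertex G) (rt : rooting r).
Implicit Types (x y z : gpoint G) (e : edge G) (v w : vertex G).
Local Notation up := (up rt).
Local Notation lo := (lo rt).
Local Notation par := (par rt).
Local Notation lev := (level rt).
Local Notation depth := (depth rt).

Lemma level_par v : lev (par v) = (lev v).-1.
Proof.
have [->|/(lo_surj rt)[e <-]] := pselect (v = r).
  by rewrite par_root level_root.
by rewrite par_lo level_lo.
Qed.

Lemma level_eq0 v : lev v = 0%N -> v = r.
Proof.
move=> v0; apply: contrapT => /(lo_surj rt)[e ve].
by move: v0; rewrite -ve level_lo.
Qed.

Lemma lo_neq_root e : lo e <> r.
Proof. by move=> er; have := level_lo rt e; rewrite er level_root. Qed.

Lemma depth_up_lt e : depth (up e) < depth (lo e).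
Proof. by rewrite depth_lo ltrDl len_gt0. Qed.

Lemma depth_par v : depth (par v) <= depth v.
Proof.
have [->|/(lo_surj rt)[e <-]] := pselect (v = r); first by rewrite par_root.
by rewrite par_lo ltW// depth_up_lt.
Qed.

Lemma level_iter_par k v : lev (iter k par v) = (lev v - k)%N.
Proof. by elim: k => [|k IH]; rewrite ?subn0//= level_par IH; lia. Qed.

Lemma depth_iter_par k v : depth (iter k par v) <= depth v.
Proof. by elim: k => [//|k IH] /=; rewrite (le_trans (depth_par _)). Qed.

Definition anc v w := exists k, iter k par w = v.

Lemma anc_refl v : anc v v. Proof. by exists 0%N. Qed.
Hint Resolve anc_refl : core.

Lemma anc_trans u v w : anc u v -> anc v w -> anc u w.
Proof. by move=> [k <-] [j <-]; exists (k + j)%N; rewrite iterD. Qed.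

Lemma anc_par v : anc (par v) v. Proof. by exists 1%N. Qed.

Lemma anc_up e : anc (up e) (lo e).
Proof. by rewrite -(par_lo rt); exact: anc_par. Qed.

Lemma anc_root v : anc r v.
Proof. by exists (lev v); apply: level_eq0; rewrite level_iter_par subnn. Qed.

Lemma anc_level v w : anc v w -> (lev v <= lev w)%N.
Proof. by move=> [k <-]; rewrite level_iter_par leq_subr. Qed.

Lemma anc_depth v w : anc v w -> depth v <= depth w.
Proof. by move=> [k <-]; exact: depth_iter_par. Qed.

Lemma depth_ge0 v : 0 <= depth v.
Proof. by rewrite -(depth_root rt) anc_depth//; exact: anc_root. Qed.

Lemma anc_level_eq v w : anc v w -> lev v = lev w -> v = w.
Proof.
move=> [[//|k] <-] /esym; rewrite level_iter_par => lw.
have /level_eq0 -> : lev w = 0%N by lia.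
by elim: (k.+1) => //= n ->; exact: par_root.
Qed.

Lemma anc_anti v w : anc v w -> anc w v -> v = w.
Proof.
by move=> vw wv; apply: anc_level_eq => //; have := anc_level vw; have := anc_level wv; lia.
Qed.

Lemma anc_parE v w : anc v w -> v = w \/ anc v (par w).
Proof. by move=> [[|k] <-]; [left|right; exists k; rewrite -iterSr]. Qed.

Lemma anc_lo v e : anc v (lo e) <-> v = lo e \/ anc v (up e).
Proof.
split=> [/anc_parE[]|[->//|vu]]; rewrite ?par_lo; [by left|by right|].
exact: anc_trans (anc_up e).
Qed.

Lemma anc_total u v w : anc u w -> anc v w -> anc u v \/ anc v u.
Proof.
move=> [j <-] [k <-]; have [jk|/ltnW jk] := leqP j k.
  by right; exists (k - j)%N; rewrite -iterD subnK.
by left; exists (j - k)%N; rewrite -iterD subnK.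
Qed.

Lemma anc_up_lo e : ~ anc (lo e) (up e).
Proof. by move/anc_level; rewrite level_lo; lia. Qed.

(* The point of [e] at distance [a] from the end nearer to the root. *)
Definition ep e (a : R) := edge_point e (if orient rt e then a else len e - a).

(* The first vertex at or below [x]. *)
Definition bot x : vertex G :=
  match x with inl v => v | inr p => lo (val p).1 end.

Definition dep x : R :=
  match x with
  | inl v => depth v
  | inr p => depth (up (val p).1) +
      (if orient rt (val p).1 then (val p).2 else len (val p).1 - (val p).2)
  end.

Lemma ep0 e : ep e 0 = vpoint (up e).
Proof.
rewrite /ep /up /hsrc; case: (orient rt e) => /=; first by rewrite edge_point_src.
by rewrite edge_point_tgt// subr0.
Qed.

Lemma ep_len e : ep e (len e) = vpoint (lo e).
Proof.
rewrite /ep /lo /htgt; case: (orient rt e) => /=; first by rewrite edge_point_tgt.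
by rewrite edge_point_src// subrr.
Qed.

Lemma edge_pointE e t : edge_point e t = ep e (if orient rt e then t else len e - t).
Proof. by rewrite /ep; case: (orient rt e) => //; rewrite subKr. Qed.

Lemma bot_ep e a : 0 < a <= len e -> bot (ep e a) = lo e.
Proof.
move=> /andP[a0]; rewrite le_eqVlt => /predU1P[->|al]; first by rewrite ep_len.
have te : 0 < (e, if orient rt e then a else len e - a).2 < len (e, a).1.
  by rewrite /=; case: (orient rt e); lra.
by rewrite /ep (edge_point_in te).
Qed.

Lemma dep_ep e a : 0 <= a <= len e -> dep (ep e a) = depth (up e) + a.
Proof.
move=> /andP[]; rewrite le_eqVlt => /predU1P[<- _|a0]; first by rewrite ep0 addr0.
rewrite le_eqVlt => /predU1P[->|al]; first by rewrite ep_len /= depth_lo.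
have te : 0 < (e, if orient rt e then a else len e - a).2 < len (e, a).1.
  by rewrite /=; case: (orient rt e); lra.
rewrite /ep (edge_point_in te)/=.
by case: (orient rt e) => //; rewrite subKr.
Qed.

Lemma gpointP x : x = vpoint r \/ exists e a, 0 < a <= len e /\ x = ep e a.
Proof.
case: x => [v|[[e t] /= te]].
  have [->|/(lo_surj rt)[e <-]] := pselect (v = r); [by left|right].
  by exists e, (len e); rewrite lexx len_gt0 ep_len.
right; exists e, (if orient rt e then t else len e - t); split.
  by case: (orient rt e); lra.
by rewrite -edge_pointE (edge_point_in te).
Qed.

(** The pair ([bot], [dep]) serves as a coordinate system on the graph. *)
Lemma bot_dep_inj x y : bot x = bot y -> dep x = dep y -> x = y.
Proof.
have [->|[e [a [ae ->]]]] := gpointP x; have [->|[f [b [bf ->]]]] := gpointP y => //.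
- by rewrite bot_ep//= => /esym /lo_neq_root.
- by rewrite bot_ep//= => /lo_neq_root.
rewrite !bot_ep// => /lo_inj ef; rewrite -{}ef in bf *.
by rewrite !dep_ep ?(ltW (andP ae).1)//; [move=> /addrI->|lra|lra].
Qed.

Lemma lipschitz_ep (H : gpoint G -> R) :
  (forall e (a b : R), 0 <= a <= len e -> 0 <= b <= len e ->
    `|H (ep e a) - H (ep e b)| <= `|a - b|) -> lipschitz H.
Proof.
move=> lH e s t se te; rewrite !edge_pointE.
have -> : `|s - t| = `|(if orient rt e then s else len e - s) -
    (if orient rt e then t else len e - t)|.
  by case: (orient rt e) => //; rewrite distrC; congr `|_|; ring.
by apply: lH; case: (orient rt e); lra.
Qed.

Lemma lipschitz_dep : lipschitz dep.
Proof.
apply: lipschitz_ep => e a b ae be; rewrite !dep_ep//.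
by rewrite opprD addrACA subrr add0r.
Qed.

Lemma reach_ep e a b : 0 <= a <= len e -> 0 <= b <= len e ->
  reach (ep e a) (ep e b) `|a - b|.
Proof.
move=> ae be.
have -> : `|a - b| = `|(if orient rt e then a else len e - a) -
    (if orient rt e then b else len e - b)|.
  by case: (orient rt e) => //; rewrite distrC; congr `|_|; ring.
by apply: reach_edge; case: (orient rt e); lra.
Qed.

Lemma dep_bot x : dep x <= depth (bot x).
Proof.
have [->//|[e [a [ae ->]]]] := gpointP x.
by rewrite bot_ep// dep_ep ?depth_lo; lra.
Qed.

Lemma depth_par_bot x : bot x <> r -> depth (par (bot x)) < dep x.
Proof.
have [->//|[e [a [ae ->]]] _] := gpointP x.
by rewrite bot_ep// par_lo dep_ep; lra.
Qed.

Lemma dep_ge0 x : 0 <= dep x.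
Proof.
have [->|[e [a [ae ->]]]] := gpointP x; first by rewrite /= depth_root.
by rewrite dep_ep ?addr_ge0 ?depth_ge0//; lra.
Qed.

Lemma reach_anc x y : anc (bot x) (bot y) -> dep x <= dep y -> reach x y (dep y - dep x).
Proof.
move=> [k]; elim: k y => [|k IH] y.
  have [->|[e [a [ae ->]]]] := gpointP x; have [->|[f [b [bf ->]]]] := gpointP y => //=.
  - by move=> _ _; rewrite subrr; exact: reach_refl.
  - by rewrite bot_ep// => /lo_neq_root.
  - by rewrite bot_ep// => /esym/lo_neq_root.
  rewrite !bot_ep// => /lo_inj ef; rewrite {}ef in bf *.
  rewrite !dep_ep ?(ltW (andP ae).1)//; [|lra|lra].
  rewrite lerD2l => ab.
  have -> : depth (up e) + b - (depth (up e) + a) = `|a - b|.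
    by rewrite distrC ger0_norm ?subr_ge0//; lra.
  by apply: reach_ep; lra.
rewrite iterSr => xk xy.
have [yr|yr] := pselect (bot y = r).
  by apply: IH => //; rewrite -xk yr par_root.
have xp : dep x <= depth (par (bot y)).
  apply: le_trans (dep_bot x) _; apply: anc_depth; by exists k.
have xpy := IH (vpoint (par (bot y))) xk xp.
have -> : dep y - dep x = (dep (vpoint (par (bot y))) - dep x) + (dep y - depth (par (bot y))).
  by rewrite /=; lra.
apply: reach_trans xpy _; move: yr.
have [->//|[e [a [ae ->]]] _] := gpointP y.
rewrite bot_ep// par_lo dep_ep; last lra.
have -> : depth (up e) + a - depth (up e) = `|0 - a| by rewrite sub0r normrN ger0_norm; lra.
by rewrite -ep0; apply: reach_ep; lra.
Qed.

(** The path through the ancestors gives one bound, the Lipschitz function [dep] the other. *)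
Lemma dist_anc x y : anc (bot x) (bot y) -> dep x <= dep y ->
  dist x y = (dep y - dep x)%:E.
Proof.
move=> xy dxy; apply/le_anti; rewrite reach_dist/=; last exact: reach_anc.
by apply: le_trans (lipschitz_dist lipschitz_dep x y); rewrite lee_fin distrC ler_norm.
Qed.

Lemma dist_root x : dist (vpoint r) x = (dep x)%:E.
Proof.
rewrite dist_anc/= ?depth_root ?subr0 ?dep_ge0//; exact: anc_root.
Qed.

(* The points of the closed branch hanging from the parent of [w] through [w],
   the parent itself excluded. *)
Definition branch w : set (gpoint G) := [set x | anc w (bot x)].

(** The distance to the attaching vertex inside the branch, extended by 0. As it vanishes at that
    vertex it is 1-Lipschitz, which makes the branch open and separates it from the rest. *)
Definition branch_height w x : R :=
  if `[< branch w x >] then dep x - depth (par w) else 0.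

Lemma branch_height_in w x : branch w x -> branch_height w x = dep x - depth (par w).
Proof. by move=> wx; rewrite /branch_height asboolT. Qed.

Lemma branch_height_out w x : ~ branch w x -> branch_height w x = 0.
Proof. by move=> wx; rewrite /branch_height asboolF. Qed.

Lemma branch_gt w x : w <> r -> branch w x -> depth (par w) < dep x.
Proof.
move=> wr wx.
have xr : bot x <> r by move=> xr; apply: wr; apply: anc_anti; [rewrite -xr|exact: anc_root].
case: (anc_parE wx) => [->|/anc_depth h]; first exact: depth_par_bot.
by apply: le_lt_trans (depth_par _) _; apply: le_lt_trans h _; exact: depth_par_bot.
Qed.

Lemma branch_ep w e a : 0 < a <= len e -> branch w (ep e a) <-> anc w (lo e).
Proof. by move=> ae; rewrite /branch/= bot_ep. Qed.

Lemma branch_height_ep w e (a : R) : w <> r -> 0 <= a <= len e ->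
  branch_height w (ep e a) =
  if `[< anc w (lo e) >] then depth (up e) + a - depth (par w) else 0.
Proof.
move=> wr /andP[]; rewrite le_eqVlt => /predU1P[<- _|a0 al].
  rewrite ep0 addr0; case: asboolP => [/anc_lo[->|wu]|wn].
  - by rewrite par_lo subrr branch_height_out//; exact: anc_up_lo.
  - by rewrite branch_height_in.
  - by rewrite branch_height_out// => wu; apply: wn; apply/anc_lo; right.
have ae : 0 < a <= len e by rewrite a0.
have bE := branch_ep w ae; case: asboolP => wn.
  by rewrite branch_height_in ?dep_ep ?(ltW a0)//; apply/bE.
by rewrite branch_height_out// => /bE.
Qed.

Lemma lipschitz_branch_height w : w <> r -> lipschitz (branch_height w).
Proof.
move=> wr; apply: lipschitz_ep => e a b ae be; rewrite !branch_height_ep//.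
case: ifP => _; last by rewrite subrr normr0.
by rewrite le_eqVlt; apply/orP; left; apply/eqP; congr `|_|; ring.
Qed.

Lemma branchE w : w <> r -> branch w = [set x | 0 < branch_height w x].
Proof.
move=> wr; apply/seteqP; split=> x /= wx.
  by rewrite branch_height_in// subr_gt0 branch_gt.
by apply: contrapT => /branch_height_out wx0; rewrite wx0 ltxx in wx.
Qed.

Lemma open_branch w : w <> r -> open (branch w).
Proof. by move=> wr; rewrite branchE//; apply: lipschitz_open; exact: lipschitz_branch_height. Qed.

Lemma anc_depth_eq v w : anc v w -> depth v = depth w -> v = w.
Proof.
move=> vw dvw; have [->//|/anc_depth vp] := anc_parE vw.
have [wr|wr] := pselect (w = r).
  by apply: anc_anti => //; rewrite wr; exact: anc_root.
by have := depth_par_bot (x := vpoint w) wr; rewrite /= -dvw ltNge vp.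
Qed.

Lemma anc_bot_of_dep x y w : anc (bot x) w -> anc (bot y) w -> dep x <= dep y ->
  anc (bot x) (bot y).
Proof.
move=> xw yw xy; have [//|/anc_parE[->//|/anc_depth yx]] := anc_total xw yw.
have [xr|xr] := pselect (bot x = r); first by rewrite xr; exact: anc_root.
have := depth_par_bot xr; have := dep_bot y; lra.
Qed.

Lemma anc_dep_inj x y w : anc (bot x) w -> anc (bot y) w -> dep x = dep y -> x = y.
Proof.
move=> xw yw xy; apply: bot_dep_inj => //; apply: anc_anti;
  by apply: (anc_bot_of_dep (w := w)) => //; rewrite xy.
Qed.

Lemma dep_gt0 x : x <> vpoint r -> 0 < dep x.
Proof.
have [->//|[e [a [ae ->]]] _] := gpointP x.
by rewrite dep_ep ?ltr_wpDl ?depth_ge0//; lra.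
Qed.

Lemma open_dep_lt c : open [set x | dep x < c].
Proof.
rewrite (_ : mkset _ = [set x | - c < - dep x]); last first.
  by apply/seteqP; split=> x /=; rewrite ltrN2.
apply: (@lipschitz_open _ _ (fun x => - dep x)) => e s t se te.
by rewrite opprK addrC distrC; exact: lipschitz_dep.
Qed.

Lemma closure_branch w : w <> r ->
  closure (branch w) `<=` branch w `|` [set vpoint (par w)].
Proof.
move=> wr x cx; apply: contrapT => /not_orP[xw xp].
suff [B oB [Bx Bw]] : exists2 B, open B & B x /\ forall y, B y -> ~ branch w y.
  have [y [wy By]] := cx B (open_nbhs_nbhs (conj oB Bx)).
  exact: Bw wy.
have [xlt|lex] := ltP (dep x) (depth (par w)).
  exists [set y | dep y < depth (par w)]; first exact: open_dep_lt.
  by split => // y /= yw /(branch_gt wr); rewrite ltNge ltW.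
(* A point outside the branch, at least as deep as the parent and different from it, is not on the
   way from the root to w; hence its own branch is a neighbourhood disjoint from [branch w]. *)
have xNw : ~ anc (bot x) w.
  move=> /anc_parE[bw|bp]; first by apply: xw; rewrite /branch/= bw; exact: anc_refl.
  have dbx := dep_bot x; have dbp := anc_depth bp.
  have bE : bot x = par w by apply: anc_depth_eq => //; apply/le_anti; rewrite dbp (le_trans lex).
  by apply: xp; apply: bot_dep_inj => //=; apply/le_anti; rewrite lex (le_trans dbx).
exists (branch (bot x)).
  by apply: open_branch => xr; apply: xNw; rewrite xr; exact: anc_root.
split=> [|y xy wy]; first exact: anc_refl.
by have [//|wx] := anc_total xy wy; exact: xw.
Qed.

Lemma ep_continuous e : {within `[0, len e], continuous (ep e)}.
Proof. by apply: reach_continuous => s t; exact: reach_ep. Qed.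

Lemma ep_segment_connected e a : 0 <= a <= len e ->
  connected (ep e @` `[0, a]) /\ connected (ep e @` `[a, len e]).
Proof.
move=> ae; split; apply: connected_continuous_connected;
  try exact: segment_connected; apply: continuous_subspaceW (@ep_continuous e);
  by move=> t /=; rewrite !in_itv/=; lra.
Qed.

(** Each point is joined to [vpoint w] by edge segments inside the branch; the branch is the union
    of these connected sets, which share that vertex. *)
Lemma connected_branch w : w <> r -> connected (branch w).
Proof.
move=> wr.
have H y : branch w y -> exists C, [/\ connected C, C (vpoint w), C y & C `<=` branch w].
  move=> [k]; elim: k y => [|k IH] y wy; have [yE|[e [a [ae yE]]]] := gpointP y.
  - by case: wr; rewrite -wy yE.
  - have wE : lo e = w by rewrite -wy yE /= bot_ep.
    exists (ep e @` `[a, len e]); split.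
    + by apply: (ep_segment_connected _).2; lra.
    + by exists (len e); rewrite ?ep_len ?wE//= in_itv/=; lra.
    + by exists a; rewrite ?yE//= in_itv/=; lra.
    + move=> _ [t /= + <-]; rewrite in_itv/= => te.
      by apply/branch_ep; [lra|rewrite wE; exact: anc_refl].
  - case: wr; rewrite -wy yE; elim: (k.+1) => //= n ->; exact: par_root.
  have be : bot y = lo e by rewrite yE bot_ep.
  have [|C [cC Cw Cz CU]] := IH (vpoint (up e)).
    by rewrite /= -wy iterSr be par_lo.
  have Se : connected (ep e @` `[0, a]) by apply: (ep_segment_connected _).1; lra.
  have S0 : (ep e @` `[0, a]) (vpoint (up e)).
    by exists 0; rewrite ?ep0//= in_itv/=; lra.
  exists (C `|` (ep e @` `[0, a])); split.
  - by apply: connectedU => //; exists (vpoint (up e)).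
  - by left.
  - by right; exists a; rewrite ?yE//= in_itv/=; lra.
  - move=> z [/CU//|[t /= + <-]]; rewrite in_itv/= => /andP[].
    rewrite le_eqVlt => /predU1P[<- _|t0 ta]; first by rewrite ep0; exact: CU Cz.
    apply/branch_ep; first by lra.
    by exists k.+1; rewrite -wy be.
have /choice[C CP] : forall y : {y | branch w y}, exists C,
    [/\ connected C, C (vpoint w), C (sval y) & C `<=` branch w].
  by case=> y wy; exact: H.
have -> : branch w = \bigcup_y C y.
  apply/seteqP; split=> [y wy|y [z _]].
    by exists (exist _ y wy) => //; case: (CP (exist _ y wy)).
  by have [_ _ _] := CP z; apply.
apply: bigcup_connected => [|y _]; last by case: (CP y).
by exists (vpoint w) => y _; case: (CP y).
Qed.

Lemma compact_boundary_branch w : w <> r ->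
  compact (closure (branch w) `\` interior (branch w)).
Proof.
move=> wr; apply: (@subclosed_compact _ _ [set vpoint (par w)]).
- apply: closedI; first exact: closed_closure.
  by apply: open_closedC; exact: open_interior.
- exact: compact_set1.
- move=> x [/(closure_branch wr)[wx|//] nx]; exfalso; apply: nx.
  exact: open_nbhs_nbhs (conj (open_branch wr) wx).
Qed.

Lemma point_at_depth v s : 0 <= s <= depth v -> exists2 x, anc (bot x) v & dep x = s.
Proof.
have [n] := ubnP (lev v); elim: n v => // n IH v vn /andP[s0 sv].
have [vr|] := pselect (v = r).
  exists (vpoint r); first by rewrite vr; exact: anc_refl.
  by apply/le_anti; rewrite /= depth_root s0 (le_trans sv)// vr depth_root.
move=> /(lo_surj rt)[e ve]; have [su|us] := leP s (depth (up e)).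
  have [||x xu xs] := IH (up e); rewrite ?s0//.
    by move: vn; rewrite -ve level_lo.
  by exists x => //; rewrite -ve; apply: anc_trans xu (anc_up e).
have sl : 0 < s - depth (up e) <= len e.
  by rewrite subr_gt0 us lerBlDl -depth_lo ve.
exists (ep e (s - depth (up e))); first by rewrite bot_ep// -ve; exact: anc_refl.
by rewrite dep_ep ?subrKC//; lra.
Qed.

(** * Rays of vertices and the ends they define *)

Section Ray.
Variable u : nat -> vertex G.
Hypothesis uray : forall j, exists2 e, up e = u j & lo e = u j.+1.

Lemma ray_level j : lev (u j) = (lev (u 0%N) + j)%N.
Proof.
elim: j => [|j IH]; first by rewrite addn0.
by have [e eu <-] := uray j; rewrite level_lo eu IH addnS.
Qed.

Lemma ray_neq_root j : u j.+1 <> r.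
Proof. by move=> ur; have := ray_level j.+1; rewrite ur level_root; lia. Qed.

Lemma ray_par j : par (u j.+1) = u j.
Proof. by have [e <- <-] := uray j; rewrite par_lo. Qed.

Lemma ray_anc i j : (i <= j)%N -> anc (u i) (u j).
Proof.
move=> ij; exists (j - i)%N; rewrite -[in u j](subnK ij).
by elim: (j - i)%N => // n IH; rewrite addSn iterSr ray_par.
Qed.

Lemma ray_depth_lt j : depth (u j) < depth (u j.+1).
Proof. by have [e <- <-] := uray j; exact: depth_up_lt. Qed.

(** The index is shifted because [u 0] may be the root, whose branch is the whole graph. [cut j]
    starts just below [u j], its only possible boundary point. *)
Definition cut j : set (gpoint G) := branch (u j.+1).

Lemma cut_level j x : closure (cut j) x -> (j <= lev (bot x))%N.
Proof.
move=> /(closure_branch (@ray_neq_root j)) [/anc_level|->]; rewrite ?ray_par /= ray_level; lia.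
Qed.

Lemma cut_end_seq : end_seq cut.
Proof.
split.
- move=> j; split; [|exact/open_branch/ray_neq_root
    |exact/connected_branch/ray_neq_root|exact/compact_boundary_branch/ray_neq_root].
  by exists (vpoint (u j.+1)); exact: anc_refl.
- by move=> j x; apply: anc_trans; exact: ray_anc.
- apply/seteqP; split=> // x xc.
  by have := cut_level (xc (lev (bot x)).+1 I); rewrite ltnn.
Qed.

Definition ray_end : set (nat -> set (gpoint G)) :=
  [set U | end_seq U /\ end_equiv cut U].

Lemma ray_end_cut : ray_end cut.
Proof. by split; [exact: cut_end_seq|move=> n; exists n, n; split=> x]. Qed.

Lemma ends_ray_end : ends ray_end.
Proof. by exists cut => //; exact: cut_end_seq. Qed.

(** A ray to this end has to enter [cut j], and its arc length from the root equals its depth. *)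
Lemma dist_end_root_ge j : ((depth (u j))%:E <= dist_end (vpoint r) ray_end)%E.
Proof.
apply: le_ereal_inf_tmp => l [f [f0 fd ft]].
have [t [t0 tl ct]] := ft cut j ray_end_cut.
apply: le_trans (ltW tl); rewrite lee_fin.
have := branch_gt (@ray_neq_root j) (ct t (lexx _) tl); rewrite ray_par => /ltW/le_trans; apply.
have l0 : (0%:E < l)%E by apply: le_lt_trans tl; rewrite lee_fin.
have := fd 0 t (lexx _) t0 l0 tl; rewrite f0 dist_root sub0r normrN ger0_norm// => -[->].
by [].
Qed.

(** S is the supremum of the depths along u. The ray is parametrised by depth: at time t it is at
    the point of depth [dep x + t] on the way from the root to some [u j]. *)
Lemma dist_end_le (S : R) x : (forall j, depth (u j) < S) ->
  (forall s, s < S -> exists j, s < depth (u j)) ->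
  (exists j, anc (bot x) (u j)) ->
  (dist_end x ray_end <= (S - dep x)%:E)%E.
Proof.
move=> uS Su [i xi]; apply: ereal_inf_lbound.
have /choice[f fP] : forall t : R, exists y, 0 <= t -> t < S - dep x ->
    (exists j, anc (bot y) (u j)) /\ dep y = dep x + t.
  move=> t; have [/andP[t0 tS]|h] := boolP ((0 <= t) && (t < S - dep x)); last first.
    by exists x => t0 tS; move: h; rewrite t0 tS.
  have [j tj] := Su (dep x + t) ltac:(lra).
  have [y yj yt] : exists2 y, anc (bot y) (u j) & dep y = dep x + t.
    by apply: point_at_depth; rewrite addr_ge0 ?dep_ge0//= ltW.
  by exists y => _ _; split => //; exists j.
exists f; split.
- have x0 : 0 < S - dep x.
    by rewrite subr_gt0; apply: le_lt_trans (uS i); apply: le_trans (dep_bot x) (anc_depth xi).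
  have [[j yj] yd] := fP 0 (lexx _) x0.
  apply: (anc_dep_inj (w := u (maxn i j))); last by rewrite yd addr0.
    by apply: anc_trans yj (ray_anc _); exact: leq_maxr.
  by apply: anc_trans xi (ray_anc _); exact: leq_maxl.
- move=> s t s0 t0; rewrite !lte_fin => sS tS.
  wlog st : s t s0 t0 sS tS / s <= t.
    move=> h; have [/h|/ltW/h] := leP s t; first exact.
    by rewrite dist_sym distrC; exact.
  have [[j yj] yd] := fP s s0 sS; have [[k zk] zd] := fP t t0 tS.
  have dst : dep (f s) <= dep (f t) by rewrite yd zd lerD2l.
  rewrite dist_anc//; last first.
    apply: (anc_bot_of_dep (w := u (maxn j k))) => //.
      by apply: anc_trans yj (ray_anc _); exact: leq_maxl.
    by apply: anc_trans zk (ray_anc _); exact: leq_maxr.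
  by rewrite yd zd distrC ger0_norm ?subr_ge0//; congr _%:E; ring.
- move=> U n [_ /(_ n)[j [k [_ kU]]]].
  (* The time at which the ray passes [u k.+1], or 0 if x is already as deep. *)
  exists (Num.max 0 (depth (u k.+1) - dep x)); split.
  + by rewrite le_max lexx.
  + rewrite lte_fin gt_max; have := uS k.+1; have := uS i; have := anc_depth xi; have := dep_bot x.
    by move=> *; apply/andP; split; lra.
  + move=> t; rewrite ge_max lte_fin => /andP[t0 kt] tS; apply: kU.
    have [[m ym] yd] := fP t t0 tS.
    apply: (@anc_bot_of_dep (vpoint (u k.+1)) _ (u (maxn k.+1 m))) => /=.
    * by apply: ray_anc; exact: leq_maxl.
    * by apply: anc_trans ym (ray_anc _); exact: leq_maxr.
    * by rewrite yd; lra.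
Qed.

End Ray.

Definition descending_ray (u : nat -> vertex G) :=
  forall j, exists2 e, up e = u j & lo e = u j.+1.

Lemma end_seq_mono (U : nat -> set (gpoint G)) : end_seq U ->
  forall n m, (n <= m)%N -> U m `<=` U n.
Proof.
move=> [_ dU _] n m /subnK<-; elim: (m - n)%N => // k IH.
by rewrite addSn; exact: subset_trans (dU _) IH.
Qed.

(** Otherwise points of the compact edge, one in each [U n], would have a cluster point, and it
    would lie in every [closure (U n)]. *)
Lemma end_seq_avoids_edge (U : nat -> set (gpoint G)) e : end_seq U ->
  exists n, forall a, 0 <= a <= len e -> ~ U n (ep e a).
Proof.
move=> eU; apply: contrapT => /forallNP Uex.
pose K := ep e @` `[0, len e].
have cK : compact K.
  by apply: continuous_compact; [exact: ep_continuous|exact: segment_compact].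
have /choice[x xP] : forall n, exists x, K x /\ U n x.
  move=> n; have := Uex n => /existsNP[a /not_implyP[ae /contrapT Ua]].
  by exists (ep e a); split=> //; exists a.
have FK : (x @ \oo) K by exists 0%N => // n _; case: (xP n).
have [y [Ky cy]] := cK (x @ \oo) _ FK.
suff : (\bigcap_n closure (U n)) y by case: eU => _ _ ->.
move=> n _ B yB.
have : (x @ \oo) (U n).
  by exists n => // m /= nm; apply: (end_seq_mono eU nm); case: (xP m).
by move=> /cy /(_ yB)[z [zU zB]]; exists z.
Qed.

(** * Leaves and levels of a locally finite tree *)

Hypothesis Glf : locally_finite G.

Lemma finite_children v : finite_set [set e | up e = v].
Proof.
apply: sub_finite_set (finite_image (fun h : edge G * bool => h.1) (Glf v)).
by move=> e /= ev; exists (e, orient rt e).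
Qed.

Definition children v : seq (edge G) := fset_set [set e | up e = v].

Lemma mem_children v e : (e \in children v) = (up e == v).
Proof.
rewrite in_fset_set; last exact: finite_children.
by apply/idP/eqP; rewrite inE.
Qed.

Lemma uniq_children v : uniq (children v).
Proof. exact: fset_uniq. Qed.

(** The half-edges at a non-root vertex are the reversed parent edge and one for each child. *)
Lemma leafP v : v <> r -> deg v = 1%N <-> children v = [::].
Proof.
move=> /(lo_surj rt)[e0 e0v].
have s0 : star_at v (e0, ~~ orient rt e0).
  by rewrite /star_at/= -e0v /lo /hsrc /htgt /=; case: (orient rt e0).
have sch e : up e = v -> star_at v (e, orient rt e) by [].
rewrite /deg; split=> [/eqP/cardfs1P[h hE]|c0].
  have mh g : star_at v g -> g = h.
    move=> gv; have : g \in fset_set (star_at v) by rewrite in_fset_set// inE.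
    by rewrite hE inE => /eqP.
  case cE: (children v) => [//|e c].
  have ev : up e = v by apply/eqP; rewrite -mem_children cE mem_head.
  have := mh _ (sch e ev); rewrite -(mh _ s0) => -[ee0].
  by rewrite ee0; case: (orient rt e0).
have -> : star_at v = [set (e0, ~~ orient rt e0)].
  apply/seteqP; split=> [[e b] /= eb|_ ->//].
  have [be|be] := eqVneq b (orient rt e).
    have : e \in children v by rewrite mem_children /up -be; exact/eqP.
    by rewrite c0.
  have bE : b = ~~ orient rt e by case: b (orient rt e) be {eb} => [] [].
  suff -> : e0 = e by rewrite bE.
  apply: (@lo_inj _ _ _ rt); rewrite e0v -eb bE /lo /hsrc /htgt /=.
  by case: (orient rt e).
by rewrite fset_set1 cardfs1.
Qed.

Fixpoint levelV n : seq (vertex G) :=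
  if n is n'.+1 then map lo (flatten (map children (levelV n'))) else [:: r].
Definition levelE n := flatten (map children (levelV n)).

Lemma mem_levelV n v : (v \in levelV n) = (lev v == n).
Proof.
elim: n v => [|n IH] v /=.
  by rewrite inE; apply/eqP/eqP => [->|/level_eq0//]; exact: level_root.
apply/mapP/eqP => [[e /flatten_mapP[w wn]]|vn].
  by rewrite mem_children => /eqP eu ->; move: wn; rewrite level_lo eu IH => /eqP->.
have /(lo_surj rt)[e ve] : v <> r by move=> vr; move: vn; rewrite vr level_root.
exists e => //; apply/flatten_mapP; exists (up e); last by rewrite mem_children.
by move: vn; rewrite IH -ve level_lo => -[->].
Qed.

Lemma mem_levelE n e : (e \in levelE n) = (lev (up e) == n).
Proof.
apply/flatten_mapP/eqP => [[w wn]|en].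
  by rewrite mem_children => /eqP->; apply/eqP; rewrite -mem_levelV.
by exists (up e); rewrite ?mem_children// mem_levelV en.
Qed.

Lemma uniq_levels n : uniq (levelV n) /\ uniq (levelE n).
Proof.
have H s : uniq s -> uniq (flatten (map children s)).
  elim: s => //= v s IH /andP[vs us]; rewrite cat_uniq uniq_children IH// andbT.
  apply/hasPn => e /flatten_mapP[w ws]; rewrite mem_children => /eqP ew.
  rewrite mem_children ew; apply: contraNN vs => /eqP<-//.
elim: n => [|n [uV uE]]; first by split=> //; exact: H.
have uV' : uniq (levelV n.+1) by rewrite map_inj_uniq//; exact: lo_inj.
by split=> //; exact: H.
Qed.

Lemma sum_levelE (F : edge G -> R) n :
  \sum_(e <- levelE n) F e = \sum_(v <- levelV n) \sum_(e <- children v) F e.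
Proof. by rewrite big_flatten big_map. Qed.

Lemma sum_levelVS (F : vertex G -> R) n :
  \sum_(v <- levelV n.+1) F v = \sum_(e <- levelE n) F (lo e).
Proof. by rewrite big_map. Qed.

(** By local finiteness the first N levels have finitely many edges, and each is eventually avoided.
    The root is excluded separately, since for N = 0 no edge is listed. *)
Lemma end_seq_avoids_level (U : nat -> set (gpoint G)) N : end_seq U ->
  exists n, forall m x, (n <= m)%N -> U m x -> (N < lev (bot x))%N.
Proof.
move=> eU.
have H (s : seq (edge G)) : exists n, forall e a, e \in s -> 0 <= a <= len e -> ~ U n (ep e a).
  elim: s => [|e s [n Hn]]; first by exists 0%N.
  have [m Hm] := end_seq_avoids_edge e eU.
  exists (maxn n m) => f a; rewrite inE => /predU1P[->|fs] ae.
    by move=> /(end_seq_mono eU (leq_maxr n m)); exact: Hm.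
  by move=> /(end_seq_mono eU (leq_maxl n m)); exact: Hn.
have [n1 H1] := H (flatten [seq levelE i | i <- iota 0 N]).
have [n2 H2] : exists n, ~ closure (U n) (vpoint r).
  apply: contrapT => /forallNP h; case: eU => _ _ U0.
  suff : (\bigcap_n closure (U n)) (vpoint r) by rewrite U0.
  by move=> n _; apply: contrapT; exact: h.
exists (maxn n1 n2) => m x nm Ux.
have [xr|[e [a [ae xE]]]] := gpointP x.
  exfalso; apply: H2; apply: subset_closure; rewrite -xr.
  by apply: end_seq_mono eU _ _ _ _ Ux; rewrite (leq_trans (leq_maxr n1 n2)).
rewrite xE bot_ep// level_lo ltnS leqNgt; apply/negP => eN.
apply: (H1 e a); [|lra|].
  apply/flatten_mapP; exists (lev (up e)); last by rewrite mem_levelE.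
  by rewrite mem_iota.
by rewrite -xE; apply: end_seq_mono eU _ _ _ _ Ux; rewrite (leq_trans (leq_maxl n1 n2)).
Qed.

Fixpoint levelsE n : seq (edge G) :=
  if n is n'.+1 then levelsE n' ++ levelE n' else [::].

Lemma mem_levelsE n e : (e \in levelsE n) = (lev (up e) < n)%N.
Proof. by elim: n => [|n IH] //=; rewrite mem_cat IH mem_levelE ltnS orbC -leq_eqVlt. Qed.

Lemma uniq_levelsE n : uniq (levelsE n).
Proof.
elim: n => //= n IH; rewrite cat_uniq IH (uniq_levels n).2 andbT/=.
by apply/hasPn => e; rewrite mem_levelE mem_levelsE => /eqP->; rewrite ltnn.
Qed.

(** * The lower bound *)

Section LevelSums.
Variable a : edge G -> R.
Hypothesis a0 : forall e, 0 <= a e.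

Definition psum n : R := \sum_(e <- levelsE n) a e.

Lemma psumS n : psum n.+1 = psum n + \sum_(e <- levelE n) a e.
Proof. by rewrite /psum big_cat. Qed.

Lemma psum_mono n m : (n <= m)%N -> psum n <= psum m.
Proof.
move=> /subnK<-; elim: (m - n)%N => // k IH.
by rewrite addSn psumS (le_trans IH)// lerDl sumr_ge0.
Qed.

Lemma psum_le_esum n : ((psum n)%:E <= \esum_(e in [set: edge G]) (a e)%:E)%E.
Proof.
apply: esum_ge; exists [set` levelsE n]; first by split => //; exact: finite_seq.
by rewrite -fsbig_seq ?uniq_levelsE// sumEFin.
Qed.

(** Every finite set of edges lies within finitely many levels, so level sums control the unordered
    sum. *)
Lemma esum_le_psum c : (forall n, ((psum n)%:E <= c)%E) ->
  (\esum_(e in [set: edge G]) (a e)%:E <= c)%E.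
Proof.
move=> ac; apply: ge_ereal_sup => _ [X [fX _] <-].
have [n Xn] : exists n, X `<=` [set` levelsE n].
  exists (\max_(e <- fset_set X) (lev (up e)).+1) => e Xe /=; rewrite mem_levelsE.
  by apply: leq_bigmax_seq => //; rewrite in_fset_set// inE.
apply: le_trans (ac n); rewrite /psum -sumEFin [leRHS]fsbig_seq ?uniq_levelsE//.
apply: lee_fsum_nneg_subset => //.
- by move=> e; rewrite !inE; exact: Xn.
- by move=> e _; rewrite lee_fin.
Qed.

Lemma psum_tail (A : R) : \esum_(e in [set: edge G]) (a e)%:E = A%:E ->
  psum n @[n --> \oo] --> A.
Proof.
move=> aA; have le n : psum n <= A by rewrite -lee_fin -aA psum_le_esum.
apply/cvgrPdist_lt => e e0.
have [N AN] : exists N, A - e < psum N.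
  apply: contrapT => /forallNP h.
  have : (A%:E <= (A - e)%:E)%E.
    by rewrite -aA; apply: esum_le_psum => n; rewrite lee_fin leNgt; exact/negP/h.
  by rewrite lee_fin; lra.
exists N => // n /= Nn; rewrite ger0_norm ?subr_ge0//.
by have := psum_mono Nn; lra.
Qed.

End LevelSums.

(** At a leaf the default v makes the descent stationary, so that the iterates of [child] treat
    leaves and ends alike. *)
Definition child v : vertex G := if children v is e :: _ then lo e else v.

Lemma child_leaf v : children v = [::] -> child v = v.
Proof. by rewrite /child => ->. Qed.

Lemma iter_child_leaf v n : children v = [::] -> iter n child v = v.
Proof. by move=> cv; elim: n => //= n ->; exact: child_leaf. Qed.

Lemma child_par v : children v <> [::] -> exists2 e, up e = v & lo e = child v.
Proof.
rewrite /child; case cE: (children v) => [//|e s] _; exists e => //.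
by apply/eqP; rewrite -mem_children cE mem_head.
Qed.

Lemma child_ray v : (exists m, children (iter m child v) = [::]) \/
  descending_ray (fun j => iter j child v).
Proof.
have [?|/forallNP h] := pselect (exists m, children (iter m child v) = [::]); first by left.
by right=> j; have [e ej ej1] := child_par (h j); exists e.
Qed.

(** * Barta's principle, level by level *)

Section Barta.
Variables (f : gpoint G -> R) (g : edge G -> R -> R).
Local Notation mu := (@lebesgue_measure R).
Hypothesis fg : forall e, H1_derivative (len e) (on_edges f e) (g e).
Hypothesis fleaf : forall v, v <> r -> children v = [::] -> f (vpoint v) = 0.
Hypothesis fray : forall u, descending_ray u ->
  f (vpoint (u j)) @[j --> \oo] --> 0.
Let A e := \int[mu]_(t in `[0, len e]) (g e t ^+ 2).
Let B e := \int[mu]_(t in `[0, len e]) (on_edges f e t ^+ 2).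

Let A0 e : 0 <= A e.
Proof. by apply: Rintegral_ge0 => t _; exact: sqr_ge0. Qed.

Let B0 e : 0 <= B e.
Proof. by apply: Rintegral_ge0 => t _; exact: sqr_ge0. Qed.

Lemma edge_picone e k b : 0 <= k ->
  - (pi / 2) < k * depth (up e) + b -> k * depth (lo e) + b < pi / 2 ->
  k ^+ 2 * B e + (k * tan (k * depth (up e) + b) * f (vpoint (up e)) ^+ 2 -
     k * tan (k * depth (lo e) + b) * f (vpoint (lo e)) ^+ 2) <= A e.
Proof.
move=> k0 h1 h2.
have dl := depth_lo rt e; have le0 := len_gt0 e.
have H t : 0 <= t <= len e -> 0 <= k * t /\ k * t <= k * len e.
  by move=> /andP[t0 tl]; rewrite mulr_ge0// ler_wpM2l.
have e0 : on_edges f e 0 = f (vpoint (src e)) by rewrite /on_edges edge_point_src.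
have e1 : on_edges f e (len e) = f (vpoint (tgt e)) by rewrite /on_edges edge_point_tgt.
move: h1 h2; rewrite dl; case oE: (orient rt e) => h1 h2.
- have := @picone_tan _ _ _ _ le0 (fg e) k (k * depth (up e) + b).
  have -> : k * len e + (k * depth (up e) + b) = k * (depth (up e) + len e) + b by ring.
  have uE : src e = up e by rewrite /up /hsrc oE.
  have lE : tgt e = lo e by rewrite /lo /htgt oE.
  rewrite e0 e1 uE lE; apply => t /H[t1 t2].
  by rewrite mulrDr in h2; apply/andP; split; lra.
(* This edge is parametrised towards the root, so the frequency is [- k] and the initial phase is
   that of the lower vertex. *)
- have := @picone_tan _ _ _ _ le0 (fg e) (- k) (k * (depth (up e) + len e) + b).
  have -> : - k * len e + (k * (depth (up e) + len e) + b) = k * depth (up e) + b by ring.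
  have uE : tgt e = up e by rewrite /up /hsrc oE.
  have lE : src e = lo e by rewrite /lo /htgt oE.
  rewrite e0 e1 uE lE sqrrN => P; apply: le_trans (P _).
    by rewrite -/(B e); lra.
  by move=> t /H[t1 t2]; rewrite mulrDr in h2 *; apply/andP; split; lra.
Qed.

Fixpoint energy_below m v : R :=
  if m is m'.+1 then \sum_(e <- children v) (A e + energy_below m' (lo e)) else 0.

Let energy_below_ge0 m v : 0 <= energy_below m v.
Proof.
by elim: m v => //= m IH v; rewrite sumr_ge0// => e _; rewrite addr_ge0.
Qed.

Lemma sum_energy_below m n :
  \sum_(v <- levelV n) energy_below m v = psum A (n + m) - psum A n.
Proof.
elim: m n => [|m IH] n; first by rewrite addn0 subrr big1.
rewrite -sum_levelE big_split /= -sum_levelVS IH psumS addnS addSn.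
ring.
Qed.

Lemma child_limit v : v <> r -> f (vpoint (iter m child v)) @[m --> \oo] --> 0.
Proof.
move=> vr; have [[m mv]|/fray//] := child_ray v.
apply: cvg_near_cst; exists m => // n /= /subnK<-; rewrite iterD iter_child_leaf//.
apply: fleaf => //; elim: m {mv n} => //= m IH.
by rewrite /child; case: children => // e s; exact: lo_neq_root.
Qed.

Section Tail.
Variables (k b s : R).
Hypotheses (k0 : 0 < k) (b0 : 0 < b) (kb : k * s + b < pi / 2).
Hypothesis depthS : forall v, depth v <= s.
Let c v := k * tan (k * depth v + b).

Let phase v : b <= k * depth v + b < pi / 2.
Proof.
rewrite lerDr mulr_ge0 ?depth_ge0 ?(ltW k0)//=.
by apply: le_lt_trans kb; rewrite lerD2r ler_wpM2l ?(ltW k0).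
Qed.

Let b_gt : - (pi / 2) < b.
Proof. by rewrite (lt_trans _ b0)// oppr_lt0 divr_gt0// pi_gt0. Qed.

Let c_bounds v : k * tan b <= c v <= k * tan (k * s + b).
Proof.
have /andP[h1 h2] := phase v.
have SS : k * depth v + b <= k * s + b by rewrite lerD2r ler_wpM2l ?(ltW k0).
by rewrite /c !ler_wpM2l ?(ltW k0)// le_tan// (lt_le_trans b_gt).
Qed.

(* Picone's inequality along the path of first children. *)
Lemma ray_energy m v : v <> r ->
  c v * f (vpoint v) ^+ 2 <= energy_below m v +
    c (iter m child v) * f (vpoint (iter m child v)) ^+ 2.
Proof.
elim: m v => [|m IH] v vr; first by rewrite add0r.
case cE: (children v) => [|e s0].
  rewrite iter_child_leaf// (fleaf vr cE) expr0n /= mulr0.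
  by rewrite cE big_nil addr0.
have ev : up e = v by apply/eqP; rewrite -mem_children cE mem_head.
have -> : iter m.+1 child v = iter m child (lo e) by rewrite iterSr /child cE.
rewrite [energy_below _ _]/= cE big_cons.
have E0 : 0 <= \sum_(j <- s0) (A j + energy_below m (lo j)).
  by rewrite sumr_ge0// => j _; rewrite addr_ge0.
have := IH (lo e) (@lo_neq_root e).
have /andP[h1 h2] := phase (lo e); have /andP[h3 h4] := phase (up e).
have := @edge_picone e k b (ltW k0) (lt_le_trans b_gt h3) h2.
rewrite ev -/(c v) -/(c (lo e)).
have : 0 <= k ^+ 2 * B e by rewrite mulr_ge0// sqr_ge0.
lra.
Qed.

(** The descents from distinct vertices of level n run in disjoint subtrees, so their energies add
    up to at most the tail of the energy. The positive phase b keeps every weight [c v] at least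
    [k * tan b], and the far boundary terms [h m] form a finite sum of sequences tending to 0. *)
Lemma level_sq_sum_le n (E : R) : (forall m, psum A m <= E) -> (0 < n)%N ->
  k * tan b * \sum_(v <- levelV n) f (vpoint v) ^+ 2 <= E - psum A n.
Proof.
move=> AE n0.
pose h m := \sum_(v <- levelV n) c (iter m child v) * f (vpoint (iter m child v)) ^+ 2.
have vr v : v \in levelV n -> v <> r.
  by move=> vn vr; move: n0; rewrite -(eqP (etrans (esym (mem_levelV n v)) vn)) vr level_root.
have H m : k * tan b * \sum_(v <- levelV n) f (vpoint v) ^+ 2 <= E - psum A n + h m.
  apply: (@le_trans _ _ (psum A (n + m) - psum A n + h m)); last first.
    by rewrite lerD2r lerD2r.
  rewrite -sum_energy_below /h -big_split/= mulr_sumr big_seq [leRHS]big_seq.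
  apply: ler_sum => v vn; apply: le_trans (ray_energy m (vr v vn)).
  by rewrite ler_wpM2r ?sqr_ge0//; case/andP: (c_bounds v).
have hc : h m @[m --> \oo] --> 0.
  have H2 (s0 : seq (vertex G)) : {subset s0 <= levelV n} ->
      \sum_(v <- s0) c (iter m child v) * f (vpoint (iter m child v)) ^+ 2
      @[m --> \oo] --> 0.
    elim: s0 => [|v s0 IH] sn.
      by under eq_fun do rewrite big_nil; exact: cvg_cst.
    under eq_fun do rewrite big_cons.
    have Is0 : {subset s0 <= levelV n} by move=> w ws; apply: sn; rewrite inE ws orbT.
    have fl := child_limit (vr v (sn v (mem_head _ _))).
    pose C := k * tan (k * s + b).
    have fl2 : C * (f (vpoint (iter m child v)) * f (vpoint (iter m child v)))
        @[m --> \oo] --> 0.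
      have cC : (fun _ : nat => C) @ \oo --> C by exact: cvg_cst.
      by have := cvgM cC (cvgM fl fl); rewrite !mulr0; exact.
    have fl3 : c (iter m child v) * f (vpoint (iter m child v)) ^+ 2 @[m --> \oo] --> 0; last first.
      by have := cvgD fl3 (IH Is0); rewrite addr0; exact.
    apply: (squeeze_cvgr _ (cvg_cst 0) fl2); near=> m.
    have /andP[c1 c2] := c_bounds (iter m child v).
    rewrite -expr2 ler_wpM2r ?sqr_ge0// andbT mulr_ge0 ?sqr_ge0//.
    apply: le_trans c1; rewrite mulr_ge0 ?(ltW k0)//.
    apply: tan_ge0 (ltW b0) _.
    by have := phase r; rewrite (depth_root rt) mulr0 add0r => /andP[].
  exact: H2.
exact: le_of_vanishing_error H hc.
Unshelve. all: by end_near. Qed.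

End Tail.

Lemma level_sq_sum_cvg (s E : R) : (forall v, depth v <= s) ->
  \esum_(e in [set: edge G]) (A e)%:E = E%:E ->
  \sum_(v <- levelV n) f (vpoint v) ^+ 2 @[n --> \oo] --> 0.
Proof.
move=> ds AE.
have s0 : 0 <= s by apply: le_trans (depth_ge0 r) (ds r).
(* Constants for the tail estimate alone: [k * s <= b] gives [k * s + b <= pi / 4], and [s + 1] is
   positive even if s = 0. *)
pose b : R := pi / 8; pose k := b / (s + 1).
have b0 : 0 < b by rewrite divr_gt0// pi_gt0.
have s10 : 0 < s + 1 by rewrite ltr_wpDl.
have k0 : 0 < k by rewrite divr_gt0.
have ks : k * s <= b.
  by rewrite /k mulrAC ler_pdivrMr// ler_wpM2l ?(ltW b0)// lerDl.
have b2 : pi / 2 = b + b + b + b by rewrite /b; field.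
have kb : k * s + b < pi / 2 by rewrite b2; lra.
have c0 : 0 < k * tan b by rewrite mulr_gt0// tan_gt0// b2; lra.
have En m : psum A m <= E by rewrite -lee_fin -AE psum_le_esum.
have dec : (E - psum A n) / (k * tan b) @[n --> \oo] --> 0.
  have h1 : (fun=> E) @ \oo --> E by exact: cvg_cst.
  have h2 : (fun=> (k * tan b)^-1) @ \oo --> (k * tan b)^-1 by exact: cvg_cst.
  by have := cvgM (cvgB h1 (psum_tail A0 AE)) h2; rewrite subrr mul0r; exact.
have z : (fun=> 0 : R) @ \oo --> (0 : R) by exact: cvg_cst.
apply: (squeeze_cvgr _ z dec); near=> n.
rewrite sumr_ge0/= => [|v _]; last exact: sqr_ge0.
rewrite ler_pdivlMr// mulrC; apply: (level_sq_sum_le k0 b0 kb) => //.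
by near: n; exists 1%N.
Unshelve. all: by end_near. Qed.

(* [al (lo e)] is the phase on the edge [e]; the supersolution on it is
   cos (k d + al (lo e)), up to a positive factor making it continuous. *)
Section Supersolution.
Variables (k M s E : R) (al : vertex G -> R).
Hypotheses (k0 : 0 <= k) (Mpi : M < pi / 2).
Hypothesis depthS : forall v, depth v <= s.
Hypothesis AE : \esum_(e in [set: edge G]) (A e)%:E = E%:E.
Hypothesis phase_up : forall e, - M <= k * depth (up e) + al (lo e).
Hypothesis phase_lo : forall e, k * depth (lo e) + al (lo e) <= M.
Hypothesis super_root :
  0 <= \sum_(e <- children r) tan (k * depth r + al (lo e)).
Hypothesis super : forall v, v <> r -> children v <> [::] ->
  tan (k * depth v + al v) <= \sum_(e <- children v) tan (k * depth v + al (lo e)).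

Let flux_in n := \sum_(v <- levelV n) k * tan (k * depth v + al v) * f (vpoint v) ^+ 2.
Let flux_out n := \sum_(v <- levelV n)
  \sum_(e <- children v) k * tan (k * depth v + al (lo e)) * f (vpoint v) ^+ 2.

Let level_neq_root n v : v \in levelV n.+1 -> v <> r.
Proof. by rewrite mem_levelV => + vr; rewrite vr level_root. Qed.

Let flux_outE v : \sum_(e <- children v) k * tan (k * depth v + al (lo e)) * f (vpoint v) ^+ 2 =
  k * (\sum_(e <- children v) tan (k * depth v + al (lo e))) * f (vpoint v) ^+ 2.
Proof. by rewrite -mulr_suml -mulr_sumr. Qed.

Let flux_level n : k ^+ 2 * \sum_(e <- levelE n) B e + flux_out n <=
  \sum_(e <- levelE n) A e + flux_in n.+1.
Proof.
have -> : flux_out n = \sum_(e <- levelE n)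
    k * tan (k * depth (up e) + al (lo e)) * f (vpoint (up e)) ^+ 2.
  rewrite sum_levelE; apply: eq_bigr => v _; rewrite big_seq [RHS]big_seq.
  by apply: eq_bigr => e; rewrite mem_children => /eqP->.
rewrite /flux_in sum_levelVS mulr_sumr -!big_split/=; apply: ler_sum => e _.
have dl := depth_lo rt e; have le0 := len_gt0 e.
have up1 : - (pi / 2) < k * depth (up e) + al (lo e).
  by apply: lt_le_trans (phase_up e); rewrite ltrN2.
have := edge_picone k0 up1 (le_lt_trans (phase_lo e) Mpi).
lra.
Qed.

(** The vertex condition [super] enters here; at a leaf the flux vanishes with f. *)
Let flux_vertex n : flux_in n.+1 <= flux_out n.+1.
Proof.
rewrite /flux_in /flux_out big_seq [leRHS]big_seq; apply: ler_sum => v /level_neq_root vr.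
rewrite flux_outE; case cE: (children v) => [|e c].
  by rewrite (fleaf vr cE) expr0n/= !mulr0.
by rewrite ler_wpM2r ?sqr_ge0// ler_wpM2l// -cE super// cE.
Qed.

(** [M < pi / 2] bounds all the tangents by one constant, which reduces the boundary flux to the
    level sum of f^2. *)
Let flux_in_le n : flux_in n.+1 <= k * tan M * \sum_(v <- levelV n.+1) f (vpoint v) ^+ 2.
Proof.
rewrite /flux_in mulr_sumr big_seq [leRHS]big_seq; apply: ler_sum => v /level_neq_root.
move=> /(lo_surj rt)[e <-]; rewrite ler_wpM2r ?sqr_ge0// ler_wpM2l// le_tan//.
apply: lt_le_trans (_ : - M <= _); first by rewrite ltrN2.
apply: le_trans (phase_up e) _; rewrite lerD2r ler_wpM2l//.
exact: ltW (depth_up_lt e).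
Qed.

Let partial n : k ^+ 2 * psum B n.+1 <= psum A n.+1 + flux_in n.+1.
Proof.
elim: n => [|n IH].
  have z a : psum a 0 = 0 by rewrite /psum big_nil.
  rewrite (psumS B) (psumS A) !z !add0r; apply: le_trans (flux_level 0).
  (* The root has no incoming flux, and [super_root] makes its outgoing flux nonnegative. *)
  rewrite lerDl /flux_out big_seq1 flux_outE.
  by rewrite mulr_ge0 ?sqr_ge0// mulr_ge0.
rewrite psumS (psumS A) mulrDr.
have := flux_level n.+1; have := flux_vertex n; lra.
Qed.

Lemma supersolution_psum n : k ^+ 2 * psum B n <= E.
Proof.
have En m : psum A m <= E by rewrite -lee_fin -AE psum_le_esum.
have W := level_sq_sum_cvg depthS AE.
(* n stays fixed while the level [(n + m).+1] of the boundary term goes to infinity. *)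
apply: (@le_of_vanishing_error _ _ _ (fun m => k * tan M *
    \sum_(v <- levelV (n + m).+1) f (vpoint v) ^+ 2)) => [m|].
  have h1 : k ^+ 2 * psum B n <= k ^+ 2 * psum B (n + m).+1.
    by rewrite ler_wpM2l ?sqr_ge0// psum_mono// leqW// leq_addr.
  have := partial (n + m); have := flux_in_le (n + m); have := En (n + m).+1.
  lra.
have cC : (fun _ : nat => k * tan M) @ \oo --> k * tan M by exact: cvg_cst.
have W2 : \sum_(v <- levelV (n + m).+1) f (vpoint v) ^+ 2 @[m --> \oo] --> 0.
  have := W; rewrite -(cvg_shiftn n.+1); apply: cvg_trans; apply: near_eq_cvg.
  by apply: nearW => m; rewrite /= addnS addnC.
by have := cvgM cC W2; rewrite mulr0; exact.
Qed.

End Supersolution.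

Lemma sqint_derivative : sqint g = \esum_(e in [set: edge G]) (A e)%:E.
Proof. by apply: eq_esum => e _; rewrite sq_integralE//; exact: sq_integrable. Qed.

Lemma sqint_on_edges : sqint (on_edges f) = \esum_(e in [set: edge G]) (B e)%:E.
Proof.
apply: eq_esum => e _; rewrite sq_integralE//.
exact: H1_sq_integrable (len_gt0 e) (fg e).
Qed.

Lemma rayleigh_ge c : children r <> [::] -> (exists x, f x <> 0) ->
  (sqint (on_edges f) + sqint g < +oo)%E ->
  (forall E, \esum_(e in [set: edge G]) (A e)%:E = E%:E -> forall n, c * psum B n <= E) ->
  c <= fine (sqint g) / fine (sqint (on_edges f)).
Proof.
move=> cr [x /eqP fx] fin cE.
have ge0 (a : edge G -> R) : (forall e, 0 <= a e) ->
    (0 <= \esum_(e in [set: edge G]) (a e)%:E)%E.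
  by move=> a0; apply: esum_ge0 => e _; rewrite lee_fin.
have gB := ge0 B B0; have gA := ge0 A A0.
rewrite sqint_derivative sqint_on_edges in fin *.
have fA : \esum_(e in [set: edge G]) (A e)%:E \is a fin_num.
  by rewrite ge0_fin_numE//; apply: le_lt_trans fin; rewrite leeDr.
have fB : \esum_(e in [set: edge G]) (B e)%:E \is a fin_num.
  by rewrite ge0_fin_numE//; apply: le_lt_trans fin; rewrite leeDl.
set EA := fine (\esum_(e in _) (A e)%:E); set EB := fine _.
have EAE : \esum_(e in [set: edge G]) (A e)%:E = EA%:E by rewrite fineK.
have EBE : \esum_(e in [set: edge G]) (B e)%:E = EB%:E by rewrite fineK.
(* A point where f is nonzero lies on an edge, the root included because it has a child; continuity
   along the edge makes the integral of f^2 positive. *)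
have EB0 : 0 < EB.
  have [e [t [te fe]]] : exists e t, 0 <= t <= len e /\ on_edges f e t != 0.
    have H e a : 0 <= a <= len e -> x = ep e a ->
        exists e t, 0 <= t <= len e /\ on_edges f e t != 0.
      move=> ae xE; exists e, (if orient rt e then a else len e - a); split.
        by case: (orient rt e); lra.
      by rewrite /on_edges -/(ep e a) -xE.
    have [xr|[e [a [ae xE]]]] := gpointP x; last by apply: (H e a) => //; lra.
    case cE' : (children r) => [//|e s].
    apply: (H e 0); first by rewrite lexx ltW// len_gt0.
    by rewrite ep0 xr; congr vpoint; apply/esym/eqP; rewrite -mem_children cE' mem_head.
  have Be := H1_sq_integral_gt0 (len_gt0 e) (fg e) te fe.
  apply: lt_le_trans Be _; rewrite -lee_fin -EBE.
  apply: esum_ge; exists [set e]; first by split.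
  by rewrite fsbig_set1.
rewrite ler_pdivlMr//.
apply: (@le_of_vanishing_error _ _ _ (fun n => c * EB - c * psum B n)) => [n|].
  by have := cE EA EAE n; lra.
have c1 : (fun _ : nat => c) @ \oo --> c by exact: cvg_cst.
have c2 : (fun _ : nat => c * EB) @ \oo --> c * EB by exact: cvg_cst.
by have := cvgB c2 (cvgM c1 (psum_tail B0 EBE)); rewrite subrr; exact.
Qed.

End Barta.

Lemma H10_leaf f g v : H10_with (dirichlet_set r) f g ->
  v <> r -> children v = [::] -> f (vpoint v) = 0.
Proof. by move=> [_ fD] vr cv; apply: (fD (inl v)); split=> //; exact/leafP. Qed.

(** [u n.+1] lies in [cut u n], so the vertices of the ray are an admissible sequence for the value
    at its end. *)
Lemma H10_ray f g u : H10_with (dirichlet_set r) f g -> descending_ray u ->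
  f (vpoint (u j)) @[j --> \oo] --> 0.
Proof.
move=> [_ fD] ur; have := fD (inr (ray_end u)) (ends_ray_end ur).
move=> /(_ (cut u) (fun n => vpoint (u n.+1)) (ray_end_cut ur)) H.
by rewrite -cvg_shiftS; apply: H => n; exact: anc_refl.
Qed.

(** Barta's principle in Riccati form: dividing the Kirchhoff inequality at a vertex by the positive
    value of the supersolution leaves a comparison of tangents, so the phases can be chosen edge by
    edge. *)
Lemma supersolution_lambda1 (k M s : R) (al : vertex G -> R) :
  0 <= k -> M < pi / 2 -> (forall v, depth v <= s) -> children r <> [::] ->
  (forall e, - M <= k * depth (up e) + al (lo e)) ->
  (forall e, k * depth (lo e) + al (lo e) <= M) ->
  0 <= \sum_(e <- children r) tan (al (lo e)) ->
  (forall v, v <> r -> children v <> [::] ->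
    tan (k * depth v + al v) <= \sum_(e <- children v) tan (k * depth v + al (lo e))) ->
  ((k ^+ 2)%:E <= lambda1 (dirichlet_set r))%E.
Proof.
move=> k0 Mpi ds cr hup hlo hr hv.
apply: le_ereal_inf_tmp => _ [f [g [fg fx ->]]]; rewrite lee_fin.
have [[_ fe fin] _] := fg.
apply: rayleigh_ge => // E EA n.
have fl v := @H10_leaf f g v fg; have fr u := @H10_ray f g u fg.
apply: (supersolution_psum fe fl fr k0 Mpi ds EA hup hlo _ hv).
by rewrite (depth_root rt) mulr0; under eq_bigr do rewrite add0r.
Qed.

Lemma anc_child v w : anc v w -> v <> w -> exists2 e, up e = v & anc (lo e) w.
Proof.
have [n] := ubnP (lev w); elim: n w => // n IH w wn vw vNw.
have [wr|/(lo_surj rt)[e we]] := pselect (w = r).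
  by case: vNw; apply: anc_anti => //; rewrite wr; exact: anc_root.
have : anc v (up e) by move: vw; rewrite -we => /anc_lo[ve|//]; case: vNw; rewrite ve.
have [ve _|vNu vu] := pselect (v = up e); first by exists e; rewrite // we; exact: anc_refl.
have [|e' e'v e'u] := IH (up e) _ vu vNu; first by move: wn; rewrite -we level_lo.
by exists e' => //; rewrite -we; apply: anc_trans e'u (anc_up e).
Qed.

Lemma children_neq0 v e : up e = v -> children v <> [::].
Proof. by move=> /eqP; rewrite -mem_children => + c0; rewrite c0. Qed.

Lemma anc_iter_child m v : anc v (iter m child v).
Proof.
elim: m => [|m IH]; first exact: anc_refl.
apply: anc_trans IH _; rewrite iterS; move: (iter m child v) => w.
have [cw|/child_par[e <- <-]] := pselect (children w = [::]); last exact: anc_up.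
by rewrite child_leaf//; exact: anc_refl.
Qed.

Lemma ends_nonempty (c : set (nat -> set (gpoint G))) : ends c -> exists2 U, end_seq U & c U.
Proof.
move=> [U eU ->]; exists U => //; split=> // n; by exists n, n; split=> x.
Qed.

Lemma dist_end_ge0 x (c : set (nat -> set (gpoint G))) : ends c -> (0 <= dist_end x c)%E.
Proof.
move=> /ends_nonempty[U _ cU]; apply: le_ereal_inf_tmp => l [f [_ _ /(_ U 0%N cU)[t [t0 tl _]]]].
by apply: le_trans (ltW tl); rewrite lee_fin.
Qed.

(** * The centre, the inradius and the spectral bound *)

Section Centre.
Hypothesis Gcentre : centre_vertex r.
Hypothesis Gfin : (inradius (dirichlet_set r) < +oo)%E.
Local Notation D := (dirichlet_set r).

(** The infimum over an empty set is +oo, which a finite inradius excludes. *)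
Lemma dirichlet_set_neq0 : exists b, D b.
Proof.
apply: contrapT => /forallNP D0.
suff : inradius D = +oo%E by move=> i; move: Gfin; rewrite i ltxx.
apply/eqP; rewrite -leye_eq; apply: ereal_sup_ubound; exists (vpoint r) => //.
rewrite (_ : [set _ | _ in _] = set0) ?ereal_inf0//.
by apply/seteqP; split=> // t [b Db _]; case: (D0 b).
Qed.

Lemma centre_inf b : D b -> ereal_inf [set bdist (vpoint r) b | b in D] = bdist (vpoint r) b.
Proof.
move=> Db; apply/le_anti; rewrite ereal_inf_lbound/=; last by exists b.
by apply: le_ereal_inf_tmp => _ [b' Db' <-]; rewrite (Gcentre Db Db').
Qed.

Lemma centre_dist_exists : exists L : R, forall b, D b -> bdist (vpoint r) b = L%:E.
Proof.
have [b Db] := dirichlet_set_neq0; exists (fine (bdist (vpoint r) b)) => b' Db'.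
rewrite (Gcentre Db' Db) fineK// ge0_fin_numE.
  apply: le_lt_trans Gfin; rewrite -(centre_inf Db); apply: ereal_sup_ubound.
  by exists (vpoint r).
case: b Db => [v|c] /= Dc; last exact: dist_end_ge0.
by rewrite dist_root lee_fin dep_ge0.
Qed.

Definition radius : R := projT1 (cid centre_dist_exists).
Local Notation L := radius.

Lemma centre_dist b : D b -> bdist (vpoint r) b = L%:E.
Proof. by rewrite /radius; case: cid => /= l; apply. Qed.

Lemma depth_leaf v : v <> r -> children v = [::] -> depth v = L.
Proof.
move=> vr cv; have /centre_dist : D (inl v) by split=> //; exact/leafP.
by rewrite /= dist_root => -[].
Qed.

Lemma depth_ray u j : descending_ray u -> depth (u j) < L.
Proof.
move=> ur; have uL i : depth (u i) <= L.
  rewrite -lee_fin -(centre_dist (b := inr (ray_end u)) (ends_ray_end ur)).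
  exact: dist_end_root_ge.
exact: lt_le_trans (ray_depth_lt ur j) (uL j.+1).
Qed.

(** By [dist_end_le] the distance L to the end is at most the supremum of the depths along u. *)
Lemma depth_ray_sup u s : descending_ray u -> s < L -> exists j, s < depth (u j).
Proof.
move=> ur sL; pose S := sup (range (fun j => depth (u j))).
have hS : has_sup (range (fun j => depth (u j))).
  by split; [exists (depth (u 0%N)), 0%N|exists L => _ [j _ <-]; exact/ltW/depth_ray].
have uS j : depth (u j) < S.
  by apply: lt_le_trans (ray_depth_lt ur j) _; apply: ub_le_sup; [exact: hS.2|exists j.+1].
have Su t : t < S -> exists j, t < depth (u j).
  by move=> /(sup_gt hS.1)[_ [j _ <-]]; exists j.
apply: (Su); apply: lt_le_trans sL _; rewrite -lee_fin.
rewrite -(centre_dist (b := inr (ray_end u)) (ends_ray_end ur)).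
have := dist_end_le ur (S := S) (x := vpoint r) uS Su.
rewrite /= depth_root subr0; apply; exists 0%N; exact: anc_root.
Qed.

Lemma children_root : children r <> [::].
Proof.
have H v : v <> r -> children r <> [::].
  move=> vr; have [|e er _] := @anc_child r v (anc_root v); first by move=> rv; apply: vr.
  exact: children_neq0 er.
have [[v [_ vr]|c /ends_nonempty[U eU _]]] := dirichlet_set_neq0; first exact: (H v).
have [n nU] := end_seq_avoids_level 0 eU.
have [Un _ _] := eU; have [[x Ux] _ _ _] := Un n.
apply: (H (bot x)) => xr; have := nU n x (leqnn n) Ux.
by rewrite xr level_root.
Qed.

(** Descending from v by first children leads to a leaf at depth L or along a ray whose depths stay
    below L. *)
Lemma depth_le_radius v : depth v <= L.
Proof.
have [[m mv]|/depth_ray/ltW h] := child_ray v; last exact: (h 0%N).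
apply: le_trans (anc_depth (anc_iter_child m v)) _.
have [vr|vr] := pselect (iter m child v = r); first by case: children_root; rewrite -vr.
by rewrite depth_leaf.
Qed.

Lemma radius_gt0 : 0 < L.
Proof.
case cr : (children r) => [|e c]; first by case: children_root.
by apply: lt_le_trans (depth_le_radius (lo e)); rewrite depth_lo ltr_wpDl ?depth_ge0 ?len_gt0.
Qed.

Lemma dirichlet_below x : exists2 b, D b & (bdist x b <= (L - dep x)%:E)%E.
Proof.
have [[m mv]|ur] := child_ray (bot x).
  have vr : iter m child (bot x) <> r by move=> vr; case: children_root; rewrite -vr.
  exists (inl (iter m child (bot x))); first by split=> //; exact/leafP.
  have ax := anc_iter_child m (bot x).
  rewrite /= dist_anc//=; last exact: le_trans (dep_bot x) (anc_depth ax).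
  by rewrite depth_leaf.
exists (inr (ray_end (fun j => iter j child (bot x)))); first exact: ends_ray_end.
apply: dist_end_le => //.
- by move=> j; exact: (depth_ray j ur).
- by move=> s; exact: depth_ray_sup ur.
- by exists 0%N; exact: anc_refl.
Qed.

(** The supremum is attained at the centre: from x, descending a further [L - dep x] reaches a point
    of the Dirichlet set. *)
Lemma inradiusE : inradius D = L%:E.
Proof.
apply/le_anti/andP; split.
  apply: ge_ereal_sup => _ [x _ <-]; have [b Db bx] := dirichlet_below x.
  apply: le_trans (ereal_inf_lbound _) _; first by exists b.
  by apply: le_trans bx _; rewrite lee_fin gerBl dep_ge0.
have [b Db] := dirichlet_set_neq0.
by apply: ereal_sup_ubound; exists (vpoint r) => //; rewrite (centre_inf Db) centre_dist.
Qed.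

Let omega : R := pi / (2 * L).

Let omega_gt0 : 0 < omega.
Proof. by rewrite divr_gt0 ?pi_gt0// mulr_gt0// radius_gt0. Qed.

Let omegaL : omega * L = pi / 2.
Proof. by rewrite /omega; field; rewrite gt_eqF// radius_gt0. Qed.

Lemma sum_children_ge v (F : edge G -> R) e : up e = v ->
  (forall e', e' \in children v -> 0 <= F e') -> F e <= \sum_(e' <- children v) F e'.
Proof.
move=> /eqP; rewrite -mem_children => ev F0.
rewrite (bigD1_seq e) ?uniq_children//= lerDl big_seq_cond sumr_ge0// => e' /andP[ec _].
exact: F0.
Qed.

Lemma lambda1_ge : ((omega ^+ 2)%:E <= lambda1 D)%E.
Proof.
(* For k strictly below omega all phases are at most [k * L < pi / 2], where the tangent is bounded;
   omega itself is reached by approximation. *)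
have base k : 0 < k -> k < omega -> ((k ^+ 2)%:E <= lambda1 D)%E.
  move=> k0 ko.
  have kd v : 0 <= k * depth v <= k * L.
    by rewrite mulr_ge0 ?depth_ge0 ?(ltW k0)//= ler_wpM2l ?(ltW k0)// depth_le_radius.
  have kL : k * L < pi / 2 by rewrite -omegaL ltr_pM2r// radius_gt0.
  have kL0 : 0 <= k * L by case/andP: (kd r) => /le_trans; apply.
  apply: (@supersolution_lambda1 k (k * L) L (fun=> 0)) => //.
  - exact: ltW.
  - exact: depth_le_radius.
  - exact: children_root.
  - move=> e; rewrite addr0; have /andP[h _] := kd (up e).
    by apply: le_trans h; rewrite oppr_le0.
  - by move=> e; rewrite addr0; case/andP: (kd (lo e)).
  - by rewrite sumr_ge0// => e _; rewrite tan0.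
  - move=> v vr /child_par[e ev _]; apply: (sum_children_ge ev) => e' _.
    rewrite addr0; have /andP[h1 h2] := kd v.
    by apply: tan_ge0 => //; exact: le_lt_trans kL.
have l0 : (0 <= lambda1 D)%E.
  have h0 : 0 < omega / 2 by rewrite divr_gt0.
  apply: le_trans (base (omega / 2) h0 _); first by rewrite lee_fin sqr_ge0.
  by rewrite ltr_pdivrMr// ltr_pMr ?ltr1n.
rewrite leNgt; apply/negP; case lE : (lambda1 D) l0 => [a||//].
  rewrite lee_fin lte_fin => a0 ao.
  have so : Num.sqrt a < omega.
    by rewrite -(@ltr_pXn2r _ 2) ?nnegrE ?sqrtr_ge0 ?(ltW omega_gt0)// sqr_sqrtr.
  (* If [lambda1 D] were a < omega^2, this k between sqrt a and omega would contradict [base]. *)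
  pose k := (Num.sqrt a + omega) / 2.
  have ks : Num.sqrt a < k by rewrite /k midf_lt.
  have ko : k < omega by rewrite /k midf_lt.
  have k0 : 0 < k by apply: le_lt_trans ks; exact: sqrtr_ge0.
  have := base k k0 ko; rewrite lE lee_fin leNgt => /negP; apply.
  by rewrite -[ltLHS](sqr_sqrtr a0) ltr_pXn2r ?nnegrE ?sqrtr_ge0 ?(ltW k0).
by move=> _; rewrite ltNge leey.
Qed.

(* The phase is raised by [th] on the path from the root to [v0], where the two
   branches overcompensate the rise, and lowered by [t], with [t] much smaller
   than [th], on all the other edges. *)
Lemma branching_gap v0 : v0 <> r -> (1 < size (children v0))%N ->
  ((omega ^+ 2)%:E < lambda1 D)%E.
Proof.
move=> v0r sv0.
have L0 := radius_gt0; have pi2 : 0 < pi / 2 :> R by rewrite divr_gt0 ?pi_gt0.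
set d0 := depth v0.
have d00 : 0 < d0 by apply: (@dep_gt0 (vpoint v0)) => -[].
have d0L : d0 < L.
  case cE : (children v0) sv0 => [//|e c] _.
  have ev : up e = v0 by apply/eqP; rewrite -mem_children cE mem_head.
  by apply: lt_le_trans (depth_le_radius (lo e)); rewrite /d0 -ev depth_up_lt.
have od0 : 0 < omega * d0 by rewrite mulr_gt0.
have od1 : omega * d0 < pi / 2 by rewrite -omegaL ltr_pM2l.
have t0 : 0 < tan (omega * d0) by exact: tan_gt0.
have tc : {for omega * d0, continuous (@tan R)}.
  by apply: tan_continuous; rewrite od1 andbT (lt_trans _ od0)// oppr_lt0.
(* The raised phase at v0 has to be balanced by two or more child edges with phase close to
   [omega * d0]; the strict factor 2 leaves room to perturb k and t afterwards. *)
have [th [th0 th1 th2]] : exists th : R, [/\ 0 < th, omega * d0 + th < pi / 2 &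
    tan (omega * d0 + th) < 2 * tan (omega * d0)].
  have c1 : omega * d0 + x @[x --> (0:R)^'+] --> omega * d0.
    apply: cvg_at_right_filter; rewrite -[X in _ --> X]addr0.
    by apply: cvgD; [exact: cvg_cst|exact: cvg_id].
  have c2 : tan (omega * d0 + x) @[x --> (0:R)^'+] --> tan (omega * d0).
    exact: cvg_comp c1 tc.
  near (0:R)^'+ => x; exists x; split; near: x.
  - exact: nbhs_right_gt.
  - exact: cvgr_lt c1 _ od1.
  - apply: cvgr_lt c2 _ _; rewrite mulr_natl mulr2n; lra.
have th3 : th < pi / 2 by apply: le_lt_trans th1; rewrite lerDr ltW.
have tth : 0 < tan th by exact: tan_gt0.
(* A positive lower bound for the depths of all non-root vertices, taken from the finitely many
   children of the root; it keeps lowered phases nonnegative at those vertices. *)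
have [dm [dm0 dmP]] : exists dm : R, 0 < dm /\ forall v, v <> r -> dm <= depth v.
  have [dm [dm0 dmP]] : exists dm : R, 0 < dm /\ forall e, e \in children r -> dm <= depth (lo e).
    elim: (children r) => [|e c [dm [dm0 dmP]]]; first by exists 1.
    exists (Num.min dm (depth (lo e))); split.
      by rewrite lt_min dm0 (@dep_gt0 (vpoint (lo e)))// => -[/lo_neq_root].
    by move=> e'; rewrite inE ge_min => /predU1P[->|/dmP->//]; rewrite lexx orbT.
  exists dm; split=> // v vr.
  have [e er ev] : exists2 e, up e = r & anc (lo e) v.
    by apply: anc_child; [exact: anc_root|exact/nesym].
  apply: le_trans (anc_depth ev); apply: dmP; rewrite mem_children; exact/eqP.
pose m := size (children r).
(* Chosen so that [kk t * L = pi / 2 + t / 2]: lowering by t brings the largest phase down to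
   [pi / 2 - t / 2]. *)
pose kk (t : R) := omega + t / (2 * L).
(* [m%:R * tan t < tan th] lets the raised edge at the root outweigh the lowered ones; [t <= pi / 4]
   puts the phase [- t] at the root above [- M]. *)
have [t [tpos tdm tpi k1 [k2 mt]]] : exists t : R, [/\ 0 < t, t <= omega * dm, t <= pi / 4,
    kk t * d0 + th < pi / 2 & tan (kk t * d0 + th) < 2 * tan (kk t * d0 - t) /\
    m%:R * tan t < tan th].
  have ct : t @[t --> (0:R)^'+] --> (0:R) by exact: cvg_at_right_filter.
  have ck : kk t * d0 @[t --> (0:R)^'+] --> omega * d0.
    have -> : omega * d0 = (omega + 0 / (2 * L)) * d0 by rewrite mul0r addr0.
    apply: cvgM; last exact: cvg_cst.
    apply: cvgD; first exact: cvg_cst.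
    by apply: cvgM => //; exact: cvg_cst.
  have c1 : kk t * d0 + th @[t --> (0:R)^'+] --> omega * d0 + th.
    by apply: cvgD => //; exact: cvg_cst.
  have c2 : tan (kk t * d0 + th) @[t --> (0:R)^'+] --> tan (omega * d0 + th).
    apply: cvg_comp c1 _; apply: tan_continuous; rewrite th1 andbT.
    by rewrite (@lt_trans _ _ 0) ?oppr_lt0// addr_gt0.
  have c3 : kk t * d0 - t @[t --> (0:R)^'+] --> omega * d0.
    by rewrite -[X in _ --> X]subr0; exact: cvgB.
  have c4 : 2 * tan (kk t * d0 - t) @[t --> (0:R)^'+] --> 2 * tan (omega * d0).
    by apply: cvgM; [exact: cvg_cst|exact: cvg_comp c3 tc].
  have c5 : tan (kk t * d0 + th) - 2 * tan (kk t * d0 - t) @[t --> (0:R)^'+] -->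
      tan (omega * d0 + th) - 2 * tan (omega * d0) by exact: cvgB.
  have c6 : m%:R * tan t @[t --> (0:R)^'+] --> (0:R).
    have ct0 : tan t @[t --> (0:R)^'+] --> tan (0:R).
      by apply: cvg_comp ct _; apply: tan_continuous; rewrite pi2 oppr_lt0 pi2.
    have cm : (fun _ : R => m%:R) @ (0:R)^'+ --> (m%:R : R) by exact: cvg_cst.
    by have := cvgM cm ct0; rewrite tan0 mulr0; exact.
  near (0:R)^'+ => x; exists x; split; [| | | |split].
  - by near: x; exact: nbhs_right_gt.
  - by near: x; apply: nbhs_right_le; rewrite mulr_gt0.
  - by near: x; apply: nbhs_right_le; rewrite divr_gt0// pi_gt0.
  - by near: x; exact: cvgr_lt c1 _ th1.
  - by rewrite -subr_lt0; near: x; apply: cvgr_lt c5 _ _; rewrite subr_lt0.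
  - by near: x; exact: cvgr_lt c6 _ tth.
set k := kk t in k1 k2.
have ok : omega < k by rewrite /k /kk ltrDl divr_gt0// mulr_gt0.
have k0 : 0 < k by apply: lt_trans ok.
have kL : k * L = pi / 2 + t / 2.
  by rewrite /k /kk mulrDl omegaL; congr (_ + _); field; rewrite gt_eqF.
pose al w := if `[< anc w v0 >] then th else - t.
have al_in w : anc w v0 -> al w = th by move=> wv; rewrite /al asboolT.
have al_out w : ~ anc w v0 -> al w = - t by move=> wv; rewrite /al asboolF.
have kd v : 0 <= k * depth v <= k * L.
  by rewrite mulr_ge0 ?depth_ge0 ?(ltW k0)//= ler_wpM2l ?(ltW k0)// depth_le_radius.
have kd0 v : anc v v0 -> k * depth v <= k * d0.
  by move=> /anc_depth h; rewrite ler_wpM2l ?(ltW k0).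
have kt v : v <> r -> t <= k * depth v.
  move=> /dmP h; apply: le_trans tdm _; apply: ler_pM => //; exact: ltW.
pose M := Num.max (k * d0 + th) (pi / 2 - t / 2).
have Mt : t <= M by rewrite le_max; apply/orP; right; lra.
have M2 : M < pi / 2 by rewrite gt_max k1 /= ltrBlDr ltrDl divr_gt0.
have phase_le w : k * depth w + al w <= M.
  have [wv|wv] := pselect (anc w v0).
    by rewrite al_in// le_max lerD2r kd0.
  rewrite al_out// le_max; apply/orP; right.
  by have /andP[_ h] := kd w; rewrite kL in h; lra.
have phase_ge0 v e : v <> r -> 0 <= k * depth v + al (lo e).
  move=> vr; have h := kt v vr; have [wv|wv] := pselect (anc (lo e) v0).
    by rewrite al_in// addr_ge0 ?(ltW th0)//; case/andP: (kd v).
  by rewrite al_out// subr_ge0.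
have phase_child v e : up e = v -> k * depth v + al (lo e) <= M.
  move=> ev; apply: le_trans (phase_le (lo e)).
  by rewrite lerD2r ler_wpM2l ?(ltW k0)// -ev ltW// depth_up_lt.
apply: lt_le_trans (_ : (k ^+ 2)%:E <= _)%E.
  by rewrite lte_fin ltr_pXn2r ?nnegrE ?(ltW k0) ?(ltW omega_gt0).
apply: (@supersolution_lambda1 k M L al) => //.
- exact: ltW.
- exact: depth_le_radius.
- exact: children_root.
- move=> e; have /andP[h1 _] := kd (up e).
  have [wv|wv] := pselect (anc (lo e) v0).
    by rewrite al_in//; lra.
  by rewrite al_out//; lra.
- have [e er ev] : exists2 e, up e = r & anc (lo e) v0.
    by apply: anc_child; [exact: anc_root|exact/nesym].
  have tt : 0 <= tan t by apply: tan_ge0; [exact: ltW|lra].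
  have ec : e \in children r by rewrite mem_children; exact/eqP.
  rewrite (bigD1_seq e) ?uniq_children//= al_in//.
  have : - (m%:R * tan t) <= \sum_(i <- children r | i != e) tan (al (lo i)).
    have -> : m%:R * tan t = \sum_(i <- children r) tan t.
      by rewrite big_const_seq count_predT iter_addr addr0 mulr_natl.
    rewrite (bigD1_seq e) ?uniq_children//= opprD.
    apply: (@le_trans _ _ (- \sum_(i <- children r | i != e) tan t)).
      by rewrite gerDr oppr_le0.
    rewrite -sumrN; apply: ler_sum => i _.
    have [wv|wv] := pselect (anc (lo i) v0).
      by rewrite al_in// (le_trans _ (ltW tth))// oppr_le0.
    by rewrite al_out// tanN.
  lra.
- move=> v vr cv; have ch0 e' : e' \in children v -> 0 <= tan (k * depth v + al (lo e')).
    rewrite mem_children => /eqP ev; apply: tan_ge0; first exact: phase_ge0.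
    exact: le_lt_trans (phase_child _ _ ev) M2.
  have [e ev _] := child_par cv.
  (* At v0 all child edges carry the lowered phase, and there are at least two of them. *)
  have [vv0|vNv0] := pselect (v = v0).
    have off e' : e' \in children v -> al (lo e') = - t.
      rewrite mem_children => /eqP e'v; apply: al_out.
      by rewrite -vv0 -e'v; exact: anc_up_lo.
    have -> : \sum_(e' <- children v) tan (k * depth v + al (lo e')) =
        (size (children v))%:R * tan (k * depth v - t).
      rewrite (eq_big_seq (fun=> tan (k * depth v - t))) => [|e' /off->//].
      by rewrite big_const_seq count_predT iter_addr addr0 mulr_natl.
    rewrite al_in ?vv0; last exact: anc_refl.
    apply: le_trans (ltW k2) _; rewrite ler_wpM2r ?ler_nat//.
    apply: tan_ge0; first by rewrite subr_ge0 kt.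
    by have := le_lt_trans (phase_child _ _ ev) M2; rewrite vv0 off// mem_children; exact/eqP.
  (* Above v0 the child edge towards v0 keeps the raised phase; off the path every child edge keeps
     the lowered one. One such edge suffices, as the other tangents are nonnegative. *)
  have [va|va] := pselect (anc v v0).
    have [e' e'v e'a] := anc_child va vNv0.
    rewrite al_in// -(al_in _ e'a); exact: (sum_children_ge e'v).
  have e'a : ~ anc (lo e) v0 by move=> h; apply: va; apply: anc_trans h; rewrite -ev; exact: anc_up.
  rewrite al_out// -(al_out _ e'a); exact: (sum_children_ge ev).
Unshelve. all: by end_near. Qed.

(** * Equality *)

Lemma dist_comparable x y : anc (bot x) (bot y) -> dist x y = `|dep x - dep y|%:E.
Proof.
move=> xy; have [dxy|dyx] := leP (dep x) (dep y).
  by rewrite dist_anc// distrC ger0_norm// subr_ge0.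
have [xyE|xpy] := anc_parE xy.
  by rewrite dist_sym dist_anc ?(ltW dyx) ?xyE ?ger0_norm ?subr_ge0 ?(ltW dyx).
have [yr|yr] := pselect (bot y = r).
  have /anc_anti xr : anc (bot x) r by rewrite -yr.
  rewrite dist_sym dist_anc ?(ltW dyx) ?ger0_norm ?subr_ge0 ?(ltW dyx)//.
  by rewrite yr; exact: anc_root.
exfalso; have := anc_depth xpy; have := depth_par_bot yr; have := dep_bot x; lra.
Qed.

Lemma dist_across e x y : up e = r -> branch (lo e) x -> ~ branch (lo e) y ->
  dist x y = (dep x + dep y)%:E.
Proof.
move=> er xe ye; apply/le_anti/andP; split.
  apply: reach_dist; apply: (reach_trans (y := vpoint r)).
    apply: reach_sym; have := @reach_anc (vpoint r) x (anc_root _).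
    by rewrite /= depth_root subr0; apply; exact: dep_ge0.
  have := @reach_anc (vpoint r) y (anc_root _).
  by rewrite /= depth_root subr0; apply; exact: dep_ge0.
(* The depth with a sign: [dep z] on the branch and [- dep z] off it, which is 1-Lipschitz because
   the branch is attached at depth 0. *)
pose H z := 2 * branch_height (lo e) z - dep z.
have pr : depth (par (lo e)) = 0 by rewrite par_lo er depth_root.
have lH : lipschitz H.
  apply: lipschitz_ep => e' a b ae be; rewrite /H !branch_height_ep ?dep_ep//;
    try exact: lo_neq_root.
  rewrite pr; case: ifP => _.
    by rewrite le_eqVlt; apply/orP; left; apply/eqP; congr `|_|; ring.
  by rewrite distrC le_eqVlt; apply/orP; left; apply/eqP; congr `|_|; ring.
apply: le_trans (lipschitz_dist lH x y).
rewrite lee_fin /H branch_height_in// branch_height_out// pr.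
by apply: le_trans (ler_norm _); lra.
Qed.

Lemma top_edge x : bot x <> r -> exists2 e, up e = r & branch (lo e) x.
Proof. by move=> xr; apply: anc_child; [exact: anc_root|exact/nesym]. Qed.

Lemma top_edge_unique e e' x : up e = r -> up e' = r -> branch (lo e) x ->
  branch (lo e') x -> e = e'.
Proof.
move=> er e'r xe xe'; apply: (@lo_inj _ _ _ rt).
have ll : lev (lo e) = lev (lo e') by rewrite !level_lo er e'r.
by have [/anc_level_eq->//|/anc_level_eq-> //] := anc_total xe xe'.
Qed.

Definition unbranched := forall e e', up e = up e' -> up e <> r -> e = e'.

Lemma unbranched_total w v v' : unbranched -> w <> r -> anc w v -> anc w v' ->
  anc v v' \/ anc v' v.
Proof.
move=> nb wr wv wv'; have [n] := ubnP (lev v); elim: n v wv => // n IH v wv vn.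
have [<-|wp] := anc_parE wv; first by left.
have [vr|/(lo_surj rt)[e ve]] := pselect (v = r); first by left; rewrite vr; exact: anc_root.
rewrite -ve par_lo in wp; have ur : up e <> r.
  by move=> ur; apply: wr; apply: anc_anti; [rewrite -ur|exact: anc_root].
have [|uv'|v'u] := IH (up e) wp; first by move: vn; rewrite -ve level_lo.
  have [uE|uN] := pselect (up e = v'); first by right; rewrite -uE -ve; exact: anc_up.
  have [e' e'u e'v'] := anc_child uv' uN.
  by left; rewrite -ve (nb e e')//.
by right; rewrite -ve; apply: anc_trans v'u (anc_up e).
Qed.

Lemma unbranched_dist w x y : unbranched -> w <> r -> branch w x -> branch w y ->
  dist x y = `|dep x - dep y|%:E.
Proof.
move=> nb wr wx wy; have [|] := unbranched_total nb wr wx wy; first exact: dist_comparable.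
by move=> yx; rewrite dist_sym dist_comparable// distrC.
Qed.

Lemma unbranched_children v : unbranched -> v <> r -> children v <> [::] ->
  exists2 e, children v = [:: e] & lo e = child v.
Proof.
move=> nb vr; rewrite /child; case cE: (children v) => [//|e s] _; exists e => //.
case: s cE => // e' s cE.
have ev : up e = v by apply/eqP; rewrite -mem_children cE mem_head.
have e'v : up e' = v by apply/eqP; rewrite -mem_children cE !inE eqxx orbT.
have := uniq_children v; rewrite cE (nb e e') ?ev//.
by rewrite /= inE eqxx.
Qed.

Lemma levelVS_neq_root n v : v \in levelV n.+1 -> v <> r.
Proof. by rewrite mem_levelV => + vr; rewrite vr level_root. Qed.

(** Every non-root vertex has at most one child, so iterating [child] carries level 1 onto level n +
    1, except for descents stopped at a leaf, where F is 0. *)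
Lemma sum_levelV_child (F : vertex G -> R) n : unbranched ->
  (forall v, v <> r -> children v = [::] -> F v = 0) ->
  \sum_(v <- levelV n.+1) F v = \sum_(v <- levelV 1) F (iter n child v).
Proof.
move=> nb; elim: n F => [//|n IH] F F0.
rewrite sum_levelVS sum_levelE.
transitivity (\sum_(v <- levelV n.+1) F (child v)).
  apply: eq_big_seq => v /levelVS_neq_root vr.
  have [cv|/(unbranched_children nb vr)[e cv <-]] := pselect (children v = [::]).
    by rewrite cv big_nil child_leaf// F0.
  by rewrite cv big_seq1.
rewrite (IH (fun v => F (child v))) => [|v vr cv]; last by rewrite child_leaf// F0.
by apply: eq_bigr => v _; rewrite iterS.
Qed.

(** A non-root vertex either has one child, so that its two contributions cancel, or is a leaf with
    F = 0; the root counts once per child. *)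
Lemma psum_telescope (F : vertex G -> R) n : unbranched ->
  (forall v, v <> r -> children v = [::] -> F v = 0) ->
  psum (fun e => F (lo e) - F (up e)) n.+1 =
    \sum_(v <- levelV n.+1) F v - F r *+ size (children r).
Proof.
move=> nb F0; have step m : \sum_(e <- levelE m) (F (lo e) - F (up e)) =
    \sum_(v <- levelV m.+1) F v - \sum_(v <- levelV m) F v *+ size (children v).
  rewrite sumrB -sum_levelVS sum_levelE; congr (_ - _); apply: eq_bigr => v _.
  rewrite (eq_big_seq (fun=> F v)) => [|e]; last by rewrite mem_children => /eqP->.
  by rewrite big_const_seq count_predT iter_addr addr0.
elim: n => [|n IH]; first by rewrite psumS step {1}/psum big_nil add0r big_seq1.
rewrite psumS IH step.
rewrite [X in _ + (_ - X)](_ : _ = \sum_(v <- levelV n.+1) F v); first by ring.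
apply: eq_big_seq => v /levelVS_neq_root vr.
have [cv|/(unbranched_children nb vr)[e -> _]//] := pselect (children v = [::]).
by rewrite cv F0.
Qed.

Lemma child_depth_cvg v : v <> r -> L - depth (iter n child v) @[n --> \oo] --> 0.
Proof.
move=> vr; apply/cvgrPdist_lt => e e0.
have [N NL] : exists N, L - e < depth (iter N child v).
  have [[m mv]|ur] := child_ray v; last by apply: (depth_ray_sup ur); lra.
  exists m; rewrite depth_leaf ?ltrBlDr ?ltrDl//.
  elim: (m) => //= k IH; rewrite /child; case: children => // e' s; exact: lo_neq_root.
exists N => // n /= Nn; rewrite sub0r normrN ger0_norm ?subr_ge0 ?depth_le_radius//.
have := anc_depth (anc_iter_child (n - N) (iter N child v)).
by rewrite -iterD subnK//; lra.
Qed.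

(** By [sum_levelV_child] all these sums run over the fixed finite level 1, so convergence along
    each descent suffices. *)
Lemma level_gap_cvg : unbranched ->
  \sum_(v <- levelV n) (L - depth v) @[n --> \oo] --> 0.
Proof.
move=> nb; rewrite -cvg_shiftS /=.
have -> : (fun n => \sum_(v <- levelV n.+1) (L - depth v)) =
    (fun n => \sum_(v <- levelV 1) (L - depth (iter n child v))).
  apply/funext => n; apply: (sum_levelV_child (F := fun v => L - depth v)) => //.
  by move=> v vr cv; rewrite depth_leaf// subrr.
have : forall v, v \in levelV 1 -> v <> r by move=> v /levelVS_neq_root.
elim: (levelV 1) => [|v s IH] vr.
  by under eq_fun do rewrite big_nil; exact: cvg_cst.
under eq_fun do rewrite big_cons.
have h1 := child_depth_cvg (vr v (mem_head _ _)).
have h2 : \sum_(v <- s) (L - depth (iter n child v)) @[n --> \oo] --> 0.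
  by apply: IH => w ws; apply: vr; rewrite inE ws orbT.
by have := cvgD h1 h2; rewrite addr0; exact.
Qed.

Lemma cos_depth_le s : 0 <= s <= L -> `|cos (omega * s)| <= omega * (L - s).
Proof.
move=> /andP[s0 sL]; have -> : cos (omega * s) = cos (omega * s) - cos (omega * L).
  by rewrite omegaL cos_pihalf subr0.
by apply: le_trans (cos_lipschitz _) _; rewrite ?mulrBr// ler_wpM2l// ltW.
Qed.

(** * The trial function on an unbranched tree *)

Section Trial.
Hypothesis nb : unbranched.
Let c e : R := if orient rt e then omega else - omega.
Let b e : R := omega * (if orient rt e then depth (up e) else depth (lo e)).
Let f x : R := cos (omega * dep x).
Let g e t : R := - c e * sin (c e * t + b e).
Local Notation mu := (@lebesgue_measure R).
Let A e := \int[mu]_(t in `[0, len e]) (g e t ^+ 2).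
Let B e := \int[mu]_(t in `[0, len e]) (on_edges f e t ^+ 2).

Let f_edge e t : 0 <= t <= len e -> on_edges f e t = cos (c e * t + b e).
Proof.
move=> te; rewrite /on_edges /f edge_pointE dep_ep; last by case: (orient rt e); lra.
congr cos; rewrite /c /b; have := depth_lo rt e.
by case: (orient rt e) => dl; rewrite ?dl; ring.
Qed.

Let fg e : H1_derivative (len e) (on_edges f e) (g e).
Proof. by have := H1_derivative_cos (len_gt0 e) (@f_edge e). Qed.

Let f_continuous : continuous f.
Proof.
move=> x; have h := lipschitz_continuous lipschitz_dep (x := x).
apply: (@cvg_comp _ _ _ (fun x => omega * dep x) cos _ (nbhs (omega * dep x))).
  have FF := nbhs_filter x.
  by apply: cvgM => //; exact: cvg_cst.
exact: continuous_cos.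
Qed.

(** The product f' f at v, with the derivative taken away from the root. *)
Let F v := - omega * sin (omega * depth v) * cos (omega * depth v).

Let F_edge e : A e - omega ^+ 2 * B e = F (lo e) - F (up e).
Proof.
have := cos_energy (len_gt0 e) (@f_edge e); rewrite -/(A e) -/(B e).
have -> : c e ^+ 2 = omega ^+ 2 by rewrite /c; case: ifP; rewrite ?sqrrN.
move=> ->; rewrite /F /c /b; have := depth_lo rt e.
case: (orient rt e) => dl.
  have -> : omega * len e + omega * depth (up e) = omega * depth (lo e) by rewrite dl; ring.
  ring.
have -> : - omega * len e + omega * depth (lo e) = omega * depth (up e) by rewrite dl; ring.
ring.
Qed.

Let c2 e : c e ^+ 2 = omega ^+ 2.
Proof. by rewrite /c; case: ifP; rewrite ?sqrrN. Qed.

Let A0 e : 0 <= A e. Proof. by apply: Rintegral_ge0 => t _; exact: sqr_ge0. Qed.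
Let B0 e : 0 <= B e. Proof. by apply: Rintegral_ge0 => t _; exact: sqr_ge0. Qed.

(** Shifted by L, the depth vanishes at the leaves as [psum_telescope] requires; this leaves L for
    each child of the root, minus nonnegative gaps. *)
Let psum_len n : psum (fun e => len e) n <= L *+ size (children r).
Proof.
apply: le_trans (psum_mono _ (leqnSn n)) _; first by move=> e; exact/ltW/len_gt0.
have -> : psum (fun e => len e) n.+1 = psum (fun e => (depth (lo e) - L) - (depth (up e) - L)) n.+1.
  by apply: eq_bigr => e _; rewrite depth_lo; ring.
rewrite (psum_telescope (F := fun v => depth v - L))//; last first.
  by move=> v vr cv; rewrite depth_leaf// subrr.
rewrite depth_root sub0r mulNrn opprK gerDr.
by rewrite -oppr_ge0 -sumrN sumr_ge0// => v _; rewrite opprB subr_ge0 depth_le_radius.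
Qed.

Let esum_bound (a : edge G -> R) (k : R) : 0 <= k -> (forall e, 0 <= a e <= k * len e) ->
  exists E, \esum_(e in [set: edge G]) (a e)%:E = E%:E.
Proof.
move=> k0 ak; exists (fine (\esum_(e in [set: edge G]) (a e)%:E)).
have a0 e : 0 <= a e by case/andP: (ak e).
rewrite fineK// ge0_fin_numE; last by apply: esum_ge0 => e _; rewrite lee_fin.
apply: le_lt_trans (ltry (k * (L *+ size (children r)))).
apply: esum_le_psum => // n; rewrite lee_fin.
apply: le_trans (ler_wpM2l k0 (psum_len n)); rewrite /psum mulr_sumr.
by apply: ler_sum => e _; case/andP: (ak e).
Qed.

(** Beyond level N the gap [L - dep] is at most one term of the level sum of gaps, which gives a
    bound uniform over all sequences approaching the end. *)
Let f_end (e : set (nat -> set (gpoint G))) : ends e -> end_value f e 0.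
Proof.
move=> [U0 eU0 ->] U x [eU _] Ux.
apply/cvgrPdist_lt => d d0.
have od : 0 < d / omega by rewrite divr_gt0.
have /cvgrPdist_lt /(_ _ od)[N _ hN] := level_gap_cvg nb.
have [n0 nU] := end_seq_avoids_level N eU.
exists n0 => // n /= n0n; rewrite sub0r normrN /f.
have xn := nU n (x n) n0n (Ux n).
have xr : bot (x n) <> r by move=> xr; move: xn; rewrite xr level_root.
have dL : 0 <= dep (x n) <= L by rewrite dep_ge0 (le_trans (dep_bot _)) ?depth_le_radius.
apply: le_lt_trans (cos_depth_le dL) _; rewrite -ltr_pdivlMl// mulrC.
have := hN N (leqnn N); rewrite /= sub0r normrN ger0_norm; last first.
  by rewrite sumr_ge0// => v _; rewrite subr_ge0 depth_le_radius.
apply: le_lt_trans.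
(* The ancestor at level N. One [par] is split off, hence the [.-1], because [depth_par_bot] places
   the parent of [bot (x n)] above [x n]. *)
pose w := iter (lev (bot (x n)) - N).-1 par (par (bot (x n))).
have wN : w \in levelV N.
  by rewrite mem_levelV /w level_iter_par level_par; apply/eqP; lia.
have wd : depth w <= dep (x n).
  by apply: le_trans (depth_iter_par _ _) _; exact/ltW/depth_par_bot.
rewrite (bigD1_seq w) ?(uniq_levels N).1//=.
have : 0 <= \sum_(i <- levelV N | i != w) (L - depth i).
  by rewrite sumr_ge0// => v _; rewrite subr_ge0 depth_le_radius.
lra.
Qed.

Lemma lambda1_le : (lambda1 D <= (omega ^+ 2)%:E)%E.
Proof.
have o0 := omega_gt0.
have [EA EAE] : exists E, \esum_(e in [set: edge G]) (A e)%:E = E%:E.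
  apply: (esum_bound (k := omega ^+ 2)); first exact: sqr_ge0.
  by move=> e; rewrite A0 -(c2 e); exact: sin_sq_le (len_gt0 e).
have [EB EBE] : exists E, \esum_(e in [set: edge G]) (B e)%:E = E%:E.
  apply: (esum_bound (k := 1)) => // e.
  by rewrite B0 mul1r; have := cos_sq_le (len_gt0 e) (@f_edge e).
have gE : sqint g = EA%:E by rewrite (sqint_derivative fg).
have fE : sqint (on_edges f) = EB%:E by rewrite (sqint_on_edges fg).
(* The partial sums differ by boundary terms F: zero at the root, as sin 0 = 0, and bounded further
   down by the vanishing sum of gaps. *)
have AB : EA = omega ^+ 2 * EB.
  apply/eqP; rewrite -subr_eq0; apply/eqP.
  have h1 := psum_tail A0 EAE; have h2 := psum_tail B0 EBE.
  have cO : (fun _ : nat => omega ^+ 2) @ \oo --> omega ^+ 2 by exact: cvg_cst.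
  have h3 : psum A n - omega ^+ 2 * psum B n @[n --> \oo] --> EA - omega ^+ 2 * EB.
    exact: cvgB h1 (cvgM cO h2).
  have h4 : psum A n - omega ^+ 2 * psum B n @[n --> \oo] --> 0.
    rewrite -cvg_shiftS /=.
    have gap : \sum_(v <- levelV n.+1) (L - depth v) @[n --> \oo] --> 0.
      by have := level_gap_cvg nb; rewrite -cvg_shiftS.
    have gap2 : omega ^+ 2 * \sum_(v <- levelV n.+1) (L - depth v) @[n --> \oo] --> 0.
      by have := cvgM cO gap; rewrite mulr0; exact.
    apply/norm_cvg0P; have z : (fun=> 0 : R) @ \oo --> (0 : R) by exact: cvg_cst.
    apply: (squeeze_cvgr _ z gap2); apply: nearW => n; rewrite normr_ge0/=.
    have -> : psum A n.+1 - omega ^+ 2 * psum B n.+1 = \sum_(v <- levelV n.+1) F v.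
      rewrite /psum mulr_sumr -sumrB; under eq_bigr do rewrite F_edge.
      have := @psum_telescope F n nb; rewrite /psum => ->.
        by rewrite /F depth_root mulr0 sin0 mulr0 mul0r mul0rn subr0.
      by move=> v vr cv; rewrite /F depth_leaf// omegaL cos_pihalf mulr0.
    apply: le_trans (ler_norm_sum _ _ _) _; rewrite mulr_sumr; apply: ler_sum => v _.
    have -> : `|F v| = omega * (`|sin (omega * depth v)| * `|cos (omega * depth v)|).
      by rewrite /F !normrM normrN (gtr0_norm o0) mulrA.
    have -> : omega ^+ 2 * (L - depth v) = omega * (omega * (L - depth v)).
      by rewrite expr2 mulrA.
    rewrite ler_wpM2l ?(ltW o0)//.
    apply: le_trans (_ : `|cos (omega * depth v)| <= _).
      by rewrite ler_piMl// sin_max.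
    by apply: cos_depth_le; rewrite depth_ge0 depth_le_radius.
  exact: cvg_unique h3 h4.
apply: le_trans (ereal_inf_lbound _) _.
  exists f, g; split; [split; [split|]| |reflexivity].
  - exact: f_continuous.
  - exact: fg.
  - by rewrite gE fE ltry.
  - case=> [v [dv vr]|e ee]; last exact: f_end.
    by rewrite /f /= depth_leaf ?omegaL ?cos_pihalf//; exact/leafP.
  - exists (vpoint r); rewrite /f /= depth_root mulr0 cos0.
    by apply/eqP; rewrite oner_neq0.
rewrite lee_fin gE fE /= AB.
(* For [EB = 0] the quotient is 0 by the convention for division. *)
have [->|EB0] := eqVneq EB 0; first by rewrite mulr0 mul0r sqr_ge0.
by rewrite mulfK.
Qed.

End Trial.

End Centre.
End Rooted.

(** * Distances in a star graph *)

Section Star.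
Variables (R : realType) (k : nat) (l : R) (l0 : 0 < l).
Local Notation SG := (star_graph k l0).

Definition star_rooting : rooting (None : vertex SG).
Proof.
apply: (@Rooting R SG None (fun=> true) (fun v => if v is Some _ then 1%N else 0%N)
  (fun=> None) (fun v => if v is Some _ then l else 0)) => //.
- by move=> e; rewrite add0r.
- by case=> [i|//] _; exists i.
Defined.

Local Notation rt := star_rooting.
Local Notation pt := (@edge_point R SG).

Lemma star_depth_par v : depth rt (par rt v) = 0.
Proof. by []. Qed.

Lemma star_unbranched : unbranched rt.
Proof. by move=> e e' _; case. Qed.

Lemma star_point z : (0 < k)%N -> exists i s, 0 <= s <= l /\ z = pt i s.
Proof.
move=> k0; have [->|[i [s [sl ->]]]] := gpointP rt z.
  exists (Ordinal k0), 0; split; first by rewrite lexx ltW.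
  by rewrite edge_point_src.
by exists i, s; split => //; move: sl => /andP[/ltW-> ->].
Qed.

Lemma star_dep i s : 0 <= s <= l -> dep rt (pt i s) = s.
Proof. by move=> sl; have := dep_ep rt (e := i) sl; rewrite add0r. Qed.

Lemma star_branch_height i j t : 0 <= t <= l ->
  branch_height rt (Some i) (pt j t) = if i == j then t else 0.
Proof.
move=> tl; have := @branch_height_ep _ _ _ rt (Some i) j t (fun h => ltac:(discriminate h)) tl.
rewrite -[ep _ _ _]/(pt j t) => ->; rewrite -[lo rt j]/(Some j).
have -> : `[< anc rt (Some i) (Some j) >] = (i == j).
  apply/asboolP/eqP => [/anc_level_eq h|->]; last exact: anc_refl.
  by have [] := h erefl.
by rewrite star_depth_par /= add0r subr0.
Qed.

(** The sum of the two depths minus twice the depth at which the paths to the common vertex meet. *)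
Lemma star_dist i s z : 0 <= s <= l ->
  dist (pt i s) z = (dep rt z + s - 2 * Num.min s (branch_height rt (Some i) z))%:E.
Proof.
move=> /andP[]; have bh0 : 0 <= branch_height rt (Some i) z.
  rewrite /branch_height; case: ifP => // _.
  by rewrite star_depth_par subr0 dep_ge0.
rewrite le_eqVlt => /predU1P[<- _|s0 sl].
  by rewrite edge_point_src// min_l// mulr0 subr0 addr0 (dist_root rt).
have bi : branch rt (Some i) (pt i s).
  have si : 0 < s <= @len R SG i by rewrite s0.
  by apply/(branch_ep rt (Some i) si); exact: anc_refl.
have sd : dep rt (pt i s) = s by apply: star_dep; rewrite ltW.
have [zi|zi] := pselect (branch rt (Some i) z).
  rewrite (unbranched_dist star_unbranched _ bi zi)// sd branch_height_in//.
  rewrite star_depth_par subr0; congr _%:E.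
  have [h|h] := leP s (dep rt z); last by rewrite gtr0_norm ?subr_gt0//; ring.
  by rewrite distrC ger0_norm ?subr_ge0//; ring.
rewrite (dist_across (rt := rt) (e := i) _ bi zi)// sd branch_height_out//.
by rewrite min_r ?(ltW s0)// mulr0 subr0 addrC.
Qed.

Lemma star_distE i s j t : 0 <= s <= l -> 0 <= t <= l ->
  dist (pt i s) (pt j t) = (t + s - 2 * Num.min s (if i == j then t else 0))%:E.
Proof. by move=> sl tl; rewrite star_dist// star_dep// star_branch_height. Qed.

Lemma star_tip i : pt i l = @vpoint R SG (Some i).
Proof. by rewrite edge_point_tgt. Qed.

End Star.

(** * An unbranched tree is a star *)

Section UnbranchedStar.
Variables (R : realType) (G : metric_graph R) (r : vertex G) (rt : rooting r).
Hypotheses (Glf : locally_finite G) (Gcentre : centre_vertex r).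
Hypothesis Gfin : (inradius (dirichlet_set r) < +oo)%E.
Hypothesis nb : unbranched rt.
Local Notation L := (radius rt Gcentre Gfin).
Local Notation dep := (dep rt).
Local Notation L0 := (radius_gt0 rt Glf Gcentre Gfin).
Local Notation k := (size (children rt r)).
Local Notation SG := (star_graph k (radius_gt0 rt Glf Gcentre Gfin)).
Local Notation pt := (@edge_point R SG).

Let k_gt0 : (0 < k)%N.
Proof. by case: (children rt r) (@children_root _ _ _ rt Glf Gfin). Qed.

Let topE (i : 'I_k) : edge G := tnth (in_tuple (children rt r)) i.

Let up_topE i : up rt (topE i) = r.
Proof. by apply/eqP; rewrite -mem_children// mem_tnth. Qed.

Let topE_inj : injective topE.
Proof. by apply/tuple_uniqP; exact: uniq_children. Qed.

(** At the root any index will do, since position 0 is the common vertex on every edge of the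
    star. *)
Let index_exists (x : gpoint G) : exists i : 'I_k,
  bot rt x <> r -> branch rt (lo rt (topE i)) x.
Proof.
have [xr|/(top_edge (rt := rt))[e er xe]] := pselect (bot rt x = r).
  by exists (Ordinal k_gt0).
have /tnthP[i ei] : e \in in_tuple (children rt r) by rewrite mem_children//; exact/eqP.
by exists i => _; rewrite /topE -ei.
Qed.

Let index x : 'I_k := projT1 (cid (index_exists x)).

Let indexP x : bot rt x <> r -> branch rt (lo rt (topE (index x))) x.
Proof. by rewrite /index; case: cid. Qed.

Let branch_bot e x : branch rt (lo rt e) x -> bot rt x <> r.
Proof.
move=> xe xr; apply: (@lo_neq_root _ _ _ rt e); apply: anc_anti (anc_root rt _).
by move: xe; rewrite /branch/= xr.
Qed.

Let index_eq i x : branch rt (lo rt (topE i)) x -> index x = i.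
Proof.
move=> xi; apply: topE_inj; apply: (top_edge_unique (rt := rt) _ _ _ xi) => //.
by apply: indexP; exact: branch_bot xi.
Qed.

Definition star_map (x : gpoint G) : gpoint SG := pt (index x) (dep x).
Local Notation phi := star_map.

Let dep_bounds x : 0 <= dep x <= L.
Proof. by rewrite dep_ge0 (le_trans (dep_bot rt _)) ?depth_le_radius. Qed.

Lemma star_map_isometry x y : dist (phi x) (phi y) = dist x y.
Proof.
rewrite /phi star_distE//; have dx := dep_ge0 rt x; have dy := dep_ge0 rt y.
have rootE z : bot rt z = r -> z = vpoint r.
  move=> zr; have [//|[e [a [ae zE]]]] := gpointP rt z.
  by move: zr; rewrite zE bot_ep// => /lo_neq_root.
have [/rootE ->|xr] := pselect (bot rt x = r).
  rewrite (dist_root rt) /= depth_root addr0 min_l ?mulr0 ?subr0//.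
  by case: ifP.
have [/rootE ->|yr] := pselect (bot rt y = r).
  by rewrite dist_sym (dist_root rt) /= depth_root add0r if_same min_r// mulr0 subr0.
have xi := indexP xr; have [ij|ij] := eqVneq (index x) (index y).
  have yi : branch rt (lo rt (topE (index x))) y by rewrite ij; exact: indexP.
  rewrite (unbranched_dist nb _ xi yi); last exact: lo_neq_root.
  congr _%:E; have [h|h] := leP (dep x) (dep y).
    by rewrite distrC ger0_norm ?subr_ge0//; ring.
  by rewrite gtr0_norm ?subr_gt0//; ring.
rewrite min_r// mulr0 subr0 addrC (dist_across (up_topE _) xi)//.
by move=> /index_eq yi; rewrite yi eqxx in ij.
Qed.

Let descend (i : 'I_k) :
  (exists v, [/\ v <> r, children rt v = [::] & anc rt (lo rt (topE i)) v]) \/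
  descending_ray rt (fun j => iter j (child rt) (lo rt (topE i))).
Proof.
have [[m mv]|] := child_ray rt Glf (lo rt (topE i)); last by right.
left; exists (iter m (child rt) (lo rt (topE i))); split=> //; last exact: anc_iter_child.
by elim: (m) => [|n IH] /=; [|rewrite /child; case: children => // e s]; exact: lo_neq_root.
Qed.

Lemma star_map_surj z : (forall i, z <> @vpoint R SG (Some i)) -> exists x, phi x = z.
Proof.
move=> zt; have [i [s [/andP[s0 sL] zE]]] := star_point z k_gt0.
have sL1 : s < L.
  by rewrite lt_neqAle sL andbT; apply/eqP => sE; apply: (zt i); rewrite zE sE star_tip.
(* Branch i contains a leaf at depth L or vertices of depth arbitrarily close to L, so only tips can
   be missed. *)
have [v iv sv] : exists2 v, anc rt (lo rt (topE i)) v & s < depth rt v.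
  have [[v [vr cv iv]]|ur] := descend i.
    by exists v => //; rewrite (depth_leaf Glf Gcentre Gfin).
  have [j sj] := depth_ray_sup ur sL1.
  by exists (iter j (child rt) (lo rt (topE i))) => //; exact: anc_iter_child.
have [x xv xs] := @point_at_depth _ _ _ rt v s ltac:(by rewrite s0 ltW).
exists x; rewrite /phi xs; move: s0; rewrite le_eqVlt => /predU1P[s0|s0].
  by rewrite zE -s0 !edge_point_src.
rewrite (@index_eq i) ?zE//.
have [//|/anc_lo[xE|]] := anc_total iv xv; first by rewrite /branch/= xE; exact: anc_refl.
rewrite up_topE => /anc_anti xr; move: s0; rewrite -xs ltNge.
by rewrite (le_trans (dep_bot rt x))// (xr (anc_root rt _)) depth_root.
Qed.

Lemma star_map_tip i : exists2 b, dirichlet_set r b &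
  match b with
  | inl v => phi (vpoint v) = @vpoint R SG (Some i)
  | inr c => end_value phi c (@vpoint R SG (Some i))
  end.
Proof.
have [[v [vr cv iv]]|ur] := descend i.
  exists (inl v); first by split=> //; exact/(leafP rt Glf).
  by rewrite /phi (@index_eq i)//= (depth_leaf Glf Gcentre Gfin)// star_tip.
set u := fun j : nat => _ in ur.
exists (inr (ray_end rt u)); first exact: ends_ray_end.
move=> U x [eU cU] Ux A; rewrite nbhsE => -[B [oB Bt] BA].
have [d d0 dB] : exists2 d : R, 0 < d & forall y, (dist (@vpoint R SG (Some i)) y < d%:E)%E -> B y.
  exact: oB.
(* Below a vertex of this branch deeper than L - d, every image is within d of the tip. *)
have [j dj] := @depth_ray_sup _ _ _ rt Gcentre Gfin u (L - d) ur ltac:(by rewrite ltrBlDr ltrDl).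
have [m [_ [Um _]]] := cU j.
exists m => // n /= mn; apply: BA; apply: dB.
have xc : branch rt (u j.+1) (x n) by apply: Um; apply: (end_seq_mono eU mn).
have xi : branch rt (lo rt (topE i)) (x n).
  by apply: anc_trans xc; exact: anc_iter_child.
have LL : 0 <= L <= L by rewrite lexx ltW// L0.
rewrite /phi (index_eq xi) -star_tip (star_distE _ _ LL (dep_bounds (x n))) eqxx.
rewrite min_r; last by case/andP: (dep_bounds (x n)).
have := branch_gt (@ray_neq_root _ _ _ rt u ur j) xc.
rewrite (ray_par ur) lte_fin; lra.
Qed.

Lemma unbranched_equilateral_star : is_equilateral_star (dirichlet_set r).
Proof.
exists k, L, (radius_gt0 rt Glf Gcentre Gfin), phi; split.
- exact: k_gt0.
- exact: star_map_isometry.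
- exact: star_map_surj.
- exact: star_map_tip.
Qed.

End UnbranchedStar.

(** * A star does not branch away from its centre *)

Section StarUnbranched.
Variables (R : realType) (G : metric_graph R) (r : vertex G) (rt : rooting r).
Hypothesis Gcentre : centre_vertex r.
Hypothesis Gfin : (inradius (dirichlet_set r) < +oo)%E.
Local Notation L := (radius rt Gcentre Gfin).
Variables (k : nat) (l : R) (l0 : 0 < l).
Local Notation SG := (star_graph k l0).
Local Notation srt := (star_rooting k l0).
Local Notation pt := (@edge_point R SG).
Variable phi : gpoint G -> gpoint SG.
Hypothesis phi_dist : forall x y, dist (phi x) (phi y) = dist x y.
Hypothesis k_gt0 : (0 < k)%N.
Local Notation tip i := (@vpoint R SG (Some i)).
Hypothesis phi_tip : forall i, exists2 b, dirichlet_set r b &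
  match b with
  | inl v => phi (vpoint v) = tip i
  | inr c => end_value phi c (tip i)
  end.

(** The image of the centre need not be the common vertex: for k = 1 it may be an inner point of the
    only edge. *)
Let z0 := phi (vpoint r).

(** The absolute value replaces the minimum in [star_dist], so that the distance is visibly
    continuous in z for the limit in [centre_tip]. *)
Let z0_dist : exists i0 s0, [/\ 0 <= s0 <= l, z0 = pt i0 s0 & forall z, dist z0 z =
  (dep srt z - branch_height srt (Some i0) z + `|s0 - branch_height srt (Some i0) z|)%:E].
Proof.
have [i0 [s0 [s0l zE]]] := star_point z0 k_gt0; exists i0, s0; split=> // z.
rewrite zE star_dist//; congr _%:E; set h := branch_height _ _ _.
have [hs|hs] := leP s0 h; last by rewrite gtr0_norm ?subr_gt0//; ring.
by rewrite distrC ger0_norm ?subr_ge0//; ring.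
Qed.

(** At an end the isometry says nothing directly. The parameter of a ray is its distance from the
    centre, hence from z0 after applying [phi]; as the images tend to the tip, every ray to the end
    has length d. *)
Lemma centre_tip i : dist z0 (tip i) = L%:E.
Proof.
have [b Db bi] := phi_tip i; have bL := centre_dist rt Gcentre Gfin Db.
case: b Db bi bL => [v _ <-|c cE ci] /=; first by rewrite phi_dist.
have [i0 [s0 [s0l zE Hz]]] := z0_dist.
pose H z := dep srt z - branch_height srt (Some i0) z + `|s0 - branch_height srt (Some i0) z|.
have [U eU cU] := ends_nonempty cE.
move=> cL; rewrite Hz -/(H _); set d := H (tip i).
have rayE m f : is_ray (vpoint r) c m f -> m = d%:E.
  move=> [f0 fd ft].
  (* These parameters tend to d, being values of H along images that converge to the tip. The bound
     [t n < m] gives [d <= m], and M close to m gives the converse. *)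
  have approach (M : R) : (0 <= M) -> (M%:E < m)%E -> exists t : nat -> R,
      [/\ forall n, M <= t n, forall n, ((t n)%:E < m)%E & t n @[n --> \oo] --> d].
    move=> M0 Mm; have /choice[t tP] : forall n, exists t, [/\ 0 <= t, (t%:E < m)%E &
        forall t', t <= t' -> (t'%:E < m)%E -> U n (f t')] by move=> n; exact: ft.
    have tm n : ((Num.max M (t n))%:E < m)%E.
      by have [_ tn _] := tP n; rewrite EFin_max gt_max Mm.
    exists (fun n => Num.max M (t n)); split=> // [n|]; first by rewrite le_max lexx.
    have ph : phi (f (Num.max M (t n))) @[n --> \oo] --> tip i.
      apply: ci cU _ => n; have [t0 tn tU] := tP n.
      by apply: tU => //; rewrite le_max lexx orbT.
    have Hf n : H (phi (f (Num.max M (t n)))) = Num.max M (t n).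
      have M1 : 0 <= Num.max M (t n) by rewrite le_max M0.
      have m0 : (0%:E < m)%E by apply: le_lt_trans (tm n); rewrite lee_fin.
      have := fd 0 _ (lexx _) M1 m0 (tm n).
      by rewrite f0 sub0r normrN (ger0_norm M1) -phi_dist Hz => -[].
    have hc : {for tip i, continuous (branch_height srt (Some i0))}.
      by apply: lipschitz_continuous; apply: lipschitz_branch_height.
    have dc : {for tip i, continuous (dep srt)}.
      by apply: lipschitz_continuous; exact: lipschitz_dep.
    have hp := cvg_comp _ _ ph hc; have dp := cvg_comp _ _ ph dc.
    have cs : (fun _ : nat => s0) @ \oo --> s0 by exact: cvg_cst.
    have Hp : H (phi (f (Num.max M (t n)))) @[n --> \oo] --> d.
      by apply: cvgD; [exact: cvgB dp hp|apply: cvg_norm; exact: cvgB cs hp].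
    by move: Hp; under eq_fun do rewrite Hf.
  have m0 : (0%:E < m)%E.
    have [t [t0 tm _]] := ft U 0%N cU.
    by apply: le_lt_trans tm; rewrite lee_fin.
  apply/le_anti/andP; split.
    rewrite leNgt; apply/negP => dm.
    have [M [dM Mm]] : exists M : R, d < M /\ (M%:E < m)%E.
      case: m dm {ft fd approach m0} => [m||] //= dm; last by exists (d + 1); rewrite ltrDl ltry.
      by rewrite lte_fin in dm; exists ((d + m) / 2); rewrite lte_fin !midf_lt.
    have [t [tM _ td]] := approach (Num.max 0 M) ltac:(by rewrite le_max lexx)
      ltac:(by rewrite EFin_max gt_max m0).
    have [N _ /(_ N (leqnn N))] := cvgr_lt _ td _ dM.
    by move=> /= h; have := tM N; rewrite ge_max => /andP[_]; rewrite leNgt h.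
  rewrite leNgt; apply/negP => md.
  have [t [_ tm td]] := approach 0 (lexx _) m0.
  have [a [ma ad]] : exists a : R, (m <= a%:E)%E /\ a < d.
    case: m md m0 {ft fd approach tm} => [m||] md m0.
    - by exists m; rewrite lexx -lte_fin.
    - by move: md; rewrite ltNge leey.
    - by move: m0; rewrite ltNge leNye.
  have [N _ /(_ N (leqnn N))] := cvgr_gt _ td _ ad.
  by move=> /= h; have := lt_le_trans (tm N) ma; rewrite lte_fin ltNge ltW.
(* Without any ray [dist_end] would be +oo, whereas it equals L. *)
have [m [f mf]] : exists m f, is_ray (vpoint r) c m f.
  apply: contrapT => nray; move: cL; rewrite /dist_end.
  rewrite (_ : [set _ | _] = set0) ?ereal_inf0//.
  by apply/seteqP; split=> // m [f mf]; apply: nray; exists m, f.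
rewrite -cL; apply/le_anti/andP; split; last first.
  by apply: ereal_inf_lbound; exists f; rewrite -(rayE m f mf).
by apply: le_ereal_inf_tmp => _ [f' /rayE->].
Qed.

(** Two points of the star at the same distance from z0 coincide or are twice that distance apart.
    Two child edges of a vertex at depth d0 > 0 would give points at distance d0 + a from the centre
    whose mutual distance lies between a and 2 a. *)
Lemma star_map_unbranched : unbranched rt.
Proof.
move=> e1 e2 e12 ur; apply: contrapT => Ne.
pose a := Num.min (len e1) (len e2).
have a0 : 0 < a by rewrite lt_min !len_gt0.
have a1 : 0 <= a <= len e1 by rewrite ltW//= ge_min lexx.
have a2 : 0 <= a <= len e2 by rewrite ltW//= ge_min lexx orbT.
pose x1 := ep rt e1 a; pose x2 := ep rt e2 a; pose d0 := depth rt (up rt e1).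
have d00 : 0 < d0 by apply: (@dep_gt0 _ _ _ rt (vpoint (up rt e1))) => -[].
have dx1 : dist z0 (phi x1) = (d0 + a)%:E by rewrite phi_dist (dist_root rt) dep_ep.
have dx2 : dist z0 (phi x2) = (d0 + a)%:E by rewrite phi_dist (dist_root rt) dep_ep// -e12.
have le12 : (dist x1 x2 <= (a + a)%:E)%E.
  apply: reach_dist; apply: (reach_trans (y := vpoint (up rt e1))).
    have := @reach_ep _ _ _ rt e1 a 0 a1; rewrite subr0 ger0_norm ?(ltW a0)// ep0.
    by apply; rewrite lexx ltW// len_gt0.
  have z2 : 0 <= (0 : R) <= len e2 by rewrite lexx ltW// len_gt0.
  have := @reach_ep _ _ _ rt e2 0 a z2 a2.
  by rewrite sub0r normrN ger0_norm ?(ltW a0)// ep0 -e12.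
have ge12 : (a%:E <= dist x1 x2)%E.
  have w1 : lo rt e1 <> r by exact: lo_neq_root.
  apply: le_trans (lipschitz_dist (lipschitz_branch_height rt w1) x1 x2).
  rewrite lee_fin !branch_height_ep//.
  rewrite par_lo asboolT; last exact: anc_refl.
  rewrite asboolF; last by move=> /anc_lo[/lo_inj|]; rewrite -?e12; [|exact: anc_up_lo].
  by rewrite subr0 [X in `|X|]addrAC subrr add0r ler_norm.
have [i0 [s0 [s0l zE]]] := star_point z0 k_gt0.
have [i1 [s1 [s1l z1E]]] := star_point (phi x1) k_gt0.
have [i2 [s2 [s2l z2E]]] := star_point (phi x2) k_gt0.
rewrite -phi_dist z1E z2E star_distE// lee_fin in le12.
rewrite -phi_dist z1E z2E star_distE// lee_fin in ge12.
rewrite zE z1E star_distE// in dx1; rewrite zE z2E star_distE// in dx2.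
move: dx1 dx2 => [dx1] [dx2].
have [s00|s00] := eqVneq s0 0.
  move: dx1 dx2; rewrite s00 !min_l; try by case: ifP => _ //; lra.
  by move: le12 ge12; case: (i1 == i2); case: (leP s1 _); lra.
(* If z0 is not the common vertex, the tip of its own edge is strictly nearer than any other tip;
   equal distances leave a single edge. *)
have all_i0 i : i = i0.
  apply/eqP; apply: contraT => ii0.
  have ll : 0 <= l <= l by rewrite lexx ltW.
  have := centre_tip i; rewrite -star_tip zE star_distE// eq_sym (negbTE ii0).
  have := centre_tip i0; rewrite -star_tip zE star_distE// eqxx => -[h1] -[h2].
  move/andP: s0l h1 h2 s00 => [s0p s0l].
  rewrite (min_l s0l) (min_r s0p) => h1 h2 /eqP; lra.
move: dx1 dx2 le12 ge12; rewrite (all_i0 i1) (all_i0 i2) eqxx.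
case: (leP s0 s1); case: (leP s0 s2); case: (leP s1 s2); lra.
Qed.

End StarUnbranched.

Theorem theorem4p17 (R : realType) (G : metric_graph R) (vc : vertex G)
    (Glf : locally_finite G) (Gtree : is_tree G)
    (Gcentre : centre_vertex vc)
    (Gfin : (inradius (dirichlet_set vc) < +oo)%E) :
  let D := dirichlet_set vc in
  let bound := (pi ^+ 2 / (4 * fine (inradius D) ^+ 2))%:E in
  (bound <= lambda1 D)%E /\
  (lambda1 D = bound <-> is_equilateral_star D).
Proof.
pose rt := @tree_rooting R G vc Gtree; have L0 := radius_gt0 rt Glf Gcentre Gfin.
move=> D; rewrite (inradiusE rt Glf Gcentre Gfin) /=.
have -> : pi ^+ 2 / (4 * radius rt Gcentre Gfin ^+ 2) =
    (pi / (2 * radius rt Gcentre Gfin)) ^+ 2 by field; rewrite gt_eqF.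
have lb := lambda1_ge rt Glf Gcentre Gfin.
split=> //; split=> [lE|[k [l [l0 [phi [k0 iso _ tips]]]]]].
  apply: (unbranched_equilateral_star Glf Gcentre Gfin (rt := rt)) => e e' ee' eD.
  apply: contrapT => Ne.
  suff : (1 < size (children rt (up rt e)))%N.
    by move=> /(branching_gap Glf Gcentre Gfin eD); rewrite -/D lE ltxx.
  apply: (@uniq_leq_size _ [:: e; e']).
    by rewrite /= inE andbT; apply/eqP.
  by move=> x; rewrite !inE mem_children// => /orP[]/eqP->; rewrite ?ee'.
apply/le_anti; rewrite lb andbT; apply: lambda1_le => //.
by move=> e e'; apply: (star_map_unbranched Gcentre Gfin iso k0 tips).
Qed.
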